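(* Let $n\ge 5$ be odd, let $2^\sharp=\frac{2n}{n-4}$, and let $(S^n,h)$ be the unit $n$-sphere with its standard metric. For $\alpha>0$ consider on $S^n$ the equation $$\left(\Delta_h+\frac{\alpha}{2}\right)^2u=u^{2^\sharp-1},\qquad u>0,\qquad (E_\alpha)$$ and let $E_m(\alpha)$ be the infimum of $E(u)=\int_{S^n}|u|^{2^\sharp}dv_h$ over all positive solutions $u\in H_2^2(S^n)$ of $(E_\alpha)$. Then there exists a sequence $(\alpha_k)$ of positive real numbers with $\alpha_k\to+\infty$ as $k\to+\infty$ such that, for every $k$, equation $(E_{\alpha_k})$ possesses a smooth positive nonconstant solution on $S^n$, and $E_m(\alpha_k)$ is not realized by the constant solution $\overline u_{\alpha_k}=(\alpha_k^2/4)^{(n-4)/8}$, i.e. $E_m(\alpha_k)<E(\overline u_{\alpha_k})$.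
   Context: Convention: $\Delta_h=-\mathrm{div}_h\nabla$ is the Laplace-Beltrami operator with nonnegative spectrum; $dv_h$ is the Riemannian volume element. $H_2^2(S^n)$ is the Sobolev space of functions $u\in L^2$ such that $|\nabla u|$ and $|\nabla^2u|$ are also in $L^2$. Solutions of the equation are always required to be positive. *)

(* Defs.v *)
From HB Require Import structures.
From mathcomp Require Import all_boot all_order all_algebra.
From mathcomp Require Import all_classical all_reals all_analysis.
From mathcomp Require Import measurable_realfun lebesgue_integral.

Set Implicit Arguments.
Unset Strict Implicit.
Unset Printing Implicit Defensive.

Import Order.TTheory GRing.Theory Num.Theory.
Import numFieldNormedType.Exports.

Local Open Scope classical_set_scope.
Local Open Scope ring_scope.

(* R^n is 'rV[R]_n.  Its library norm is the sup norm, which is used only for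
   limits and derivatives; lengths are measured by enorm below.  Its
   sigma-algebra (absent from the library) is the product one, as for tuples. *)
Section rV_measurable.
Context {R : realType} (n : nat).

Let coord (i : 'I_n) (x : 'rV[R]_n) : R := x ord0 i.

Let rV_set0 : g_sigma_preimage coord set0.
Proof. exact: sigma_algebra0. Qed.

Let rV_setC A : g_sigma_preimage coord A -> g_sigma_preimage coord (~` A).
Proof. exact: sigma_algebraC. Qed.

Let rV_bigcup (F : (set 'rV[R]_n)^nat) :
  (forall i, g_sigma_preimage coord (F i)) ->
  g_sigma_preimage coord (\bigcup_i F i).
Proof. exact: sigma_algebra_bigcup. Qed.

HB.instance Definition _ := @isMeasurable.Build
  (measure_tuple_display default_measure_display) 'rV[R]_n
  (g_sigma_preimage coord) rV_set0 rV_setC rV_bigcup.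

Lemma measurable_coord (i : 'I_n) :
  measurable_fun [set: 'rV[R]_n] (fun x : 'rV[R]_n => x ord0 i).
Proof.
move=> _ Y mY; rewrite setTI; apply: sub_sigma_algebra => /=.
rewrite -bigcup_seq/=; exists i => /=; first by rewrite mem_index_enum.
by exists Y => //; rewrite setTI.
Qed.

Lemma measurable_fun_rV d (T : measurableType d) (f : T -> 'rV[R]_n) :
  (forall i, measurable_fun [set: T] (fun x => f x ord0 i)) ->
  measurable_fun [set: T] f.
Proof.
move=> mf; suff sub : g_sigma_preimage coord `<=`
    image_set_system [set: T] f measurable by move=> _ A /sub.
apply: smallest_sub.
  by apply: sigma_algebra_image; exact: sigma_algebra_measurable.
rewrite -bigcup_seq; apply: bigcup_sub => i _ A [B mB <-].
by have := mf i measurableT _ mB; rewrite /image_set_system/= !setTI.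
Qed.

End rV_measurable.

Section lebesgue_rV.
Context {R : realType}.

Definition rV_cons n (p : measurableTypeR R * 'rV[R]_n) : 'rV[R]_n.+1 :=
  row_mx (p.1 : R)%:M p.2 : 'rV[R]_(1 + n).

Definition rV_uncons n (x : 'rV[R]_n.+1) : measurableTypeR R * 'rV[R]_n :=
  ((x : 'rV[R]_(1 + n)) ord0 (lshift n ord0), rsubmx (x : 'rV[R]_(1 + n))).

Let rV_consl n (p : measurableTypeR R * 'rV[R]_n) (j : 'I_1) :
  rV_cons p ord0 (lshift n j) = p.1.
Proof. by rewrite /rV_cons (row_mxEl (p.1 : R)%:M) (ord1 j) mxE eqxx. Qed.

Let rV_consr n (p : measurableTypeR R * 'rV[R]_n) (j : 'I_n) :
  rV_cons p ord0 (rshift 1 j) = p.2 ord0 j.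
Proof. by rewrite /rV_cons (row_mxEr (p.1 : R)%:M). Qed.

Lemma rV_consK n : cancel (@rV_cons n) (@rV_uncons n).
Proof.
case=> a x; rewrite /rV_uncons rV_consl; congr (_, _).
by apply/rowP => j; rewrite mxE rV_consr.
Qed.

Lemma measurable_rV_cons n : measurable_fun [set: _] (@rV_cons n).
Proof.
apply: measurable_fun_rV => i; case: (@split_ordP 1 n i) => j ->.
  by under eq_fun do rewrite rV_consl; exact: measurable_fst.
under eq_fun do rewrite rV_consr.
exact: (measurableT_comp (measurable_coord j) measurable_snd).
Qed.

Lemma measurable_rV_uncons n : measurable_fun setT (@rV_uncons n).
Proof.
apply/measurable_fun_pair; first exact: (@measurable_coord R n.+1).
apply: measurable_fun_rV => i; under eq_fun do rewrite mxE.
exact: (@measurable_coord R n.+1).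
Qed.

Section step.
Variables (n : nat) (m : {sigma_finite_measure set 'rV[R]_n -> \bar R}).

Definition lebesgue_rV_cons : set 'rV[R]_n.+1 -> \bar R :=
  pushforward (lebesgue_measure \x m)%E (@rV_cons n).

HB.instance Definition _ := Measure.copy lebesgue_rV_cons
  (measure_function_pushforward__canonical__measure_function_Measure
     (lebesgue_measure \x m)%E (@measurable_rV_cons n)).

Let lebesgue_rV_cons_sigma_finite : sigma_finite [set: _] lebesgue_rV_cons.
Proof.
have /sigma_finiteP[F [TF ndF Foo]] := sigma_finiteT (@lebesgue_measure R).
have /sigma_finiteP[G [TG ndG Goo]] := sigma_finiteT m.
exists (fun k => @rV_uncons n @^-1` (F k `*` G k)).
  rewrite -preimage_bigcup (_ : \bigcup_k _ = setT) ?preimage_setT//.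
  rewrite -subTset => -[x y] _.
  have [k _ Fkx] : (\bigcup_k F k) x by rewrite -TF.
  have [l _ Gly] : (\bigcup_l G l) y by rewrite -TG.
  exists (maxn k l) => //; split.
  - by move: x Fkx; exact/subsetPset/ndF/leq_maxl.
  - by move: y Gly; exact/subsetPset/ndG/leq_maxr.
move=> k; have [mF Fk] := Foo k; have [mG Gk] := Goo k; split.
  rewrite -[X in measurable X]setTI; apply: measurable_rV_uncons => //.
  exact: measurableX.
rewrite /lebesgue_rV_cons /pushforward -comp_preimage.
rewrite (_ : _ \o _ = id); last by apply/funext => p; exact: rV_consK.
rewrite (_ : id @^-1` _ = F k `*` G k)//.
by rewrite product_measure1E// lte_mul_pinfty// ge0_fin_numE.
Qed.

HB.instance Definition _ := Measure_isSigmaFinite.Build _ _ _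
  lebesgue_rV_cons lebesgue_rV_cons_sigma_finite.

End step.

Fixpoint lebesgue_rV n : {sigma_finite_measure set 'rV[R]_n -> \bar R} :=
  match n with
  | 0 => \d_(0 : 'rV[R]_0)
  | n'.+1 => lebesgue_rV_cons (lebesgue_rV n')
  end.

End lebesgue_rV.

Section sphere.
Context {R : realType} (n : nat).
Implicit Types (u v f : 'rV[R]_n.+1 -> R) (X G : 'rV[R]_n.+1 -> 'rV[R]_n.+1)
  (H T : 'rV[R]_n.+1 -> 'M[R]_n.+1) (x y : 'rV[R]_n.+1) (alpha : R).

Definition dotp x y : R := \sum_i x ord0 i * y ord0 i.

Definition enorm x : R := Num.sqrt (dotp x x).

(* S^n; a function, vector field or tensor field on S^n is a map on R^n.+1 of
   which every notion below only uses the values on S^n. *)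
Definition sphere : set 'rV[R]_n.+1 := [set x | enorm x = 1].

Definition radproj x : 'rV[R]_n.+1 := (enorm x)^-1 *: x.

Lemma measurable_enorm : measurable_fun [set: _] enorm.
Proof.
apply: (measurableT_comp (continuous_measurable_fun (@sqrt_continuous R))).
by apply: measurable_sum => i; apply: measurable_funM; exact: measurable_coord.
Qed.

Lemma measurable_radproj : measurable_fun [set: _] radproj.
Proof.
apply: measurable_fun_rV => i; under eq_fun => x.
  rewrite mxE -(powR_inv1 (sqrtr_ge0 _)); over.
apply: measurable_funM; last exact: measurable_coord.
apply: (@measurableT_comp _ _ _ _ _ _ (@powR R ^~ (-1)) _ enorm).
  exact: measurable_powR.
exact: measurable_enorm.
Qed.

Definition punctured_ball : set 'rV[R]_n.+1 := enorm @^-1` `]0, 1].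

Lemma measurable_punctured_ball : measurable punctured_ball.
Proof.
by rewrite -[X in measurable X]setTI; apply: measurable_enorm.
Qed.

Definition cone_measure : set 'rV[R]_n.+1 -> \bar R :=
  pushforward (mrestr (lebesgue_rV n.+1) measurable_punctured_ball) radproj.

HB.instance Definition _ := Measure.copy cone_measure
  (measure_function_pushforward__canonical__measure_function_Measure
     (mrestr (lebesgue_rV n.+1) measurable_punctured_ball) measurable_radproj).

(* The Riemannian volume of the unit sphere, as a measure on R^n.+1 carried by
   S^n: from dx = r^n dr dv_h one gets
   v_h(A) = (n + 1) * Lebesgue {x | 0 < |x| <= 1, x / |x| \in A}. *)
Definition dvol : {measure set 'rV[R]_n.+1 -> \bar R} :=
  mscale (n.+1%:R : R)%:nng cone_measure.

(* Differential calculus on S^n goes through the extension of a field that is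
   constant along rays; at x in S^n, its derivative in an ambient direction v
   is the derivative of the field along the tangential part of v. *)
Definition rayext (V : Type) (f : 'rV[R]_n.+1 -> V) := f \o radproj.

Definition partial (i : 'I_n.+1) f : 'rV[R]_n.+1 -> R := 'D_(delta_mx ord0 i) f.

Fixpoint Ck_punctured (k : nat) f : Prop :=
  (forall x, x != 0 -> {for x, continuous f}) /\
  match k with
  | 0 => True
  | k'.+1 => forall i : 'I_n.+1,
      (forall x, x != 0 -> derivable f x (delta_mx ord0 i)) /\
      Ck_punctured k' (partial i f)
  end.

Definition smooth f : Prop := forall k, Ck_punctured k (rayext f).

Definition tangent X : Prop := forall x, sphere x -> dotp x (X x) = 0.

Definition smooth_field X : Prop :=
  tangent X /\ forall i, smooth (fun x => X x ord0 i).

Definition tangent2 T : Prop :=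
  forall x, sphere x -> x *m T x = 0 /\ T x *m x^T = 0.

Definition smooth_field2 T : Prop :=
  tangent2 T /\ forall i j, smooth (fun x => T x i j).

Definition grad f : 'rV[R]_n.+1 -> 'rV[R]_n.+1 :=
  fun x => \row_i partial i (rayext f) x.

Definition divh X : 'rV[R]_n.+1 -> R :=
  fun x => \sum_i partial i (rayext (fun y => X y ord0 i)) x.

Definition laplace f : 'rV[R]_n.+1 -> R := fun x => - divh (grad f) x.

(* The ambient divergence on the first index; its tangential part is the
   divergence of the tensor field T. *)
Definition divh2 T : 'rV[R]_n.+1 -> 'rV[R]_n.+1 :=
  fun x => \row_j divh (fun y => \row_i T y i j) x.

Definition frobp (A B : 'M[R]_n.+1) : R := \sum_i \sum_j A i j * B i j.

Definition L2 f : Prop :=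
  measurable_fun sphere f /\
  (\int[dvol]_(x in sphere) (`|f x| ^+ 2)%:E < +oo)%E.

(* G is the gradient of u in the sense of distributions. *)
Definition weak_grad u G : Prop :=
  tangent G /\ forall X, smooth_field X ->
    \int[dvol]_(x in sphere) (u x * divh X x) =
    - \int[dvol]_(x in sphere) dotp (G x) (X x).

(* H is the covariant derivative of the tangent field G in the sense of
   distributions, H i j being the j-th component of the derivative of G in the
   i-th direction.  Only the tangential part of divh2 T matters, because G is
   tangent. *)
Definition weak_cov G H : Prop :=
  tangent2 H /\ forall T, smooth_field2 T ->
    \int[dvol]_(x in sphere) dotp (G x) (divh2 T x) =
    - \int[dvol]_(x in sphere) frobp (H x) (T x).

Definition H22 u : Prop :=
  L2 u /\ exists G H,
    [/\ weak_grad u G, (forall i, L2 (fun x => G x ord0 i)),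
        weak_cov G H & (forall i j, L2 (fun x => H x i j))].

Definition crit_exp : R := (2 * n%:R) / (n%:R - 4).

Definition bilaplace_op alpha f : 'rV[R]_n.+1 -> R :=
  let L g := fun x => laplace g x + alpha / 2 * g x in L (L f).

Definition classical_solution alpha u : Prop :=
  smooth u /\ forall x, sphere x ->
    0 < u x /\ bilaplace_op alpha u x = u x `^ (crit_exp - 1).

(* The equation is understood in the sense of distributions, the operator
   being formally self-adjoint; for u in H22, positivity is almost everywhere.
   The integrability clause makes the right-hand side a distribution. *)
Definition H22_solution alpha u : Prop :=
  [/\ H22 u,
      {ae dvol, forall x, sphere x -> 0 < u x},
      dvol.-integrable sphere (fun x => (u x `^ (crit_exp - 1))%:E) &
      forall phi, smooth phi ->
        \int[dvol]_(x in sphere) (u x * bilaplace_op alpha phi x) =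
        \int[dvol]_(x in sphere) (u x `^ (crit_exp - 1) * phi x)].

Definition energy u : \bar R :=
  (\int[dvol]_(x in sphere) (`|u x| `^ crit_exp)%:E)%E.

Definition min_energy alpha : \bar R :=
  ereal_inf [set energy u | u in [set u | H22_solution alpha u]].

Definition const_solution alpha : 'rV[R]_n.+1 -> R :=
  fun=> (alpha ^+ 2 / 4) `^ ((n%:R - 4) / 8).

End sphere.

Arguments min_energy {R} n alpha.
Arguments const_solution {R} n alpha _.

(* Main.v *)
Require Import Defs.
From mathcomp Require Import all_boot all_order all_algebra.
From mathcomp Require Import all_classical all_reals all_analysis.
From mathcomp Require Import measurable_realfun lebesgue_integral.
From mathcomp Require Import ring lra.

(* The solutions bifurcate from the constant one, among functions of the first
   coordinate t only.  Put q = n - 4, m = n + 4, p = m / q and beta = alpha / 2,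
   and look for u = c v^q, where c is the constant solution and v = 1 + s Z(t);
   since q and m are natural numbers, the equation becomes polynomial:
   (L + beta)^2 v^q = beta^2 v^m.  Its linearization
   (L + beta)^2 - p beta^2 = (L - kappa) (L + sg kappa), with
   kappa = (sqrt p - 1) beta and sg = (sqrt p + 1) / (sqrt p - 1), degenerates
   exactly when kappa is an eigenvalue lam_j of L.  The unknowns are the
   coefficients of the power series Z = p_j(t) + ..., where p_j is the monic
   Gegenbauer polynomial, together with the shift kappa - lam_j.  In a weighted
   space of coefficients the off-diagonal part of L is small, so that a branch
   of solutions is given by the contraction principle for all small s < 0.
   Integrating the equation against 1 gives int v^(n-4) = int v^(n+4), and
   v^(2n) - 1 - (n/4) (v^(n+4) - v^(n-4)) is C (s Z)^3 + O(s^4) with C > 0.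
   For even j the integral of p_j^3 is positive, by Askey's argument on the
   linearization of products of orthogonal polynomials, so int v^(2n) < int 1
   for small s < 0: the energy of u is below that of c.  Finally, j tends to
   infinity. *)

(** The substitution s = - r^2, with corrections of size r to p_j and to lam_j, settles the sign of
    s and makes the quadratic terms smaller than the unknowns by a factor r: the equation becomes x
    = Lam x - r Phi(r, x) with Lam linear. On coefficients L is upper triangular, (L a)_k = lam_k
    a_k - (k+1)(k+2) a_(k+2). Division by a diagonal of size k^4 makes the bands bounded, and among
    sequences of size delta^k reading a later coefficient gains a power of delta; hence Lam
    contracts although the eigenvalues grow. Since delta < 1, the series converge beyond [-1, 1] and
    the solutions are smooth at both poles. The energy comparison reaches third order by symmetry:
    with v = exp tau, v^(2n) - 1 = 2 v^n sinh (n tau) and v^(n+4) - v^(n-4) = 2 v^n sinh (4 tau).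
    Both sinh are odd, so once the factor n/4 cancels the term in tau, the next one is cubic, with
    coefficient 2 (n^3 - 16 n) / 6 = n (n+4) (n-4) / 3 = C. For odd j the integral of p_j^3 vanishes
    by parity, which is why j is even. *)

Set Implicit Arguments.
Unset Strict Implicit.
Unset Printing Implicit Defensive.

Import Order.TTheory GRing.Theory Num.Theory.
Import numFieldNormedType.Exports.

Local Open Scope classical_set_scope.
Local Open Scope ring_scope.

(** * Lebesgue measure *)

#[global] Arguments lebesgue_rV {R} n : simpl never.

Section affine_change_of_variables.
Context {R : realType}.
Local Open Scope ereal_scope.

Let aff (c b : R) (y : measurableTypeR R) : measurableTypeR R := (c * y + b)%R.

Let maff c b : measurable_fun [set: measurableTypeR R] (aff c b).
Proof.
apply: continuous_measurable_fun => x.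
by apply: cvgD; [apply: cvgM; [exact: cvg_cst|exact: cvg_id]|exact: cvg_cst].
Qed.

(** The image of Lebesgue measure under [x |-> c x + b], multiplied by [c], agrees with Lebesgue
    measure on half-open intervals, hence on all measurable sets. *)
Lemma lebesgue_integral_affine (c b : R) (f : measurableTypeR R -> \bar R) :
  (0 < c)%R -> measurable_fun [set: _] f -> (forall x, 0 <= f x) ->
  \int[lebesgue_measure]_x f (c * x + b)%R =
  (c^-1)%:E * \int[lebesgue_measure]_x f x.
Proof.
move=> c0 mf f0.
have ci0 : (0 <= c^-1)%R by rewrite invr_ge0 ltW.
pose nu : {measure set _ -> \bar R} :=
  measure_function_pushforward__canonical__measure_function_Measure
     (@lebesgue_measure R) (maff c b).
pose nu' : {measure set _ -> \bar R} := mscale (NngNum (ltW c0)) nu.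
have E : forall A, measurable A -> lebesgue_measure A = nu' A.
  apply: lebesgue_measure_unique => _ [[x y] _ <-].
  transitivity (c%:E * lebesgue_measure (aff c b @^-1` `]x, y]%classic)); last by [].
  have -> : aff c b @^-1` `]x, y]%classic =
      `]((x - b) / c)%R, ((y - b) / c)%R]%classic.
    apply/seteqP; split => z; rewrite /= !in_itv/= /aff => /andP[].
      move=> h1 h2; apply/andP; split.
        by rewrite ltr_pdivrMr// mulrC ltrBlDr.
      by rewrite ler_pdivlMr// mulrC lerBrDr.
    rewrite ltr_pdivrMr// ltrBlDr ler_pdivlMr// lerBrDr => h1 h2.
    by apply/andP; split; rewrite mulrC.
  rewrite !lebesgue_measure_itv/= !lte_fin ltr_pM2r ?invr_gt0// ltrD2r.
  case: ifP => _; last by rewrite mule0.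
  rewrite -!EFinB -EFinM; congr (_%:E).
  by field; rewrite gt_eqF.
have -> : \int[lebesgue_measure]_x f x = \int[nu']_x f x.
  by apply: eq_measure_integral => A mA _; exact: E.
rewrite ge0_integral_mscale// (ge0_integral_pushforward (maff c b))//=.
by rewrite muleA -EFinM mulVf ?gt_eqF// mul1e.
Qed.

Lemma measurable_affine n (c : R) (b : 'rV[R]_n) :
  measurable_fun [set: 'rV[R]_n] (fun x => c *: x + b)%R.
Proof.
apply: measurable_fun_rV => i.
under eq_fun do rewrite !mxE.
apply: measurable_funD; last exact: measurable_cst.
by apply: measurable_funM; [exact: measurable_cst|exact: measurable_coord].
Qed.

Lemma integral_lebesgue_rVS n (f : 'rV[R]_n.+1 -> \bar R) :
  measurable_fun [set: _] f -> (forall x, 0 <= f x) ->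
  \int[lebesgue_rV n.+1]_x f x =
  \int[lebesgue_measure]_y \int[lebesgue_rV n]_x f (rV_cons (y, x)).
Proof.
move=> mf f0.
transitivity (\int[pushforward (lebesgue_measure \x lebesgue_rV n) (@rV_cons R n)]_x f x).
  by [].
rewrite (ge0_integral_pushforward (@measurable_rV_cons R n))//=.
rewrite fubini_tonelli1//=.
apply: measurableT_comp => //; exact: measurable_rV_cons.
Qed.

Lemma rV_cons_lshift n (p : measurableTypeR R * 'rV[R]_n) (j : 'I_1) :
  rV_cons p ord0 (lshift n j) = p.1.
Proof. by rewrite /rV_cons (row_mxEl (p.1 : R)%:M) (ord1 j) mxE eqxx. Qed.

Lemma rV_cons_rshift n (p : measurableTypeR R * 'rV[R]_n) (j : 'I_n) :
  rV_cons p ord0 (rshift 1 j) = p.2 ord0 j.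
Proof. by rewrite /rV_cons (row_mxEr (p.1 : R)%:M). Qed.

Lemma affine_rV_cons n (c : R) (b : 'rV[R]_n.+1) y (x : 'rV[R]_n) :
  (c *: rV_cons (y, x) + b = rV_cons (c * y + (rV_uncons b).1, c *: x + (rV_uncons b).2))%R.
Proof.
apply/rowP => i; case: (@split_ordP 1 n i) => k ->.
  by rewrite 2!mxE !rV_cons_lshift (ord1 k).
by rewrite 2!mxE !rV_cons_rshift !mxE.
Qed.

(** Tonelli peels off one coordinate at each step. Dilations will yield polar coordinates, and
    translations ([c = 1]) the vanishing of integrals of derivatives. *)
Lemma lebesgue_rV_affine n (c : R) (b : 'rV[R]_n) (f : 'rV[R]_n -> \bar R) :
  (0 < c)%R -> measurable_fun [set: _] f -> (forall x, 0 <= f x) ->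
  \int[lebesgue_rV n]_x f (c *: x + b)%R =
  ((c^-1) ^+ n)%:E * \int[lebesgue_rV n]_x f x.
Proof.
move=> c0; elim: n b f => [b f mf f0|n IH b f mf f0].
  rewrite expr0 mul1e; apply: eq_integral => x _; congr f.
  by apply/rowP => -[].
rewrite integral_lebesgue_rVS//; last first.
  by apply: measurableT_comp => //; exact: measurable_affine.
rewrite integral_lebesgue_rVS//.
under eq_integral do under eq_integral do rewrite affine_rV_cons.
have mfc : measurable_fun [set: _] (f \o @rV_cons R n).
  by apply: measurableT_comp => //; exact: measurable_rV_cons.
have mF := measurable_fun_fubini_tonelli_F (m2 := lebesgue_rV n) (f \o @rV_cons R n) mfc (fun x => f0 _).
have cn0 : (0 <= c^-1 ^+ n)%R by rewrite exprn_ge0// invr_ge0 ltW.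
under eq_integral => y _.
  rewrite (IH (rV_uncons b).2 (fun x => f (rV_cons ((c * y + (rV_uncons b).1)%R, x))))//; last first.
    apply: (measurableT_comp mfc).
    by apply/measurable_fun_pair; [exact: measurable_cst|exact: measurable_id].
  over.
rewrite /= (@lebesgue_integral_affine c (rV_uncons b).1 (fun y => (c^-1 ^+ n)%:E * \int[lebesgue_rV n]_x f (rV_cons (y, x))))//.
- rewrite ge0_integralZl//; first by rewrite muleA -EFinM exprS.
  by move=> y _; apply: integral_ge0.
- by apply: emeasurable_funM => //; exact: mF.
- by move=> y; rewrite mule_ge0//; exact: integral_ge0.
Qed.

End affine_change_of_variables.

(** * Euclidean norm and spherical measure *)

Section lebesgue_rV_facts.
Context {R : realType}.

Definition rV_box n (a b : R) : set 'rV[R]_n :=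
  [set x | forall i, a <= x ord0 i <= b].

Arguments rV_box : clear implicits.

Lemma measurable_rV_box n (a b : R) : measurable (rV_box n a b).
Proof.
have -> : rV_box n a b =
    \bigcap_(i in [set: 'I_n]) ((fun x : 'rV[R]_n => x ord0 i) @^-1` `[a, b]%classic).
  apply/seteqP; split => x /= h i; first by move=> _; rewrite /= in_itv/=.
  by have := h i I; rewrite /= in_itv/=.
apply: fin_bigcap_measurable => // i _.
rewrite -[X in measurable X]setTI; apply: measurable_coord => //.
Qed.

Lemma lebesgue_rV_box n (a b : R) : a < b ->
  lebesgue_rV n (rV_box n a b) = ((b - a) ^+ n)%:E.
Proof.
move=> ab; elim: n => [|n IH].
  by rewrite /= diracE expr0 mem_set// => -[].
transitivity ((lebesgue_measure \x lebesgue_rV n)%E (@rV_cons R n @^-1` rV_box n.+1 a b)).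
  by [].
have -> : @rV_cons R n @^-1` rV_box n.+1 a b = `[a, b]%classic `*` rV_box n a b.
  apply/seteqP; split => [[y x] h|[y x] [/= h1 h2] i].
    split => /= [|i].
      by have := h (@lshift 1 n ord0); rewrite rV_cons_lshift /= in_itv.
    by have := h (@rshift 1 n i); rewrite rV_cons_rshift.
  case: (@split_ordP 1 n i) => k ->.
    by move: h1; rewrite rV_cons_lshift in_itv.
  by rewrite rV_cons_rshift.
rewrite product_measure1E//; last exact: measurable_rV_box.
rewrite IH /= lebesgue_measure_itv/= lte_fin ab -EFinB -EFinM.
by rewrite exprS.
Qed.

Lemma cvg_floor_approx (y : R) :
  (fun k => (Num.floor (k.+1%:R * y))%:~R / k.+1%:R : R) @ \oo --> y.
Proof.
apply/cvgrPdist_le => e e0; near=> k.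
have k0 : (0 : R) < k.+1%:R by rewrite ltr0n.
have /andP[h1 h2] := floor_itv (k.+1%:R * y).
rewrite intrD in h2.
set z := (Num.floor _)%:~R in h1 h2 *.
have -> : y - z / k.+1%:R = (k.+1%:R * y - z) / k.+1%:R.
  by field; rewrite addrC natr1 pnatr_eq0.
rewrite normrM normfV (ger0_norm (ltW k0)) ler_pdivrMr// ger0_norm ?subr_ge0//.
apply: (@le_trans _ _ 1); first by rewrite lerBlDl ltW.
rewrite -ler_pdivrMl// mulr1; near: k.
have := near_infty_natSinv_lt (PosNum e0); apply: filterS => k /= /ltW.
by rewrite invf_ple ?posrE ?ltr0n.
Unshelve. all: by end_near. Qed.

(** The sigma-algebra is generated by the coordinates, so continuity has to be turned into
    measurability: [f] is the limit of its values at [x] rounded down to the grid of mesh 1/(k+1),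
    and each of these functions is constant on countably many measurable cells. Grid points may
    leave [D]; only continuity at the points of [D] matters. *)
Lemma continuous_measurable_rV n (f : 'rV[R]_n -> R) (D : set 'rV[R]_n) :
  measurable D -> (forall x, D x -> {for x, continuous f}) ->
  measurable_fun D f.
Proof.
move=> mD cf.
pose d (k : nat) (z : 'rV[int]_n) : 'rV[R]_n := \row_i ((z ord0 i)%:~R / k.+1%:R).
pose fl (k : nat) (x : 'rV[R]_n) : 'rV[int]_n := \row_i Num.floor (k.+1%:R * x ord0 i).
have mfl k z : measurable [set x | fl k x = z].
  have -> : [set x | fl k x = z] = \bigcap_(i in [set: 'I_n])
     ((fun x : 'rV[R]_n => k.+1%:R * x ord0 i) @^-1` `[(z ord0 i)%:~R, (z ord0 i + 1)%:~R[%classic).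
    apply/seteqP; split => x /=.
      by move=> <- i _; rewrite /= mxE in_itv/= floor_itv.
    move=> h; apply/rowP => i; rewrite mxE; apply/eqP.
    by have := h i I; rewrite /= in_itv/= floor_eq.
  apply: fin_bigcap_measurable => // i _.
  rewrite -[X in measurable X]setTI.
  have mm : measurable_fun [set: 'rV[R]_n] (fun x : 'rV[R]_n => k.+1%:R * x ord0 i).
    by apply: measurable_funM; [exact: measurable_cst|exact: measurable_coord].
  exact: mm.
have H2 (x : 'rV[R]_n) : (fun k => d k (fl k x)) @ \oo --> x.
  apply/cvg_mx_entourageP => A eA.
  have H i : \forall k \near \oo, A (x ord0 i, d k (fl k x) ord0 i).
    have /cvg_entourageP/(_ A eA) hA := @cvg_floor_approx (x ord0 i).
    have : \forall k \near \oo,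
      A (x ord0 i, (Num.floor (k.+1%:R * x ord0 i))%:~R / k.+1%:R) by exact: hA.
    by apply: filterS => k; rewrite !mxE.
  have {}H := @filter_forall nat _ (fun i k => A (x ord0 i, d k (fl k x) ord0 i))
    \oo eventually_filter H.
  have : \forall k \near \oo, forall (i : 'I_1) j, (x i j, d k (fl k x) i j) \in A.
    2: by [].
  apply: filterS H => k h i j.
  by rewrite (ord1 i) inE; exact: h.
apply: (@measurable_fun_cvg _ _ R D (fun k x => f (d k (fl k x)))) => //.
  move=> k; apply: measurable_funTS => _ Y mY; rewrite setTI.
  have -> : (fun x => f (d k (fl k x))) @^-1` Y =
    \bigcup_z [set x | Y (f (d k z)) /\ fl k x = z].
    apply/seteqP; split => x /=; first by move=> h; exists (fl k x).
    by move=> [z _ /= [+ ->]].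
  apply: countable_bigcupT_measurable => // z.
  have [Yz|nYz] := pselect (Y (f (d k z))).
    rewrite (_ : mkset _ = [set x | fl k x = z]); first exact: mfl.
    by apply/seteqP; split => x /= [].
  by rewrite (_ : mkset _ = set0)//; apply/seteqP; split => x //= [].
by move=> x Dx; exact: (cvg_trans (cvg_app f (H2 _)) (cf x Dx)).
Qed.

End lebesgue_rV_facts.
Arguments rV_box {R} n a b _.

Lemma ge0_integral_mrestr d (T : measurableType d) (R : realType)
    (mu : {measure set T -> \bar R}) (D E : set T) (mD : measurable D)
    (f : T -> \bar R) :
  measurable E -> D `<=` E -> measurable_fun E f ->
  (forall x, E x -> (0 <= f x)%E) ->
  (\int[mrestr mu mD]_(x in E) f x = \int[mu]_(x in D) f x)%E.
Proof.
move=> mE DE mf f0.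
have N0 : mrestr mu mD (E `\` D) = 0%E by rewrite /mrestr setDKI measure0.
rewrite (@ge0_negligible_integral _ _ _ _ E (E `\` D))//.
- rewrite setDD setIidr//; apply: eq_measure_integral => A mA AB.
  by rewrite /= /mrestr setIidl.
- exact: measurableD.
Qed.

Section enorm_facts.
Context {R : realType} (n : nat).
Implicit Types (x y : 'rV[R]_n.+1).
Local Notation sphere := (@sphere R n).
Local Notation enorm := (@enorm R n).
Local Notation radproj := (@radproj R n).
Local Notation punctured_ball := (@punctured_ball R n).
Local Notation dvol := (@dvol R n).

Lemma dotp_ge0 x : 0 <= dotp x x.
Proof. by apply: sumr_ge0 => i _; rewrite -expr2 sqr_ge0. Qed.

Lemma enorm_ge0 x : 0 <= enorm x.
Proof. exact: sqrtr_ge0. Qed.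

Lemma sqr_enorm x : enorm x ^+ 2 = dotp x x.
Proof. by rewrite sqr_sqrtr// dotp_ge0. Qed.

Lemma dotpZ (c : R) x y : dotp (c *: x) y = c * dotp x y.
Proof. by rewrite mulr_sumr; apply: eq_bigr => i _; rewrite mxE mulrA. Qed.

Lemma dotpC x y : dotp x y = dotp y x.
Proof. by apply: eq_bigr => i _; rewrite mulrC. Qed.

Lemma enormZ (c : R) x : enorm (c *: x) = `|c| * enorm x.
Proof.
rewrite /enorm dotpZ dotpC dotpZ mulrA -expr2 sqrtrM ?sqr_ge0//.
by rewrite sqrtr_sqr.
Qed.

Lemma normr_coord_le_enorm x i : `|x ord0 i| <= enorm x.
Proof.
rewrite -(ler_pXn2r (n := 2)) ?nnegrE ?enorm_ge0// sqr_enorm real_normK ?num_real//.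
rewrite /dotp (bigD1 i)//= -expr2 lerDl.
by apply: sumr_ge0 => j _; rewrite -expr2 sqr_ge0.
Qed.

Lemma enorm_eq0 x : (enorm x == 0) = (x == 0).
Proof.
apply/eqP/eqP => [x0|->]; last first.
  by rewrite /enorm /dotp big1 ?sqrtr0// => i _; rewrite mxE mul0r.
apply/rowP => i; apply/eqP; rewrite mxE -normr_le0 -x0.
exact: normr_coord_le_enorm.
Qed.

Lemma enorm_gt0 x : (0 < enorm x) = (x != 0).
Proof. by rewrite lt_def enorm_ge0 andbT enorm_eq0. Qed.

Lemma sphere_neq0 x : sphere x -> x != 0.
Proof. by rewrite /sphere /= -enorm_gt0 => ->. Qed.

Lemma sphere_radproj x : x != 0 -> sphere (radproj x).
Proof.
rewrite -enorm_gt0 => x0; rewrite /sphere /radproj /= enormZ.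
by rewrite gtr0_norm ?invr_gt0// mulVf// gt_eqF.
Qed.

Lemma radproj_id x : sphere x -> radproj x = x.
Proof. by rewrite /sphere /radproj /= => ->; rewrite invr1 scale1r. Qed.

Lemma radprojZ (c : R) x : 0 < c -> radproj (c *: x) = radproj x.
Proof.
move=> c0; rewrite /radproj enormZ gtr0_norm// scalerA; congr (_ *: _).
by rewrite invfM -mulrA [_^-1 * c]mulrC mulrA mulVf ?mul1r// gt_eqF.
Qed.

Lemma radprojE x : x != 0 -> x = enorm x *: radproj x.
Proof. by rewrite -enorm_gt0 => x0; rewrite scalerA divff ?scale1r// gt_eqF. Qed.

Lemma continuous_coord i : continuous (fun x => x ord0 i).
Proof. exact: coord_continuous. Qed.

Lemma continuous_rsum (I : Type) (r : seq I) (f : I -> 'rV[R]_n.+1 -> R) :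
  (forall i, continuous (f i)) -> continuous (fun x => \sum_(i <- r) f i x).
Proof.
move=> cf x; elim: r => [|i r IH].
  by under eq_fun do rewrite big_nil; exact: cst_continuous.
under eq_fun do rewrite big_cons.
by apply: (@continuousD _ R^o _ (f i) (fun y => \sum_(j <- r) f j y)) => //; exact: cf.
Qed.

Lemma continuous_dotpxx : continuous (fun x : 'rV[R]_n.+1 => dotp x x).
Proof.
apply: continuous_rsum => i x.
by apply: (@continuousM R _ (fun x => x ord0 i) (fun x => x ord0 i)); exact: continuous_coord.
Qed.

Lemma continuous_enorm : continuous enorm.
Proof.
move=> x; apply: (@continuous_comp _ _ _ (fun x => dotp x x) Num.sqrt).
  exact: continuous_dotpxx.
exact: sqrt_continuous.
Qed.

Lemma measurable_sphere : measurable sphere.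
Proof.
rewrite (_ : sphere = enorm @^-1` [set (1:R)])//.
by rewrite -[X in measurable X]setTI; apply: measurable_enorm.
Qed.

Lemma measurable_neq0 : measurable [set x : 'rV[R]_n.+1 | x != 0].
Proof.
rewrite (_ : mkset _ = enorm @^-1` `]0, +oo[%classic); last first.
  by apply/seteqP; split => x /=; rewrite in_itv/= andbT enorm_gt0.
by rewrite -[X in measurable X]setTI; apply: measurable_enorm.
Qed.

Lemma punctured_ballP x : punctured_ball x <-> x != 0 /\ enorm x <= 1.
Proof.
rewrite /punctured_ball /= in_itv/= enorm_gt0.
by split => [/andP//|[-> ->]].
Qed.

Lemma lebesgue_punctured_ball_fin :
  (lebesgue_rV n.+1 punctured_ball < +oo)%E.
Proof.
apply: (@le_lt_trans _ _ (lebesgue_rV n.+1 (rV_box n.+1 (-1) (1 : R)))).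
  apply: le_measure; rewrite ?inE; [exact: measurable_punctured_ball|exact: measurable_rV_box|].
  move=> x /punctured_ballP[_ x1] i; rewrite -ler_norml.
  exact: le_trans (normr_coord_le_enorm x i) x1.
by rewrite lebesgue_rV_box ?ltry// ltrN10 ?ltr01.
Qed.

Lemma lebesgue_punctured_ball_gt0 :
  (0 < lebesgue_rV n.+1 punctured_ball)%E.
Proof.
(* Coordinates in [r/2, r] are nonzero, and their squares are at most [r], so that they sum to at
   most (n + 1) r = 1. *)
pose r : R := n.+1%:R^-1.
have r0 : 0 < r by rewrite invr_gt0 ltr0n.
apply: (@lt_le_trans _ _ (lebesgue_rV n.+1 (rV_box n.+1 (r / 2) r))).
  rewrite lebesgue_rV_box; last by rewrite ltr_pdivrMr// ltr_pMr// ltr1n.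
  rewrite lte_fin exprn_gt0// subr_gt0.
  by rewrite ltr_pdivrMr// ltr_pMr// ltr1n.
apply: le_measure; rewrite ?inE; [exact: measurable_rV_box|exact: measurable_punctured_ball|].
move=> x h; apply/punctured_ballP; split.
  apply/eqP => x0; have := h ord0; rewrite x0 mxE => /andP[+ _].
  by rewrite leNgt divr_gt0.
rewrite -(ler_pXn2r (n := 2)) ?nnegrE ?enorm_ge0// sqr_enorm expr1n.
apply: (@le_trans _ _ (\sum_(i < n.+1) r)).
  apply: ler_sum => i _; have /andP[h1 h2] := h i.
  have h0 : 0 <= x ord0 i by apply: le_trans h1; rewrite divr_ge0 ?ltW.
  rewrite -[leRHS]mulr1 ler_pM// (le_trans h2)// invf_le1 ?ltr0n// ler1n//.
by rewrite sumr_const card_ord -mulr_natr mulVf// pnatr_eq0.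
Qed.

Lemma integral_dvol (f : 'rV[R]_n.+1 -> \bar R) :
  measurable_fun sphere f -> (forall x, sphere x -> (0 <= f x)%E) ->
  (\int[dvol]_(x in sphere) f x =
   n.+1%:R%:E * \int[lebesgue_rV n.+1]_(x in punctured_ball) f (radproj x))%E.
Proof.
move=> mf f0; have mS := measurable_sphere.
have mPB := @measurable_punctured_ball R n.
apply: (etrans (ge0_integral_mscale (@cone_measure R n) mS _ mf f0)).
congr (_ * _)%E.
transitivity (\int[pushforward (mrestr (lebesgue_rV n.+1) mPB) radproj]_(x in sphere) f x)%E.
  by [].
have f0' : {in sphere, forall y, (0 <= f y)%E} by move=> x; rewrite inE => /f0.
rewrite (ge0_integral_pushforward (@measurable_radproj R n) _ mS mf f0').
have mD : measurable (radproj @^-1` sphere).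
  by rewrite -[X in measurable X]setTI; apply: measurable_radproj.
have sub : punctured_ball `<=` radproj @^-1` sphere.
  by move=> x /punctured_ballP[x0 _]; exact: sphere_radproj.
have mfr : measurable_fun (radproj @^-1` sphere) (f \o radproj).
  apply: (measurable_comp mS) => //; last exact: measurable_funTS (@measurable_radproj R n).
  by move=> _ [x Dx <-].
by rewrite ge0_integral_mrestr// => x /f0.
Qed.

End enorm_facts.

(** * Polar coordinates in the form of radial moments *)

Section power_integral.
Context {R : realType}.
Notation mu := (@lebesgue_measure R).

Lemma integral_power_itv (a : R) (k : nat) : a <= 1 ->
  (\int[mu]_(s in `[a, 1%R]) (k.+1%:R * s ^+ k)%:E = (1 - a ^+ k.+1)%:E)%E.
Proof.
rewrite le_eqVlt => /predU1P[->|a1].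
  by rewrite set_itv1 integral_set1 expr1n subrr.
have cf : continuous (fun s : R => k.+1%:R * s ^+ k).
  by move=> x; apply: cvgM; [exact: cvg_cst|exact: exprn_continuous].
rewrite (@continuous_FTC2 R _ (fun x => x ^+ k.+1))//.
- by rewrite expr1n.
- exact: continuous_subspaceT.
- split => [x _||].
  + exact: exprn_derivable.
  + by apply: cvg_at_right_filter; exact: exprn_continuous.
  + by apply: cvg_at_left_filter; exact: exprn_continuous.
- move=> x _; rewrite derive1E exp_derive /GRing.scale /= mulr1.
  by rewrite mulrC.
Qed.

End power_integral.

Section radial_moments.
Context {R : realType} (n : nat).
Local Notation N := n.+1.
Local Notation sphere := (@sphere R n).
Local Notation enorm := (@enorm R n).
Local Notation radproj := (@radproj R n).
Local Notation punctured_ball := (@punctured_ball R n).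
Local Notation dvol := (@dvol R n).
Local Notation lam := (lebesgue_rV N : {measure set 'rV[R]_N -> \bar R}).
Local Notation mu := (@lebesgue_measure R).

Lemma measurable_le_indicator d (T : measurableType d) (f g : T -> R) :
  measurable_fun [set: T] f -> measurable_fun [set: T] g ->
  measurable_fun [set: T] (fun t => (f t <= g t)%R%:R : R).
Proof.
move=> mf mg.
have := measurable_fun_le measurableT mf mg; rewrite setTI => mA.
rewrite (_ : (fun t => _) = \1_[set t | f t <= g t]).
  exact: measurable_indic.
apply/funext => t; rewrite indicE; congr ((nat_of_bool _)%:R).
by apply/idP/idP; rewrite inE.
Qed.

Section nonneg_radial.
Variable h : 'rV[R]_N -> R.
Hypothesis mh : measurable_fun [set: _] h.
Hypothesis h0 : forall x, 0 <= h x.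
Hypothesis hZ : forall (c : R) x, 0 < c -> h (c *: x) = h x.
Hypothesis h00 : h 0 = 0.

Let mhle s : measurable_fun [set: 'rV[R]_N] (fun x => (h x * (enorm x <= s)%R%:R)%:E).
Proof.
apply/measurable_EFinP; apply: measurable_funM => //.
by apply: measurable_le_indicator; [exact: measurable_enorm|exact: measurable_cst].
Qed.

Let ball_integral s := (\int[lam]_x (h x * (enorm x <= s)%R%:R)%:E)%E.

Lemma ball_integral_scale s : 0 < s ->
  ball_integral s = ((s ^+ N)%:E * ball_integral 1%R)%E.
Proof.
move=> s0; have si0 : 0 < s^-1 by rewrite invr_gt0.
have := @lebesgue_rV_affine R N s^-1 0 (fun x => (h x * (enorm x <= 1)%R%:R)%:E) si0 (mhle 1).
rewrite invrK => <-; last by move=> x; rewrite lee_fin mulr_ge0.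
apply: eq_integral => x _; rewrite addr0 hZ// enormZ gtr0_norm//.
by rewrite [s^-1 * _]mulrC ler_pdivrMr// mul1r.
Qed.

Let wt k (s : measurableTypeR R) : R := k.+1%:R * s ^+ k * (0 <= s)%R%:R * (s <= 1)%R%:R.

Let mwt k : measurable_fun [set: measurableTypeR R] (wt k).
Proof.
rewrite /wt; do 2![apply: measurable_funM; last by apply: measurable_le_indicator].
by apply: measurable_funM => //; exact: exprn_measurable.
Qed.

Let wt0 k s : 0 <= wt k s.
Proof.
rewrite /wt; case: (leP 0 s) => [s0|_]; last by rewrite mulr0 mul0r.
by rewrite !mulr_ge0// exprn_ge0.
Qed.

Let ge0_itvE (a : R) (g : R -> R) : 0 <= a -> measurable_fun [set: measurableTypeR R] g ->
  (\int[mu]_s (g s * (0 <= s)%R%:R * (s <= 1)%R%:R * (a <= s)%R%:R)%:E =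
   \int[mu]_(s in `[a, 1%R]) (g s)%:E)%E.
Proof.
move=> a0 mg; rewrite [RHS]integral_mkcond; apply: eq_integral => s _.
rewrite patchE; case: ifPn => [|].
  rewrite inE /= in_itv/= => /andP[as1 ->]; rewrite as1 (le_trans a0 as1).
  by rewrite !mulr1.
rewrite notin_setE /= in_itv/= => /negP; rewrite negb_and => /orP[/negbTE ->|/negbTE ->].
  by rewrite mulr0.
by rewrite mulr0 mul0r.
Qed.

Let mexp k : measurable_fun [set: measurableTypeR R] (fun s => k.+1%:R * s ^+ k : R).
Proof. by apply: measurable_funM => //; exact: exprn_measurable. Qed.

(** Polar coordinates reduced to dilations: for k > 0, 1 - |x|^k is the integral of k s^(k-1) over
    [|x|, 1]. Tonelli then yields integrals of [h] over balls of radius [s], which scale like s^N,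
    so that 1 - |x|^k contributes the fraction k / (N + k) of the integral over the unit ball, and
    |x|^k the rest. *)
Lemma radial_moment_ge0 k : (ball_integral 1%R < +oo)%E ->
  (\int[lam]_x (h x * enorm x ^+ k * (enorm x <= 1)%R%:R)%:E =
   (N%:R / (N + k)%:R)%:E * ball_integral 1%R)%E.
Proof.
case: k => [|k] I1.
  rewrite addn0 divff ?pnatr_eq0// mul1e; apply: eq_integral => x _.
  by rewrite expr0 mulr1.
have I1f : ball_integral 1%R \is a fin_num.
  by rewrite ge0_fin_numE// integral_ge0// => x _; rewrite lee_fin mulr_ge0.
have B0 : ball_integral 0%R = 0%E.
  apply: integral0_eq => x _; rewrite le_eqVlt ltNge enorm_ge0 orbF enorm_eq0.
  by case: eqP => [->|_]; rewrite ?h00 ?mul0r ?mulr0.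
pose G (p : measurableTypeR R * 'rV[R]_N) : \bar R :=
  (wt k p.1 * (h p.2 * (enorm p.2 <= p.1)%R%:R))%:E.
have mG : measurable_fun [set: _] G.
  apply/measurable_EFinP; apply: measurable_funM.
    exact: (measurableT_comp (mwt k) measurable_fst).
  apply: measurable_funM; first exact: (measurableT_comp mh measurable_snd).
  apply: measurable_le_indicator; last exact: measurable_fst.
  exact: (measurableT_comp (@measurable_enorm R n) measurable_snd).
have G0 p : (0 <= G p)%E by rewrite lee_fin mulr_ge0// mulr_ge0.
have E := fubini_tonelli (m1 := mu) (m2 := lebesgue_rV N) G mG G0.
have EL : (\int[mu]_s \int[lebesgue_rV N]_x G (s, x) =
    (k.+1%:R / (N + k.+1)%:R)%:E * ball_integral 1%R)%E.
  transitivity (\int[mu]_s ((k.+1%:R / (N + k.+1)%:R * wt (k + N) s)%:E * ball_integral 1%R))%E.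
    apply: eq_integral => s _; rewrite /G /=.
    under eq_integral do rewrite EFinM.
    rewrite ge0_integralZl//; last 2 first.
    - by move=> x _; rewrite lee_fin mulr_ge0.
    - by rewrite lee_fin.
    case: (ltP 0 s) => s0.
      rewrite -/(ball_integral s) ball_integral_scale// muleA -EFinM.
      congr (_%:E * _)%E; rewrite /wt exprD addSn addnC -!addSnnS.
      have : (k.+1 + n).+1%:R != 0 :> R by rewrite pnatr_eq0.
      by move: (_.+1%:R : R) => c c0; field.
    move: s0; rewrite le_eqVlt => /predU1P[->|s0].
      rewrite -/(ball_integral 0%R) B0 mule0.
      have -> : wt (k + N) 0 = 0.
        by rewrite /wt exprD [0 ^+ N]exprS mul0r !(mulr0, mul0r).
      by rewrite mulr0 mul0e.
    by rewrite /wt leNgt s0 !(mulr0, mul0r) !mul0e.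
  rewrite ge0_integralZr//; last 3 first.
  - by apply/measurable_EFinP; apply: measurable_funM => //.
  - by move=> x _; rewrite lee_fin mulr_ge0// divr_ge0.
  - by apply: integral_ge0 => x _; rewrite lee_fin mulr_ge0.
  congr (_ * _)%E.
  under eq_integral do rewrite EFinM.
  rewrite ge0_integralZl//; last 2 first.
  - exact/measurable_EFinP.
  - by move=> x _; rewrite lee_fin.
  rewrite (_ : (\int[mu]_x _)%E = 1%E) ?mule1//.
  transitivity (\int[mu]_s ((k + N).+1%:R * s ^+ (k + N) * (0 <= s)%R%:R * (s <= 1)%R%:R * (0 <= s)%R%:R)%:E)%E.
    apply: eq_integral => s _; rewrite /wt; congr (_%:E).
    by case: (0 <= s); rewrite ?mulr1// !mulr0 ?mul0r.
  by rewrite (ge0_itvE (lexx 0) (mexp _)) integral_power_itv// expr0n/= subr0.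
have ER : (\int[lebesgue_rV N]_x \int[mu]_s G (s, x) =
    \int[lam]_x (h x * (1 - enorm x ^+ k.+1) * (enorm x <= 1)%R%:R)%:E)%E.
  apply: eq_integral => x _; rewrite /G /=.
  under eq_integral.
    move=> s _.
    rewrite [h x * _]mulrC mulrA mulrC EFinM; over.
  rewrite ge0_integralZl//; last 3 first.
  - apply/measurable_EFinP; apply: measurable_funM => //.
    by apply: measurable_le_indicator.
  - by move=> s _; rewrite lee_fin mulr_ge0.
  - by rewrite lee_fin.
  rewrite -mulrA EFinM; congr (_ * _)%E.
  rewrite (ge0_itvE (enorm_ge0 x) (mexp _)).
  case: (leP (enorm x) 1) => x1; first by rewrite integral_power_itv// mulr1.
  by rewrite mulr0 set_itv_ge ?integral_set0// bnd_simp -ltNge.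
have mM : measurable_fun [set: 'rV[R]_N] (fun x => (h x * enorm x ^+ k.+1 * (enorm x <= 1)%R%:R)%:E).
  apply/measurable_EFinP; apply: measurable_funM.
    apply: measurable_funM => //; apply: measurable_funX; exact: measurable_enorm.
  by apply: measurable_le_indicator => //; exact: measurable_enorm.
have S : (\int[lam]_x (h x * enorm x ^+ k.+1 * (enorm x <= 1)%R%:R)%:E +
   \int[lam]_x (h x * (1 - enorm x ^+ k.+1) * (enorm x <= 1)%R%:R)%:E =
   ball_integral 1%R)%E.
  rewrite -ge0_integralD//.
  - apply: eq_integral => x _; rewrite -EFinD; congr (_%:E); ring.
  - by move=> x _; rewrite lee_fin !mulr_ge0// exprn_ge0// enorm_ge0.
  - move=> x _; rewrite lee_fin; case: (leP (enorm x) 1) => x1; last by rewrite mulr0.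
    by rewrite !mulr_ge0// subr_ge0 exprn_ile1// enorm_ge0.
  - apply/measurable_EFinP; apply: measurable_funM.
      apply: measurable_funM => //; apply: measurable_funB => //.
      by apply: measurable_funX; exact: measurable_enorm.
    by apply: measurable_le_indicator => //; exact: measurable_enorm.
move: E; rewrite EL ER => E; move: S; rewrite -E.
move: I1f; case: (ball_integral 1%R) => // I _.
case: (\int[lam]_x _)%E => // M [] /= S.
rewrite -EFinM; congr (_%:E).
have -> : M = I - k.+1%:R / (N + k.+1)%:R * I.
  by rewrite -[X in X - _]S addrK.
have -> : N%:R = (N + k.+1)%:R - k.+1%:R :> R by rewrite natrD addrK.
have : (N + k.+1)%:R != 0 :> R by rewrite pnatr_eq0.
by move: (N + k.+1)%:R => c c0; field.
Qed.

End nonneg_radial.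

(** An algebra of integrable functions on the sphere: every integrand below lies in it, so that
    integrability is checked by closure properties alone. *)
Definition sphere_bounded (f : 'rV[R]_N -> R) : Prop :=
  measurable_fun sphere f /\ exists K, forall x, sphere x -> `|f x| <= K.

Lemma dvol_sphereE : (dvol sphere = N%:R%:E * lam punctured_ball)%E.
Proof.
have := @integral_dvol R n (cst 1%E) (measurable_cst _) (fun=> ltac:(by [])).
rewrite integral_cst ?mul1e => [->|]; last exact: measurable_sphere.
congr (_ * _)%E; transitivity (\int[lam]_(x in punctured_ball) cst 1%E x)%E => //.
by rewrite integral_cst ?mul1e//; exact: measurable_punctured_ball.
Qed.

Lemma dvol_sphere_fin : (dvol sphere < +oo)%E.
Proof.
rewrite dvol_sphereE lte_mul_pinfty//; exact: lebesgue_punctured_ball_fin.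
Qed.

Lemma dvol_sphere_gt0 : (0 < dvol sphere)%E.
Proof.
by rewrite dvol_sphereE mule_gt0//; exact: lebesgue_punctured_ball_gt0.
Qed.

Lemma sphere_bounded_integrable f : sphere_bounded f ->
  dvol.-integrable sphere (EFin \o f).
Proof.
move=> [mf [K fK]]; apply: measurable_bounded_integrable => //.
- exact: measurable_sphere.
- exact: dvol_sphere_fin.
exists K; split; first exact: num_real.
by move=> L KL x Sx; rewrite /= (le_trans (fK x Sx))// ltW.
Qed.

Lemma sphere_bounded_cst c : sphere_bounded (fun=> c).
Proof. by split; [exact: measurable_cst|exists `|c|]. Qed.

Lemma sphere_boundedD f g : sphere_bounded f -> sphere_bounded g ->
  sphere_bounded (fun x => f x + g x).
Proof.
move=> [mf [K fK]] [mg [L gL]]; split; first exact: measurable_funD.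
exists (K + L) => x Sx; rewrite (le_trans (ler_normD _ _))// lerD//.
  exact: fK.
exact: gL.
Qed.

Lemma sphere_boundedM f g : sphere_bounded f -> sphere_bounded g ->
  sphere_bounded (fun x => f x * g x).
Proof.
move=> [mf [K fK]] [mg [L gL]]; split; first exact: measurable_funM.
by exists (K * L) => x Sx; rewrite normrM ler_pM// ?fK ?gL.
Qed.

Lemma sphere_bounded_eq f g : sphere_bounded f ->
  (forall x, sphere x -> f x = g x) -> sphere_bounded g.
Proof.
move=> [mf [K fK]] fg; split.
  by apply: eq_measurable_fun mf => x; rewrite inE => /fg.
by exists K => x Sx; rewrite -fg// fK.
Qed.

Lemma compact_sphere : compact sphere.
Proof.
apply: bounded_closed_compact.
  exists 1; split; first exact: num_real.
  move=> L L1 x Sx; apply: (le_trans _ (ltW L1)).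
  rewrite /Num.norm /= mx_normrE; apply: bigmax_le => // -[i j] _ /=.
  rewrite (ord1 i); apply: (le_trans (normr_coord_le_enorm x j)).
  by move: Sx; rewrite /= => ->.
rewrite (_ : sphere = enorm @^-1` [set (1:R)])//.
apply: closed_comp; last exact: closed_eq.
by move=> x _; exact: continuous_enorm.
Qed.

Lemma sphere_bounded_continuous (f : 'rV[R]_N -> R) :
  (forall x, x != 0 -> {for x, continuous f}) -> sphere_bounded f.
Proof.
move=> cf; split.
  apply: continuous_measurable_rV; first exact: measurable_sphere.
  by move=> x /sphere_neq0; exact: cf.
have : compact (f @` sphere).
  apply: continuous_compact; last exact: compact_sphere.
  apply: continuous_in_subspaceT => x; rewrite inE => Sx.
  exact/cf/sphere_neq0.
move=> /compact_bounded[K [_ HK]]; exists (K + 1) => x Sx.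
by apply: HK; [rewrite ltrDl|exists x].
Qed.

(** The value 0 at the origin is the one that the radial moment formula requires of its
    integrand. *)
Let cst_ext (f : 'rV[R]_N -> R) x := if x == 0 then 0 else f (radproj x).

Let measurable_cst_ext f : measurable_fun sphere f ->
  measurable_fun [set: 'rV[R]_N] (cst_ext f).
Proof.
move=> mf; rewrite (_ : cst_ext f = (f \o radproj) \_ [set x | x != 0]); last first.
  apply/funext => x; rewrite patchE /cst_ext; case: ifPn => x0.
    by rewrite memNset//= x0.
  by rewrite mem_set.
apply/measurable_restrict => //; first exact: measurable_neq0.
rewrite setTI; apply: (measurable_comp (@measurable_sphere R n)) => //.
  by move=> _ [x x0 <-]; exact: sphere_radproj.
exact: measurable_funTS (@measurable_radproj R n).
Qed.

Let moment_mkcond (f : 'rV[R]_N -> R) k :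
  (\int[lam]_(x in punctured_ball) (enorm x ^+ k * f (radproj x))%:E =
   \int[lam]_x (cst_ext f x * enorm x ^+ k * (enorm x <= 1)%R%:R)%:E)%E.
Proof.
rewrite integral_mkcond; apply: eq_integral => x _; rewrite patchE /cst_ext.
case: ifPn => [|].
  by rewrite inE => /punctured_ballP[/negbTE-> ->]; rewrite mulr1 mulrC.
rewrite notin_setE => h; case: eqP => [_|/eqP x0]; first by rewrite !mul0r.
case: leP => x1; last by rewrite mulr0.
by exfalso; apply: h; apply/punctured_ballP.
Qed.

Lemma radial_moment_nneg f k : sphere_bounded f ->
  (forall x, sphere x -> 0 <= f x) ->
  \int[lam]_(x in punctured_ball) (enorm x ^+ k * f (radproj x)) =
  (N + k)%:R^-1 * \int[dvol]_(x in sphere) f x.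
Proof.
move=> bf f0; have [mf _] := bf.
have h0 x : 0 <= cst_ext f x.
  by rewrite /cst_ext; case: eqP => // /eqP /sphere_radproj; exact: f0.
have hZ (c : R) x : 0 < c -> cst_ext f (c *: x) = cst_ext f x.
  by move=> c0; rewrite /cst_ext scaler_eq0 gt_eqF// radprojZ.
have h00 : cst_ext f 0 = 0 by rewrite /cst_ext eqxx.
have E : (\int[dvol]_(x in sphere) (f x)%:E = N%:R%:E *
    \int[lam]_x (cst_ext f x * (enorm x <= 1)%R%:R)%:E)%E.
  rewrite integral_dvol//; last first.
    exact/measurable_EFinP.
  congr (_ * _)%E; have := moment_mkcond f 0.
  under eq_integral do rewrite expr0 mul1r.
  by move=> ->; under eq_integral do rewrite expr0 mulr1.
have I1 : (\int[lam]_x (cst_ext f x * (enorm x <= 1)%R%:R)%:E < +oo)%E.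
  have := integrable_fin_num (@measurable_sphere R n) (sphere_bounded_integrable bf).
  rewrite /= E; case: (\int[lam]_x _)%E => [r||]//=; first by rewrite ltry.
  by rewrite mulry gtr0_sg ?mul1e.
rewrite /Rintegral moment_mkcond (radial_moment_ge0 (measurable_cst_ext mf) h0 hZ h00)// E.
have : (\int[lam]_x (cst_ext f x * (enorm x <= 1)%R%:R)%:E \is a fin_num)%E.
  by rewrite ge0_fin_numE// integral_ge0// => x _; rewrite lee_fin mulr_ge0.
by move=> Ifin; rewrite !fineM//= mulrA [_^-1 * _]mulrC.
Qed.

Lemma punctured_ball_integrable f k : sphere_bounded f ->
  lam.-integrable punctured_ball (EFin \o (fun x => enorm x ^+ k * f (radproj x))).
Proof.
move=> [mf [K fK]].
have mPB := @measurable_punctured_ball R n.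
apply: measurable_bounded_integrable => //.
- exact: lebesgue_punctured_ball_fin.
- apply: measurable_funM.
    by apply: measurable_funTS; apply: measurable_funX; exact: measurable_enorm.
  apply: (measurable_comp (@measurable_sphere R n)) => //.
    by move=> _ [x /punctured_ballP[x0 _] <-]; exact: sphere_radproj.
  exact: measurable_funTS (@measurable_radproj R n).
exists K; split; first exact: num_real.
move=> L KL x /punctured_ballP[x0 x1]; rewrite /= (le_trans _ (ltW KL))//.
rewrite normrM -[leRHS]mul1r ler_pM//; last exact/fK/sphere_radproj.
by rewrite normrX exprn_ile1// ger0_norm// enorm_ge0.
Qed.

Lemma radial_moment f k : sphere_bounded f ->
  \int[lam]_(x in punctured_ball) (enorm x ^+ k * f (radproj x)) =
  (N + k)%:R^-1 * \int[dvol]_(x in sphere) f x.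
Proof.
move=> bf; have [mf [K fK]] := bf.
(* [f + K] is nonnegative; the formula for [f] follows by subtracting the one for the constant
   [K]. *)
have bK := @sphere_bounded_cst K.
have K0 x : sphere x -> 0 <= K by move=> /fK; exact: le_trans.
have mS := @measurable_sphere R n; have mPB := @measurable_punctured_ball R n.
have := radial_moment_nneg k (sphere_boundedD bf bK).
have := radial_moment_nneg k bK K0.
rewrite RintegralD//; [|exact: sphere_bounded_integrable..].
under [in X in _ -> X -> _]eq_Rintegral do rewrite mulrDr.
rewrite RintegralD//; [|exact: punctured_ball_integrable..].
move=> E H; apply: (addIr (\int[lam]_(x in punctured_ball) (enorm x ^+ k * K))).
rewrite [X in _ = _ + X]E -mulrDr; apply: H => x Sx.
by have := fK _ Sx; rewrite ler_norml -subr_ge0 opprK => /andP[].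
Qed.

End radial_moments.

(** * Calculus on the punctured space *)

Section directional_derivatives.
Context {R : realType} (n : nat).
Local Notation V := 'rV[R]_n.+1.
Implicit Types (f g : V -> R) (x v : V).

(** Reduces directional derivatives to one real variable, where the chain rule and the mean value
    theorem apply. *)
Lemma is_derive_lineP f x v (l : R) :
  is_derive x v f l <-> is_derive (0 : R) 1 (fun h => f (x + h *: v)) l.
Proof.
have E : (fun h : R => h^-1 *: ((f \o shift x) (h *: v) - f x)) =
  (fun h : R => h^-1 *: (((fun h => f (x + h *: v)) \o shift (0 : R)) (h *: (1 : R)) -
     (fun h => f (x + h *: v)) 0)).
  apply/funext => h /=.
  by rewrite addr0 scale0r addr0 [_%:A]mulr1 [x + _]addrC.
by split => -[h1 h2]; split; rewrite /derivable /derive ?E// -?E.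
Qed.

Lemma is_derive_line f x v (r : R) (l : R) :
  is_derive (x + r *: v) v f l ->
  is_derive r 1 (fun h : R => f (x + h *: v)) l.
Proof.
move=> /is_derive_lineP H.
have H1 : is_derive r 1 (fun h : R => h - r) 1.
  by apply: is_derive_eq; rewrite subr0.
have H0 : is_derive ((fun h : R => h - r) r) 1 (fun h => f (x + r *: v + h *: v)) l.
  by rewrite subrr.
have := @is_derive1_comp _ (fun h => f (x + r *: v + h *: v)) (fun h => h - r) r l 1 H0 H1; rewrite mulr1.
congr is_derive; apply/funext => h /=.
by rewrite -addrA -scalerDl [r + _]addrC subrK.
Qed.

Lemma is_derive_comp_dir (F : R -> R) g x v (a b : R) :
  is_derive (g x) 1 F a -> is_derive x v g b ->
  is_derive x v (fun y => F (g y)) (a * b).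
Proof.
move=> HF /is_derive_lineP Hg; apply/is_derive_lineP.
have HF' : is_derive ((fun h : R => g (x + h *: v)) 0) 1 F a by rewrite scale0r addr0.
exact: (is_derive1_comp HF' Hg).
Qed.

Lemma is_derive_coord x v i :
  is_derive x v (fun y => y ord0 i) (v ord0 i).
Proof.
apply/is_derive_lineP.
have -> : (fun h : R => (x + h *: v) ord0 i) = cst (x ord0 i) + (v ord0 i \*: id).
  by apply/funext => h; rewrite !mxE mulrC.
apply: is_derive_eq.
by rewrite add0r /GRing.scale /= mulr1.
Qed.

Lemma is_derive_rsum (I : Type) (r : seq I) (f : I -> V -> R) (df : I -> R) x v :
  (forall i, is_derive x v (f i) (df i)) ->
  is_derive x v (fun y => \sum_(i <- r) f i y) (\sum_(i <- r) df i).
Proof.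
move=> H; elim: r => [|i r IH].
  rewrite big_nil; rewrite (_ : (fun y => _) = cst 0); last first.
    by apply/funext => y; rewrite big_nil.
  exact: is_derive_cst.
rewrite big_cons (_ : (fun y => _) = (fun y => f i y + \sum_(j <- r) f j y)); last first.
  by apply/funext => y; rewrite big_cons.
exact: (@is_deriveD _ _ _ (f i) (fun y => \sum_(j <- r) f j y)).
Qed.

Lemma is_derive_mul f g x v (a b : R) : is_derive x v f a -> is_derive x v g b ->
  is_derive x v (fun y => f y * g y) (a * g x + f x * b).
Proof.
move=> Hf Hg; apply: (is_derive_eq (is_deriveM Hf Hg)).
by rewrite addrC /GRing.scale /= mulrC.
Qed.

Lemma is_derive_add f g x v (a b : R) : is_derive x v f a -> is_derive x v g b ->
  is_derive x v (fun y => f y + g y) (a + b).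
Proof. exact: is_deriveD. Qed.

Lemma is_derive_dotpxx x v : is_derive x v (fun y => dotp y y) (2 * dotp x v).
Proof.
rewrite (_ : 2 * dotp x v = \sum_i (v ord0 i * x ord0 i + x ord0 i * v ord0 i)).
  apply: is_derive_rsum => i; apply: is_derive_mul; exact: is_derive_coord.
rewrite big_split /= mulr_natl mulr2n; congr (_ + _).
by apply: eq_bigr => i _; rewrite mulrC.
Qed.

Lemma dotp_delta x i : dotp x (delta_mx ord0 i) = x ord0 i.
Proof.
rewrite /dotp (bigD1 i)//= big1 ?addr0 ?mxE ?eqxx ?mulr1// => j /negbTE ji.
by rewrite mxE eqxx ji mulr0.
Qed.

Lemma neq0_near x : x != 0 -> \forall y \near x, y != 0.
Proof.
rewrite -enorm_gt0 => x0.
have /cvgrPdist_lt/(_ _ x0) := @continuous_enorm R n x.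
apply: filterS => y; rewrite -enorm_gt0 => h.
rewrite lt_def enorm_ge0 andbT; apply/eqP => y0.
by move: h; rewrite y0 subr0 ger0_norm ?ltxx// ltW.
Qed.

Lemma is_derive_neq0 f g x v l : (forall y, y != 0 -> f y = g y) -> x != 0 ->
  is_derive x v f l -> is_derive x v g l.
Proof.
move=> fg x0; apply: near_eq_is_derive.
by apply: filterS (neq0_near x0) => y /fg.
Qed.

Lemma continuous_neq0 f g x : (forall y, y != 0 -> f y = g y) -> x != 0 ->
  {for x, continuous f} -> {for x, continuous g}.
Proof.
move=> fg x0 cf; rewrite /prop_for /continuous_at -(fg x x0).
have H : \forall y \near x, f y = g y.
  by apply: filterS (neq0_near x0) => y /fg.
exact: (cvg_trans (near_eq_cvg H) cf).
Qed.

Lemma is_derive_sqrtV (r : R) : 0 < r ->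
  is_derive r 1 (fun r : R => (Num.sqrt r)^-1) (- 2^-1 * (Num.sqrt r)^-1 ^+ 3).
Proof.
move=> r0; have s0 : Num.sqrt r != 0 by rewrite sqrtr_eq0 -ltNge.
apply: (is_derive_eq (is_deriveV s0 (is_derive1_sqrt r0))).
by rewrite /GRing.scale /=; field.
Qed.

Lemma is_derive_enormV x v : x != 0 ->
  is_derive x v (fun y => (enorm y)^-1) (- dotp x v * (enorm x)^-1 ^+ 3).
Proof.
rewrite -enorm_gt0 => x0.
have d0 : 0 < dotp x x by rewrite -sqr_enorm exprn_gt0.
apply: (is_derive_eq (is_derive_comp_dir (g := fun y => dotp y y) (is_derive_sqrtV d0) (is_derive_dotpxx x v))).
by rewrite -/(enorm x); field; rewrite gt_eqF.
Qed.

End directional_derivatives.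

Section smooth_calculus.
Context {R : realType} (n : nat).
Local Notation V := 'rV[R]_n.+1.
Local Notation E i := (delta_mx ord0 i : V).
Implicit Types (f g : V -> R).

Lemma partialE f x i l : is_derive x (E i) f l -> partial i f x = l.
Proof. by case. Qed.

Lemma eq_partial f g i x : (forall y, y != 0 -> f y = g y) -> x != 0 ->
  partial i f x = partial i g x.
Proof.
move=> fg x0; apply: near_eq_derive.
by apply: filterS (neq0_near x0) => y /fg.
Qed.

Lemma eq_Ck k f g : (forall y, y != 0 -> f y = g y) ->
  Ck_punctured k f -> Ck_punctured k g.
Proof.
elim: k f g => [|k IH] f g fg [cf df]; split => //.
- by move=> x x0; exact: (continuous_neq0 fg x0 (cf x x0)).
- by move=> x x0; exact: (continuous_neq0 fg x0 (cf x x0)).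
- move=> i; have [df1 df2] := df i; split.
    move=> x x0; apply: near_eq_derivable (df1 x x0).
    by apply: filterS (neq0_near x0) => y /fg.
  by apply: IH df2 => y y0; exact: eq_partial.
Qed.

Lemma Ck_pred k f : Ck_punctured k.+1 f -> Ck_punctured k f.
Proof.
elim: k f => [|k IH] f [cf df]; split => // i.
by have [df1 /IH df2] := df i.
Qed.

Lemma Ck_continuous k f x : Ck_punctured k f -> x != 0 -> {for x, continuous f}.
Proof. by case: k => [|k] [cf _]; exact: cf. Qed.

Lemma Ck_partial k f i : Ck_punctured k.+1 f -> Ck_punctured k (partial i f).
Proof. by move=> [_ /(_ i)[]]. Qed.

Lemma Ck_is_derive k f i x : Ck_punctured k.+1 f -> x != 0 ->
  is_derive x (E i) f (partial i f x).
Proof. by move=> [_ /(_ i)[df _]] x0; exact/derivableP/df. Qed.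

Lemma CkS k f (df : 'I_n.+1 -> V -> R) :
  (forall x, x != 0 -> {for x, continuous f}) ->
  (forall i x, x != 0 -> is_derive x (E i) f (df i x)) ->
  (forall i, Ck_punctured k (df i)) -> Ck_punctured k.+1 f.
Proof.
move=> cf Hd Hk; split => // i; split.
  by move=> x x0; case: (Hd i x x0).
by apply: eq_Ck (Hk i) => x x0; rewrite (partialE (Hd i x x0)).
Qed.

Lemma CkD k f g : Ck_punctured k f -> Ck_punctured k g ->
  Ck_punctured k (fun x => f x + g x).
Proof.
elim: k f g => [|k IH] f g Hf Hg.
  by split => // x x0; exact: (continuousD (Ck_continuous Hf x0) (Ck_continuous Hg x0)).
apply: (@CkS _ _ (fun i x => partial i f x + partial i g x)).
- by move=> x x0; exact: (continuousD (Ck_continuous Hf x0) (Ck_continuous Hg x0)).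
- move=> i x x0; exact: (is_derive_add (Ck_is_derive i Hf x0) (Ck_is_derive i Hg x0)).
- by move=> i; apply: IH; exact: Ck_partial.
Qed.

Lemma CkM k f g : Ck_punctured k f -> Ck_punctured k g ->
  Ck_punctured k (fun x => f x * g x).
Proof.
elim: k f g => [|k IH] f g Hf Hg.
  by split => // x x0; exact: (continuousM (Ck_continuous Hf x0) (Ck_continuous Hg x0)).
apply: (@CkS _ _ (fun i x => partial i f x * g x + f x * partial i g x)).
- by move=> x x0; exact: (continuousM (Ck_continuous Hf x0) (Ck_continuous Hg x0)).
- move=> i x x0; exact: (is_derive_mul (Ck_is_derive i Hf x0) (Ck_is_derive i Hg x0)).
- move=> i; apply: CkD; apply: IH; rewrite //; first [exact: Ck_partial|exact: Ck_pred].
Qed.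

Lemma Ck_cst k (c : R) : Ck_punctured k (fun _ : V => c).
Proof.
elim: k c => [|k IH] c; first by split => // x _; exact: cst_continuous.
apply: (@CkS k _ (fun _ _ => 0)).
- by move=> x _; exact: cst_continuous.
- by move=> _; exact: IH.
Qed.

Lemma CkZ k (c : R) f : Ck_punctured k f -> Ck_punctured k (fun x => c * f x).
Proof. by move=> Hf; apply: CkM => //; exact: Ck_cst. Qed.

Lemma Ck_sum k (I : Type) (r : seq I) (f : I -> V -> R) :
  (forall i, Ck_punctured k (f i)) -> Ck_punctured k (fun x => \sum_(i <- r) f i x).
Proof.
move=> Hf; elim: r => [|i r IH].
  by apply: eq_Ck (Ck_cst k 0) => x _; rewrite big_nil.
by apply: eq_Ck (CkD (Hf i) IH) => x _; rewrite big_cons.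
Qed.

Lemma Ck_coord k i : Ck_punctured k (fun x : V => x ord0 i).
Proof.
case: k => [|k]; first by split => // x _; exact: continuous_coord.
apply: (@CkS _ _ (fun j _ => (E j) ord0 i)) => [x _|j x _|j].
- exact: continuous_coord.
- exact: is_derive_coord.
- exact: Ck_cst.
Qed.

Lemma continuous_enormV (x : V) : x != 0 -> {for x, continuous (fun y => (enorm y)^-1)}.
Proof.
move=> x0; apply: (@continuous_comp _ _ _ (@enorm R n) GRing.inv).
  exact: continuous_enorm.
by apply: inv_continuous; rewrite enorm_eq0.
Qed.

(** The derivatives of 1/|x| are again polynomials in the coordinates and 1/|x|, which closes the
    induction. *)
Lemma Ck_enormV k : Ck_punctured k (fun x : V => (enorm x)^-1).
Proof.
elim: k => [|k IH]; first by split => // x; exact: continuous_enormV.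
apply: (@CkS _ _ (fun i x => - 1 * x ord0 i * ((enorm x)^-1 * ((enorm x)^-1 * (enorm x)^-1)))).
- exact: continuous_enormV.
- move=> i x x0; apply: (is_derive_eq (is_derive_enormV _ x0)).
  by rewrite dotp_delta !exprS expr0; ring.
- move=> i; apply: CkM; last by apply: CkM => //; exact: CkM.
  by apply: CkZ; exact: Ck_coord.
Qed.

Lemma Ck_enorm k : Ck_punctured k (fun x : V => enorm x).
Proof.
apply: (@eq_Ck _ (fun x => (\sum_i x ord0 i * x ord0 i) * (enorm x)^-1)).
  move=> x x0; rewrite -[\sum_i _]/(dotp x x) -sqr_enorm expr2 mulfK//.
  by rewrite enorm_eq0.
apply: CkM; last exact: Ck_enormV.
by apply: Ck_sum => i; apply: CkM; exact: Ck_coord.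
Qed.

(** [F] lists the successive derivatives of [F 0]. Differentiability is asked only at values of [g],
    because the power series below are differentiated only on [-1, 1], where the first coordinate of
    a point of the sphere lies. *)
Lemma Ck_comp k (F : nat -> R -> R) g : (forall l, Ck_punctured l g) ->
  (forall m x, x != 0 -> is_derive (g x) 1 (F m) (F m.+1 (g x))) ->
  forall m, Ck_punctured k (fun x => F m (g x)).
Proof.
move=> Hg HF; have cF m x : x != 0 -> {for x, continuous (fun y => F m (g y))}.
  move=> x0; apply: continuous_comp; first exact: (Ck_continuous (Hg 0%N)).
  apply/differentiable_continuous/derivable1_diffP.
  by case: (HF m x x0).
elim: k => [|k IH] m; first by split => // x; exact: cF.
apply: (@CkS _ _ (fun i x => F m.+1 (g x) * partial i g x)).
- exact: cF.
- move=> i x x0; apply: is_derive_comp_dir; first exact: HF.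
  exact: (Ck_is_derive i (Hg 1%N) x0).
- by move=> i; apply: CkM => //; exact: Ck_partial.
Qed.

End smooth_calculus.

(** * Integration by parts on the sphere *)

Section cutoff.
Context {R : realType}.

(* The square makes the positive part continuously differentiable. *)
Lemma is_derive_sqr_pos (y : R) :
  is_derive y 1 (fun y : R => Num.max y 0 ^+ 2) (2 * Num.max y 0).
Proof.
have sq (z : R) : is_derive z 1 (fun y : R => y ^+ 2) (2 * z).
  apply: (is_derive_eq (is_deriveM (is_derive_id z 1) (is_derive_id z 1))).
  by rewrite /GRing.scale /= mulr1 mulr_natl mulr2n.
have [y0|y0|y0] := ltgtP y 0.
- rewrite mulr0; apply: near_eq_is_derive (is_derive_cst (0 : R) y 1).
  near=> z; rewrite max_r ?expr0n// ltW//; near: z; exact: lt_nbhsl.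
- apply: near_eq_is_derive (sq y).
  near=> z; rewrite max_l// ltW//; near: z; exact: lt_nbhsr.
rewrite y0 mulr0.
suff H : (fun h : R => h^-1 *: (((fun y : R => Num.max y 0 ^+ 2) \o shift (0 : R)) (h *: (1 : R)) -
   (fun y : R => Num.max y 0 ^+ 2) 0)) @ 0^' --> (0 : R).
  split; first by apply/cvg_ex; exists 0.
  exact/cvg_lim.
apply/cvgr0Pnorm_lt => e e0; near=> h.
rewrite /= addr0 maxxx expr0n/= subr0 [h *: _]mulr1.
apply: (@le_lt_trans _ _ `|h|); last by near: h; exact: dnbhs0_lt.
have h0 : h != 0 by near: h; exact: nbhs_dnbhs_neq.
rewrite normrZ normfV ler_pdivrMl ?normr_gt0// normrX -expr2 lerXn2r ?nnegrE//.
by case: (leP h 0); rewrite ?normr0.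
Unshelve. all: by end_near. Qed.

(** To be evaluated at r = |x|^2. The factor [r] outweighs the discontinuity of a ray extension at
    the origin, and the squared positive part brings both the function and its derivative to 0 at
    the unit sphere. *)
Definition cutoff (r : R) : R := r * Num.max (1 - r) 0 ^+ 2.

Definition dcutoff (r : R) : R :=
  Num.max (1 - r) 0 ^+ 2 - 2 * r * Num.max (1 - r) 0.

Lemma is_derive_cutoff (r : R) : is_derive r 1 cutoff (dcutoff r).
Proof.
have H1 : is_derive r 1 (fun r : R => 1 - r) (- 1).
  apply: (is_derive_eq (is_deriveB (is_derive_cst (1 : R) r 1) (is_derive_id r 1))).
  by rewrite sub0r.
have H2 := @is_derive1_comp _ (fun y : R => Num.max y 0 ^+ 2) (fun r : R => 1 - r) r _ _
  (is_derive_sqr_pos (1 - r)) H1.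
have H3 := is_deriveM (is_derive_id r 1) H2.
apply: (is_derive_eq H3); rewrite /dcutoff /GRing.scale /=; ring.
Qed.

Lemma cutoff_ge1 (r : R) : 1 <= r -> cutoff r = 0 /\ dcutoff r = 0.
Proof.
move=> r1; rewrite /cutoff /dcutoff max_r ?subr_le0//.
by rewrite expr0n/= !mulr0 subr0.
Qed.

Lemma cutoff_le1 (r : R) : r <= 1 ->
  cutoff r = r * (1 - r) ^+ 2 /\ dcutoff r = (1 - r) ^+ 2 - 2 * r * (1 - r).
Proof. by move=> r1; rewrite /cutoff /dcutoff max_l ?subr_ge0. Qed.

End cutoff.

Section integral_of_partial.
Context {R : realType} (n : nat).
Local Notation N := n.+1.
Local Notation V := 'rV[R]_N.
Local Notation lam := (lebesgue_rV N : {measure set 'rV[R]_N -> \bar R}).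

Lemma measurable_neq0_continuous (g : V -> R) :
  (forall x, x != 0 -> {for x, continuous g}) -> measurable_fun [set: V] g.
Proof.
move=> cg; have m1 := @measurable_neq0 R n.
have m0 : measurable [set (0 : V)].
  rewrite (_ : [set (0:V)] = ~` [set x | x != 0]); first exact: measurableC.
  by apply/seteqP; split => x /=; [move=> ->; rewrite eqxx|move=> /negP; rewrite negbK => /eqP].
rewrite (_ : setT = [set x | x != 0] `|` [set (0 : V)]); last first.
  by apply/seteqP; split => x //= _; case: (eqVneq x 0) => [->|]; [right|left].
apply/measurable_funU => //; split; last exact: measurable_fun_set1.
exact: continuous_measurable_rV.
Qed.

Lemma integral_translate (f : V -> R) (b : V) : measurable_fun [set: V] f ->
  (\int[lam]_x (f (x + b))%:E = \int[lam]_x (f x)%:E)%E.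
Proof.
move=> mf; rewrite integralE [RHS]integralE.
have T (g : V -> \bar R) : measurable_fun [set: V] g -> (forall x, 0 <= g x)%E ->
    (\int[lam]_x g (x + b)%R = \int[lam]_x g x)%E.
  move=> mg g0; have := @lebesgue_rV_affine R N 1 b g ltr01 mg g0.
  rewrite invr1 expr1n mul1e => <-.
  by apply: eq_integral => x _; rewrite scale1r.
have mfE : measurable_fun [set: V] (EFin \o f) by exact/measurable_EFinP.
rewrite -(T ((EFin \o f)^\+)%E) ?funepos_ge0//; last exact: measurable_funepos.
rewrite -(T ((EFin \o f)^\-)%E) ?funeneg_ge0//; last exact: measurable_funeneg.
by congr (_ - _)%E; apply: eq_integral => x _; rewrite ?funepos.unlock ?funeneg.unlock.
Qed.

(** Difference quotients have integral zero by translation invariance. The mean value theorem bounds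
    them by [K] on a fixed box outside which they vanish, and dominated convergence gives the
    derivative. *)
Lemma integral_directional_derivative0 (f df : V -> R) (i : 'I_N) (K : R) :
  measurable_fun [set: V] f ->
  (forall x, is_derive x (delta_mx ord0 i) f (df x)) ->
  (forall x, `|df x| <= K) -> (forall x, `|f x| <= K) ->
  (forall x, 1 < enorm x -> f x = 0) ->
  (\int[lam]_x (df x)%:E = 0)%E.
Proof.
move=> mf Hd dK fK f0; set v : V := delta_mx ord0 i.
have K0 : 0 <= K by exact: le_trans (fK 0).
(* Half-width 2 leaves a margin of 1 around the unit ball, the largest step [h k]: a point outside
   the box does not reach the ball. *)
pose B := rV_box N (-2) (2 : R).
have mB : measurable B by exact: measurable_rV_box.
have Bfin : (lam B < +oo)%E.
  apply: (@le_lt_trans _ _ ((2 - - 2) ^+ N)%:E); last by rewrite ltry.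
  by rewrite -(@lebesgue_rV_box R N)//; lra.
have out x : ~ B x -> forall j : R, 0 <= j <= 1 -> f (x + j *: v) = 0.
  move=> nB j /andP[j0 j1]; apply: f0.
  move/existsNP : nB => [l /negP]; rewrite negb_and -!ltNge => xl.
  apply: lt_le_trans (normr_coord_le_enorm (x + j *: v) l).
  have vl : 0 <= j * v ord0 l <= 1.
    by rewrite mxE eqxx/=; case: (l == i); rewrite ?mulr1 ?mulr0 ?j0 ?j1 ?lexx ?ler01.
  rewrite 2!mxE; move: vl xl => /andP[v0 v1] /orP[h|h].
    by rewrite ltr_normr; apply/orP; right; lra.
  by rewrite ltr_normr; apply/orP; left; lra.
pose h (k : nat) : R := k.+1%:R^-1.
have h0 k : 0 < h k by rewrite invr_gt0.
have h1 k : h k <= 1 by rewrite invf_le1 ?ltr0n// ler1n.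
have hk k : 0 <= h k <= 1 by rewrite (ltW (h0 k)) h1.
pose q k x : \bar R := ((h k)^-1 * (f (x + h k *: v) - f x))%:E.
have mfk k : measurable_fun [set: V] (fun x => f (x + h k *: v)).
  apply: (measurableT_comp mf).
  have := @measurable_affine R N 1 (h k *: v).
  by under eq_fun do rewrite scale1r.
have mq k : measurable_fun [set: V] (q k).
  by apply/measurable_EFinP; apply: measurable_funM => //; exact: measurable_funB.
have qg k x : (`|q k x| <= (K * \1_B x)%:E)%E.
  have [Bx|nB] := pselect (B x); last first.
    rewrite /q (out x nB (h k))//.
    have := out x nB 0; rewrite scale0r addr0 lexx ler01 => -> //.
    by rewrite subrr mulr0 abse0 lee_fin mulr_ge0.
  rewrite indicE mem_set// mulr1 /q abse_EFin lee_fin normrM gtr0_norm ?invr_gt0//.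
  rewrite ler_pdivrMl// mulrC.
  have D (r : R) : is_derive r 1 (fun r : R => f (x + r *: v)) (df (x + r *: v)).
    exact: is_derive_line.
  have [|r _ E] := @MVT _ (fun r : R => f (x + r *: v)) (fun r => df (x + r *: v)) 0 (h k) (h0 k) (fun r _ => D r).
    apply: continuous_subspaceT => r.
    by apply/differentiable_continuous/derivable1_diffP; case: (D r).
  move: E; rewrite scale0r addr0 subr0 => ->.
  by rewrite normrM (gtr0_norm (h0 k)) ler_wpM2r// ltW.
have ig : lam.-integrable setT (fun x => (K * \1_B x)%:E).
  under eq_fun do rewrite EFinM.
  apply: integrableZl => //; apply/integrableP; split.
    by apply/measurable_EFinP; exact: measurable_indic.
  under eq_integral do rewrite gee0_abs ?lee_fin//.
  by rewrite integral_indic// setIT.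
have qcv x : q ^~ x @ \oo --> (df x)%:E.
  apply: cvg_EFin; first by apply: nearW.
  have Hl : (fun t : R => t^-1 *: (f (x + t *: v) - f x)) @ 0^' --> df x.
    have /is_derive_lineP[+ E] := Hd x.
    rewrite -E => H; apply: cvg_trans H; apply: near_eq_cvg; apply: nearW => t /=.
    by rewrite addr0 scale0r addr0 [t *: 1]mulr1.
  move/cvgr_dnbhsP : Hl => /(_ h); apply; split.
    by move=> k; rewrite gt_eqF.
  exact: cvg_harmonic.
have q0 k : (\int[lam]_x q k x = 0)%E.
  have fint : lam.-integrable setT (EFin \o f).
    apply: le_integrable ig => //; first exact/measurable_EFinP.
    move=> x _ /=; rewrite lee_fin; have [Bx|nB] := pselect (B x).
      by rewrite indicE mem_set// mulr1 (le_trans (fK x)) ?ler_norm.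
    have := out x nB 0; rewrite scale0r addr0 lexx ler01 => -> //.
    by rewrite normr0 normr_ge0.
  have fkint : lam.-integrable setT (EFin \o (fun x => f (x + h k *: v))).
    apply/integrableP; split; first exact/measurable_EFinP.
    move/integrableP : fint => [_]; apply: le_lt_trans.
    rewrite le_eqVlt; apply/orP; left; apply/eqP.
    apply: (@integral_translate (fun x => `|f x|)).
    exact: measurableT_comp.
  have dint : lam.-integrable setT (fun x => (f (x + h k *: v) - f x)%:E).
    exact: (integrableB measurableT fkint fint).
  rewrite /q; under eq_integral do rewrite EFinM.
  rewrite (integralZl measurableT dint).
  rewrite (integralB_EFin measurableT fkint fint) integral_translate// subee ?mule0//.
  exact: (integrable_fin_num measurableT fint).
have fing x : [set: V] x -> (K * \1_B x)%:E \is a fin_num by [].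
have := dominated_cvg measurableT mq (fun x _ => qcv x) fing ig (fun k x _ => qg k x).
under eq_cvg do rewrite q0.
by move=> /cvg_lim <- //; rewrite lim_cst.
Qed.

End integral_of_partial.

Section sphere_partial_integral.
Context {R : realType} (n : nat).
Local Notation N := n.+1.
Local Notation V := 'rV[R]_N.
Local Notation E i := (delta_mx ord0 i : V).
Local Notation sphere := (@sphere R n).
Local Notation enorm := (@enorm R n).
Local Notation radproj := (@radproj R n).
Local Notation punctured_ball := (@punctured_ball R n).
Local Notation dvol := (@dvol R n).
Local Notation lam := (lebesgue_rV N : {measure set 'rV[R]_N -> \bar R}).

Lemma rayextZ (f : V -> R) (c : R) x : 0 < c -> rayext f (c *: x) = rayext f x.
Proof. by move=> c0; rewrite /rayext /= radprojZ. Qed.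

Lemma rayext_sphere (f : V -> R) x : sphere x -> rayext f x = f x.
Proof. by move=> Sx; rewrite /rayext /= radproj_id. Qed.

Lemma is_derive_rayextZ (f : V -> R) (c : R) x v l : 0 < c ->
  is_derive x v (rayext f) l -> is_derive (c *: x) v (rayext f) (l * c^-1).
Proof.
move=> c0 /is_derive_lineP H; apply/is_derive_lineP.
have H1 : is_derive (0 : R) 1 (fun h : R => h * c^-1) c^-1.
  apply: (is_derive_eq (is_deriveM (is_derive_id (0 : R) 1) (is_derive_cst c^-1 (0 : R) 1))).
  by rewrite /GRing.scale /= mulr0 add0r mulr1.
have H0 : is_derive ((fun h : R => h * c^-1) 0) 1 (fun h => rayext f (x + h *: v)) l.
  by rewrite mul0r.
have -> : (fun h : R => rayext f (c *: x + h *: v)) =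
    (fun h => rayext f (x + h *: v)) \o (fun h => h * c^-1).
  2: exact: (@is_derive1_comp _ (fun h => rayext f (x + h *: v)) (fun h => h * c^-1) 0 l c^-1 H0 H1).
apply/funext => h /=.
rewrite -(@rayextZ f c (x + _))//; congr (rayext f _).
by rewrite scalerDr scalerA mulrCA divff ?gt_eqF// mulr1.
Qed.

(** A ray extension is homogeneous of degree 0, so its derivatives are homogeneous of degree -1. *)
Lemma partial_rayextE k (f : V -> R) i x : Ck_punctured k.+1 (rayext f) -> x != 0 ->
  partial i (rayext f) x = (enorm x)^-1 * partial i (rayext f) (radproj x).
Proof.
move=> Hf x0; have r0 : radproj x != 0 by exact/sphere_neq0/sphere_radproj.
have e0 : 0 < enorm x by rewrite enorm_gt0.
rewrite {1}(radprojE x0).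
by rewrite (partialE (is_derive_rayextZ e0 (Ck_is_derive i Hf r0))) mulrC.
Qed.

Lemma sphere_bounded_Ck k (f : V -> R) : Ck_punctured k f -> sphere_bounded f.
Proof. by move=> Hf; apply: sphere_bounded_continuous => x; exact: Ck_continuous Hf. Qed.

Lemma sphere_bounded_rayext k (f : V -> R) : Ck_punctured k (rayext f) -> sphere_bounded f.
Proof.
move=> /sphere_bounded_Ck Hf; apply: sphere_bounded_eq Hf _ => x.
exact: rayext_sphere.
Qed.

(* Integrate the derivative of [cutoff (|x| ^ 2) * rayext f x] over the whole
   space and compute the radial moments of the result. *)
Lemma sphere_integral_partial (f : V -> R) i : Ck_punctured 1 (rayext f) ->
  \int[dvol]_(x in sphere) partial i (rayext f) x =
  n%:R * \int[dvol]_(x in sphere) (x ord0 i * f x).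
Proof.
move=> Hf; set F := rayext f; set dF := partial i F.
have bF : sphere_bounded f := sphere_bounded_rayext Hf.
have bd : sphere_bounded dF by exact: (sphere_bounded_Ck (Ck_partial i Hf)).
pose g (x : V) := x ord0 i * f x.
have bg : sphere_bounded g.
  by apply: sphere_boundedM => //; exact: (sphere_bounded_Ck (Ck_coord 0 i)).
have [_ [K1 FK]] := bF; have [_ [K2 dK]] := bd.
pose psi x := cutoff (dotp x x) * F x.
pose dpsi x := if x == 0 then 0
  else dcutoff (dotp x x) * (2 * x ord0 i) * F x + cutoff (dotp x x) * dF x.
have FK' x : x != 0 -> `|F x| <= K1 by move=> x0; apply: FK; exact: sphere_radproj.
have K10 : 0 <= K1.
  have [x x0] : exists x : V, x != 0.
    exists (E i); apply/eqP => /matrixP/(_ ord0 i)/eqP.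
    by rewrite !mxE !eqxx oner_eq0.
  exact: le_trans (FK' x x0).
have K20 : 0 <= K2.
  have [x x0] : exists x : V, x != 0.
    exists (E i); apply/eqP => /matrixP/(_ ord0 i)/eqP.
    by rewrite !mxE !eqxx oner_eq0.
  exact: le_trans (dK _ (sphere_radproj x0)).
have d0 x : dotp x x = enorm x ^+ 2 by rewrite sqr_enorm.
have dF0 x : x != 0 -> dF x = (enorm x)^-1 * dF (radproj x).
  exact: (partial_rayextE i Hf).
have Hc x : is_derive x (E i) (fun y => cutoff (dotp y y)) (dcutoff (dotp x x) * (2 * x ord0 i)).
  have := is_derive_comp_dir (g := fun y => dotp y y) (is_derive_cutoff (dotp x x)) (is_derive_dotpxx x (E i)).
  by rewrite dotp_delta.
have Hpsi x : is_derive x (E i) psi (dpsi x).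
  rewrite /dpsi; case: (eqVneq x 0) => [->|x0]; last first.
    exact: (is_derive_mul (Hc x) (Ck_is_derive i Hf x0)).
  apply/is_derive_lineP.
  suff H : (fun h : R => h^-1 *: (((fun h => psi (0 + h *: E i)) \o shift (0 : R)) (h *: (1 : R)) -
     (fun h => psi (0 + h *: E i)) 0)) @ 0^' --> (0 : R).
    split; first by apply/cvg_ex; exists 0.
    exact/cvg_lim.
  apply/cvgr0Pnorm_lt => e e0.
  have K1e : 0 < e / (K1 + 1) by rewrite divr_gt0// ltr_wpDl.
  near=> h.
  have h0 : h != 0 by near: h; exact: nbhs_dnbhs_neq.
  have h1 : `|h| < 1 by near: h; exact: dnbhs0_lt.
  have he : `|h| < e / (K1 + 1) by near: h; exact: dnbhs0_lt.
  rewrite /= addr0 [h *: 1]mulr1 scale0r !add0r /psi.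
  have -> : dotp (0 : V) 0 = 0 by rewrite /dotp big1// => j _; rewrite mxE mul0r.
  have hE0 : h *: E i != 0.
    rewrite scaler_eq0 (negbTE h0)/=; apply/eqP => /matrixP/(_ ord0 i)/eqP.
    by rewrite !mxE !eqxx oner_eq0.
  rewrite {2}/cutoff !mul0r subr0 dotpZ dotpC dotpZ dotp_delta mxE !eqxx mulr1.
  have hh1 : h * h <= 1 by rewrite -expr2 -real_normK ?num_real// exprn_ile1// ltW.
  have [-> _] := cutoff_le1 hh1.
  rewrite normrZ normfV ltr_pdivrMl ?normr_gt0//.
  have c1 : `|(1 - h * h) ^+ 2| <= 1.
    rewrite normrX exprn_ile1//.
    have : 0 <= h * h by rewrite -expr2 sqr_ge0.
    by move=> hh0; rewrite ger0_norm ?subr_ge0// gerBl.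
  move: c1; move: ((1 - h * h) ^+ 2) => w c1.
  rewrite !normrM -!mulrA ltr_pM2l ?normr_gt0//.
  apply: (@le_lt_trans _ _ (`|h| * (1 * K1))).
    by rewrite ler_wpM2l// ler_pM// FK'.
  rewrite mul1r; apply: (@le_lt_trans _ _ (`|h| * (K1 + 1))).
    by rewrite ler_wpM2l// lerDl.
  by rewrite -ltr_pdivlMr// ltr_wpDl.
have out x : 1 <= enorm x -> cutoff (dotp x x) = 0 /\ dcutoff (dotp x x) = 0.
  by move=> x1; apply: cutoff_ge1; rewrite d0 exprn_ege1.
(* With r = |x|, [cutoff (r^2)] is r^2 - 2 r^4 + r^6 and [dcutoff (r^2)] is 1 - 4 r^2 + 3 r^4; the
   homogeneity of [dF] leaves the powers 1, 3, 5 of r with coefficients constant along rays, to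
   which [radial_moment] applies. *)
have dpsiE x : punctured_ball x -> dpsi x =
    enorm x ^+ 1 * (2 * g (radproj x) + dF (radproj x)) +
    (enorm x ^+ 3 * (- 8 * g (radproj x) - 2 * dF (radproj x)) +
    enorm x ^+ 5 * (6 * g (radproj x) + dF (radproj x))).
  move=> /punctured_ballP[x0 x1]; rewrite /dpsi (negbTE x0) dF0// d0.
  have [-> ->] := @cutoff_le1 R (enorm x ^+ 2) (exprn_ile1 2 (enorm_ge0 x) x1).
  have -> : g (radproj x) = (enorm x)^-1 * x ord0 i * F x.
    by rewrite /g /F /rayext /= {1}/radproj mxE.
  have : enorm x != 0 by rewrite enorm_eq0.
  by move: (enorm x) (x ord0 i) (F x) (dF _) => r a b c r0; field.
have dpsi0 x : ~ punctured_ball x -> dpsi x = 0.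
  move=> nx; rewrite /dpsi; case: (eqVneq x 0) => // x0.
  have [|-> ->] := out x; last by rewrite !mul0r addr0.
  by rewrite leNgt; apply/negP => /ltW h; apply: nx; apply/punctured_ballP.
have boundW (r : R) : 0 <= r <= 1 -> `|r * (1 - r ^+ 2) ^+ 2| <= 1 /\
   `|(1 - r ^+ 2) ^+ 2 - 2 * r ^+ 2 * (1 - r ^+ 2)| <= 3.
  move=> /andP[r0 r1].
  have [a0 a1] : 0 <= r ^+ 2 /\ r ^+ 2 <= 1 by rewrite exprn_ge0// exprn_ile1.
  move: (r ^+ 2) a0 a1 => a a0 a1; split.
    rewrite ger0_norm; last by rewrite mulr_ge0// sqr_ge0.
    by rewrite mulr_ile1// ?sqr_ge0// exprn_ile1 ?subr_ge0// gerBl.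
  by rewrite ler_norml; apply/andP; split; nra.
pose K := 6 * K1 + K2 + K1.
have Zero : (\int[lam]_x (dpsi x)%:E = 0)%E.
  apply: (@integral_directional_derivative0 R n psi dpsi i K) => //.
  - apply: measurable_neq0_continuous => x x0; apply: continuousM.
      apply: (@continuous_comp _ _ _ (fun x => dotp x x) cutoff).
        exact: continuous_dotpxx.
      apply/differentiable_continuous/derivable1_diffP.
      by case: (is_derive_cutoff (dotp x x)).
    exact: (Ck_continuous Hf).
  - move=> x; have [px|/dpsi0 ->] := pselect (punctured_ball x); last first.
      by rewrite normr0 !addr_ge0// mulr_ge0.
    move: (px) => /punctured_ballP[x0 x1]; rewrite /dpsi (negbTE x0) dF0// d0.
    have [-> ->] := @cutoff_le1 R (enorm x ^+ 2) (exprn_ile1 2 (enorm_ge0 x) x1).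
    have [|b1 b2] := boundW (enorm x); first by rewrite enorm_ge0.
    have -> : enorm x ^+ 2 * (1 - enorm x ^+ 2) ^+ 2 * ((enorm x)^-1 * dF (radproj x)) =
      enorm x * (1 - enorm x ^+ 2) ^+ 2 * dF (radproj x).
      have : enorm x != 0 by rewrite enorm_eq0.
      by move: (enorm x) => r r0; field.
    have s1 := dK _ (sphere_radproj x0); have s2 := FK' x x0.
    have s3 : `|2 * x ord0 i| <= 2.
      by rewrite normrM normr_nat ler_piMr// (le_trans (normr_coord_le_enorm x i)).
    move: b1 b2 s1 s2 s3.
    move: (enorm x * (1 - enorm x ^+ 2) ^+ 2)
      ((1 - enorm x ^+ 2) ^+ 2 - 2 * enorm x ^+ 2 * (1 - enorm x ^+ 2))
      (2 * x ord0 i) (F x) (dF (radproj x)) => a b c d e b1 b2 s1 s2 s3.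
    rewrite (le_trans (ler_normD _ _))// !normrM.
    have m1 : `|b| * `|c| * `|d| <= 3 * 2 * K1 by rewrite ler_pM ?mulr_ge0// ler_pM.
    have m2 : `|a| * `|e| <= 1 * K2 by rewrite ler_pM.
    rewrite /K; lra.
  - move=> x; have [->|x0] := eqVneq x 0.
      rewrite /psi; have -> : dotp (0 : V) 0 = 0 by rewrite /dotp big1// => j _; rewrite mxE mul0r.
      by rewrite /cutoff !mul0r normr0 !addr_ge0// mulr_ge0.
    case: (leP (enorm x) 1) => x1; last first.
      by rewrite /psi (proj1 (out x (ltW x1))) mul0r normr0 !addr_ge0// mulr_ge0.
    rewrite /psi d0.
    have [-> _] := @cutoff_le1 R (enorm x ^+ 2) (exprn_ile1 2 (enorm_ge0 x) x1).
    have [|b1 _] := boundW (enorm x); first by rewrite enorm_ge0.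
    have s2 := FK' x x0.
    have -> : enorm x ^+ 2 * (1 - enorm x ^+ 2) ^+ 2 * F x =
      enorm x * (enorm x * (1 - enorm x ^+ 2) ^+ 2) * F x by ring.
    have x2 : `|enorm x| <= 1 by rewrite ger0_norm ?enorm_ge0.
    move: b1 s2 x2; move: (enorm x * (1 - enorm x ^+ 2) ^+ 2) => a; move: (F x) (enorm x) => b c b1 s2 x2.
    have m1 : `|c| * `|a| * `|b| <= 1 * 1 * K1 by rewrite ler_pM ?mulr_ge0// ler_pM.
    rewrite !normrM /K; lra.
  - by move=> x x1; rewrite /psi (proj1 (out x (ltW x1))) mul0r.
have mPB := @measurable_punctured_ball R n.
have {}Zero : \int[lam]_(x in punctured_ball) dpsi x = 0.
  rewrite Rintegral_mkcond /Rintegral (_ : (fun x => _) = fun x => (dpsi x)%:E) ?Zero//.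
  apply/funext => x; rewrite patchE; case: ifPn => //.
  by rewrite notin_setE => /dpsi0 ->.
have bc c h : sphere_bounded h -> sphere_bounded (fun x => c * h x).
  by apply: sphere_boundedM; exact: sphere_bounded_cst.
have mS := @measurable_sphere R n.
have sI h : sphere_bounded h -> dvol.-integrable sphere (EFin \o h).
  exact: sphere_bounded_integrable.
have lin (a b : R) : \int[dvol]_(x in sphere) (a * g x + b * dF x) =
    a * \int[dvol]_(x in sphere) g x + b * \int[dvol]_(x in sphere) dF x.
  by rewrite RintegralD// ?RintegralZl//; apply: sI => //; exact: bc.
have blin a b : sphere_bounded (fun x => a * g x + b * dF x).
  by apply: sphere_boundedD; exact: bc.
have mom k a b : \int[lam]_(x in punctured_ball)
    (enorm x ^+ k * (a * g (radproj x) + b * dF (radproj x))) =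
    (N + k)%:R^-1 * (a * \int[dvol]_(x in sphere) g x + b * \int[dvol]_(x in sphere) dF x).
  by rewrite (radial_moment k (blin a b)) lin.
have Iint k a b : lam.-integrable punctured_ball (EFin \o (fun x =>
    enorm x ^+ k * (a * g (radproj x) + b * dF (radproj x)))).
  exact: (punctured_ball_integrable k (blin a b)).
move: Zero.
rewrite (@eq_Rintegral _ _ _ _ _ (fun x => enorm x ^+ 1 * (2 * g (radproj x) + 1 * dF (radproj x)) +
    (enorm x ^+ 3 * (- 8 * g (radproj x) + - 2 * dF (radproj x)) +
    enorm x ^+ 5 * (6 * g (radproj x) + 1 * dF (radproj x))))); last first.
  by move=> x; rewrite inE => /dpsiE ->; congr (_ * _ + (_ * _ + _ * _)); ring.
have I35 : lam.-integrable punctured_ball (EFin \o (fun x =>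
    enorm x ^+ 3 * (- 8 * g (radproj x) + - 2 * dF (radproj x)) +
    enorm x ^+ 5 * (6 * g (radproj x) + 1 * dF (radproj x)))).
  exact: (integrableD mPB (Iint 3%N (- 8) (- 2)) (Iint 5%N 6 1)).
rewrite (RintegralD mPB (Iint 1%N 2 1) I35).
rewrite (RintegralD mPB (Iint 3%N (- 8) (- 2)) (Iint 5%N 6 1)) !mom.
set A := Rintegral _ _ dF; set B := Rintegral _ _ g.
rewrite !natrD -[n.+1]addn1 natrD.
have n0 : 0 <= n%:R :> R by [].
move: (n%:R : R) n0 => c c0 H.
(* Clearing the weights 1/(n + 2), 1/(n + 4), 1/(n + 6) of the three moments leaves exactly 8 (A - n
   B). *)
have : (c + 1 + 1) * (c + 1 + 3) * (c + 1 + 5) * ((c + 1 + 1)^-1 * (2 * B + 1 * A) +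
 ((c + 1 + 3)^-1 * (- 8 * B + - 2 * A) + (c + 1 + 5)^-1 * (6 * B + 1 * A))) = 8 * (A - c * B).
  by field; rewrite !gt_eqF//; lra.
rewrite H mulr0 => /esym/eqP; rewrite mulf_eq0 pnatr_eq0/= subr_eq0 => /eqP.
by [].
Unshelve. all: by end_near. Qed.

End sphere_partial_integral.

(** * Power series *)

Section analytic_sequences.
Context {R : realType}.
Implicit Types (a b : nat -> R) (t : R).

(* Coefficients of power series of radius of convergence larger than 1. *)
Definition analytic a : Prop :=
  exists M rho : R, [/\ 0 < rho, rho < 1 & forall k, `|a k| <= M * rho ^+ k].

Definition psum a t : R := limn (pseries a t).

Definition cmul a b : nat -> R := fun k => \sum_(i < k.+1) a i * b (k - i)%N.

Definition shiftc a : nat -> R := fun k => if k is k'.+1 then a k' else 0.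

Definition constc (c : R) : nat -> R := fun k => if k is 0%N then c else 0.

Lemma sum_exp_le (th : R) n : 0 <= th -> th < 1 ->
  \sum_(i < n) th ^+ i <= (1 - th)^-1.
Proof.
move=> th0 th1; have d0 : 0 < 1 - th by rewrite subr_gt0.
rewrite -[leRHS]mul1r ler_pdivlMr// mulrC.
have := subrX1 th n; rewrite -[th - 1]opprB mulNr => /eqP.
by rewrite -eqr_oppLR opprB => /eqP <-; rewrite gerBl exprn_ge0.
Qed.

Lemma natmul_exp_bounded (th : R) k : 0 <= th -> th < 1 ->
  k.+1%:R * th ^+ k <= (1 - th)^-1.
Proof.
move=> th0 th1; apply: le_trans (sum_exp_le k.+1 th0 th1).
rewrite mulr_natl -[k.+1 in leLHS]card_ord -sumr_const; apply: ler_sum => i _.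
by apply: ler_wiXn2l; [exact: th0|exact: ltW|rewrite -ltnS].
Qed.

Lemma analytic_bound_ge0 a (M rho : R) : (forall k, `|a k| <= M * rho ^+ k) -> 0 <= M.
Proof. by move=> /(_ 0%N); rewrite expr0 mulr1; exact: le_trans. Qed.

Lemma analytic_le a (M rho rho' : R) : 0 < rho -> rho <= rho' ->
  (forall k, `|a k| <= M * rho ^+ k) -> forall k, `|a k| <= M * rho' ^+ k.
Proof.
move=> r0 rr Ha k; rewrite (le_trans (Ha k))// ler_wpM2l//.
  exact: (analytic_bound_ge0 Ha).
by rewrite lerXn2r// ?nnegrE ltW// (lt_le_trans r0).
Qed.

(** The factor k + 1 is absorbed by enlarging the ratio: (k + 1) (rho / rho')^k is bounded. *)
Lemma analytic_diffs_bound a (M rho rho' : R) : 0 < rho -> rho < rho' ->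
  (forall k, `|a k| <= M * rho ^+ k) ->
  exists M', forall k, `|pseries_diffs a k| <= M' * rho' ^+ k.
Proof.
move=> r0 rr Ha; have M0 := analytic_bound_ge0 Ha.
have r'0 : 0 < rho' by exact: lt_trans rr.
pose th := rho / rho'.
have th0 : 0 <= th by rewrite divr_ge0// ltW.
have th1 : th < 1 by rewrite ltr_pdivrMr// mul1r.
exists (M * rho * (1 - th)^-1) => k; rewrite /pseries_diffs normrM normr_nat.
have -> : M * rho / (1 - th) * rho' ^+ k = M * rho * rho' ^+ k * (1 - th)^-1.
  by rewrite mulrAC.
apply: (@le_trans _ _ (M * rho * rho' ^+ k * (k.+1%:R * th ^+ k))); last first.
  by apply: ler_wpM2l; [rewrite !mulr_ge0// ?exprn_ge0// ltW|exact: natmul_exp_bounded].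
apply: (@le_trans _ _ (k.+1%:R * (M * rho ^+ k.+1))); first by rewrite ler_wpM2l.
rewrite /th expr_div_n exprS le_eqVlt; apply/orP; left; apply/eqP.
by field; rewrite expf_neq0// gt_eqF.
Qed.

Lemma analytic_diffs a : analytic a -> analytic (pseries_diffs a).
Proof.
move=> [M [rho [r0 r1 Ha]]].
have [|M' H] := @analytic_diffs_bound a M rho ((rho + 1) / 2) r0 _ Ha; first by lra.
by exists M', ((rho + 1) / 2); split => //; lra.
Qed.

Lemma is_cvg_pseries_bound a (M rho t : R) : 0 < rho ->
  (forall k, `|a k| <= M * rho ^+ k) -> `|t| * rho < 1 -> cvgn (pseries a t).
Proof.
move=> r0 Ha tr; apply: normed_cvg.
apply: (@series_le_cvg _ _ (geometric M (rho * `|t|))) => [k|k|k|].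
- exact: normr_ge0.
- rewrite /geometric /=; apply: mulr_ge0; first exact: (analytic_bound_ge0 Ha).
  by apply: exprn_ge0; rewrite mulr_ge0// ltW.
- by rewrite /geometric /= normrM normrX exprMn mulrA ler_wpM2r// exprn_ge0.
apply: is_cvg_geometric_series.
by rewrite ger0_norm 1?mulrC//; apply: mulr_ge0 => //; exact: ltW.
Qed.

Lemma is_cvg_psum a t : analytic a -> `|t| <= 1 -> cvgn (pseries a t).
Proof.
move=> [M [rho [r0 r1 Ha]]] t1; apply: (is_cvg_pseries_bound r0 Ha).
by rewrite (le_lt_trans _ r1)// ler_piMl// ltW.
Qed.

Lemma is_derive_psum a t : analytic a -> `|t| <= 1 ->
  is_derive t 1 (psum a) (psum (pseries_diffs a) t).
Proof.
move=> [M [rho [r0 r1 Ha]]] t1.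
pose r' := (rho + 1) / 2; pose r'' := (r' + 1) / 2.
have [r'0 r'1 rr'] : [/\ 0 < r', r' < 1 & rho < r'] by split; rewrite /r'; lra.
have [r''0 r''1 rr''] : [/\ 0 < r'', r'' < 1 & r' < r''] by split; rewrite /r''; lra.
have [M' Ha'] := analytic_diffs_bound r0 rr' Ha.
have [M'' Ha''] := analytic_diffs_bound r'0 rr'' Ha'.
(* [K] lies strictly between 1 and 1 / r'': the series and its two derived series converge at [K],
   strictly beyond |t|. *)
pose K := 2 / (1 + r'').
have K1 : 1 < K by rewrite ltr_pdivlMr; lra.
have K0 : 0 < K by exact: lt_trans K1.
have Kr : `|K| * r'' < 1.
  by rewrite gtr0_norm// /K mulrAC ltr_pdivrMr; lra.
apply: (@pseries_snd_diffs _ _ K).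
- apply: (is_cvg_pseries_bound r''0 _ Kr); apply: (analytic_le r0 _ Ha); lra.
- apply: (is_cvg_pseries_bound r''0 _ Kr); apply: (analytic_le r'0 _ Ha'); lra.
- exact: (is_cvg_pseries_bound r''0 Ha'' Kr).
- by rewrite (le_lt_trans t1)// gtr0_norm.
Qed.

Lemma analyticD a b : analytic a -> analytic b -> analytic (fun k => a k + b k).
Proof.
move=> [M [r [r0 r1 Ha]]] [M' [r' [r'0 r'1 Hb]]].
have m1 := analytic_le r0 (_ : r <= Num.max r r') Ha.
have m2 := analytic_le r'0 (_ : r' <= Num.max r r') Hb.
exists (M + M'), (Num.max r r'); split.
- by rewrite lt_max r0.
- by rewrite gt_max r1.
move=> k; rewrite (le_trans (ler_normD _ _))// mulrDl lerD//.
  by apply: m1; rewrite le_max lexx.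
by apply: m2; rewrite le_max lexx orbT.
Qed.

Lemma analyticZ (c : R) a : analytic a -> analytic (fun k => c * a k).
Proof.
move=> [M [r [r0 r1 Ha]]]; exists (`|c| * M), r; split => // k.
by rewrite normrM -mulrA ler_wpM2l.
Qed.

Lemma analytic_eq a b : (forall k, a k = b k) -> analytic a -> analytic b.
Proof. by move=> /funext ->. Qed.

Lemma analytic_shift a : analytic a -> analytic (shiftc a).
Proof.
move=> [M [r [r0 r1 Ha]]]; have M0 := analytic_bound_ge0 Ha.
exists (M / r), r; split => // -[|k] /=.
  by rewrite normr0 expr0 mulr1 divr_ge0// ltW.
by rewrite exprS mulrA divfK ?gt_eqF.
Qed.

Lemma analytic_const c : analytic (constc c).
Proof.
exists `|c|, 2^-1; split; [lra|lra|move=> -[|k] /=].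
  by rewrite expr0 mulr1.
by rewrite normr0 mulr_ge0// exprn_ge0.
Qed.

Lemma psumD a b t : analytic a -> analytic b -> `|t| <= 1 ->
  psum (fun k => a k + b k) t = psum a t + psum b t.
Proof.
move=> Ha Hb t1; rewrite /psum -limD; [|exact: is_cvg_psum..].
congr (limn _); apply/funext => k; rewrite /pseries /series /=.
by rewrite fctE -big_split /=; apply: eq_bigr => i _; rewrite mulrDl.
Qed.

Lemma psumZ (c : R) a t : analytic a -> `|t| <= 1 ->
  psum (fun k => c * a k) t = c * psum a t.
Proof.
move=> Ha t1; have Ca := is_cvg_psum Ha t1.
apply/cvg_lim => //.
rewrite (_ : pseries _ t = fun k => c * pseries a t k).
  by apply: cvgM => //; exact: cvg_cst.
apply/funext => k; rewrite /pseries /series /= mulr_sumr.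
by apply: eq_bigr => i _; rewrite mulrA.
Qed.

Lemma psum_shift a t : analytic a -> `|t| <= 1 ->
  psum (shiftc a) t = t * psum a t.
Proof.
move=> Ha t1; have Ca := is_cvg_psum Ha t1.
apply/cvg_lim => //; rewrite -(cvg_shiftn 1) /=.
rewrite (_ : (fun n => _) = fun k => t * pseries a t k).
  by apply: cvgM => //; exact: cvg_cst.
apply/funext => k; rewrite /pseries /series /= addn1 big_nat_recl//= mul0r add0r.
by rewrite mulr_sumr; apply: eq_bigr => i _; rewrite exprS mulrCA.
Qed.

Lemma psum_const c t : psum (constc c) t = c.
Proof.
apply/cvg_lim => //; rewrite -(cvg_shiftn 1) /=.
rewrite (_ : (fun n => _) = cst c); first exact: cvg_cst.
apply/funext => k; rewrite /pseries /series /= addn1 big_nat_recl//= expr0 mulr1.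
by rewrite big1 ?addr0// => i _; rewrite mul0r.
Qed.

Lemma cauchy_partial_sum (a b : nat -> R) n :
  \sum_(k < n) \sum_(i < k.+1) a i * b (k - i)%N =
  \sum_(i < n) a i * \sum_(j < n - i) b j.
Proof.
elim: n => [|n IH]; first by rewrite !big_ord0.
rewrite big_ord_recr /= IH [RHS]big_ord_recr /= subSnn big_ord1.
rewrite [\sum_(i < n.+1) a i * b (n - i)%N]big_ord_recr /= subnn addrA; congr (_ + _).
rewrite -big_split /=; apply: eq_bigr => i _.
by rewrite subSn ?big_ord_recr /= ?mulrDr// ltnW.
Qed.

(** The product of the partial sums of length n exceeds the partial sum of the Cauchy product by the
    terms with i + j >= n. They split into n blocks of size O(r^n), and n r^n is at most a constant
    times r'^n for any r' > r. *)
Lemma psum_mul a b t : analytic a -> analytic b -> `|t| <= 1 ->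
  psum (cmul a b) t = psum a t * psum b t.
Proof.
move=> Ha Hb t1; have Ca := is_cvg_psum Ha t1; have Cb := is_cvg_psum Hb t1.
have [M [r [r0 r1 Ma]]] : exists M r : R, [/\ 0 < r, r < 1 &
    (forall k, `|a k| <= M * r ^+ k) /\ (forall k, `|b k| <= M * r ^+ k)].
  have [M [r [r0 r1 HA]]] := Ha; have [M' [r' [r'0 r'1 HB]]] := Hb.
  have M0 := analytic_bound_ge0 HA; have M'0 := analytic_bound_ge0 HB.
  have rm0 : 0 < Num.max r r' by rewrite lt_max r0.
  exists (M + M'), (Num.max r r'); split => //; first by rewrite gt_max r1.
  split=> k.
    have := analytic_le r0 (_ : r <= Num.max r r') HA k.
    rewrite le_max lexx => /(_ isT)/le_trans; apply.
    by rewrite ler_wpM2r ?lerDl// exprn_ge0// ltW.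
  have := analytic_le r'0 (_ : r' <= Num.max r r') HB k.
  rewrite le_max lexx orbT => /(_ isT)/le_trans; apply.
  by rewrite ler_wpM2r ?lerDr// exprn_ge0// ltW.
move: Ma => [Ma Mb]; have M0 := analytic_bound_ge0 Ma.
have cAB : (pseries a t \* pseries b t)%R @ \oo --> psum a t * psum b t.
  by apply: cvgM.
have term (c : nat -> R) : (forall k, `|c k| <= M * r ^+ k) ->
    forall k, `|c k * t ^+ k| <= M * r ^+ k.
  move=> Hc k; rewrite normrM normrX -[leRHS]mulr1 ler_pM// ?exprn_ge0//.
  by rewrite exprn_ile1.
suff D0 : (fun n => pseries a t n * pseries b t n - pseries (cmul a b) t n) @ \oo --> (0 : R).
  apply/cvg_lim => //.
  rewrite (_ : pseries (cmul a b) t = (pseries a t \* pseries b t)%R \-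
      (fun n => pseries a t n * pseries b t n - pseries (cmul a b) t n)).
    by rewrite -[X in _ --> X]subr0; exact: cvgB.
  by apply/funext => k /=; rewrite opprB addrC subrK.
have E n : pseries a t n * pseries b t n - pseries (cmul a b) t n =
  \sum_(i < n) (a i * t ^+ i) * (\sum_(n - i <= j < n) b j * t ^+ j).
  rewrite /pseries /series /= !big_mkord.
  have -> : \sum_(i < n) cmul a b i * t ^+ i =
      \sum_(k < n) \sum_(i < k.+1) (a i * t ^+ i) * (b (k - i)%N * t ^+ (k - i)%N).
    apply: eq_bigr => k _; rewrite /cmul mulr_suml; apply: eq_bigr => i _.
    by rewrite mulrACA -exprD subnKC// -ltnS.
  rewrite (cauchy_partial_sum (fun i => a i * t ^+ i) (fun j => b j * t ^+ j)).
  rewrite mulr_suml -sumrB; apply: eq_bigr => i _; rewrite -mulrBr; congr (_ * _).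
  rewrite -(big_mkord xpredT (fun j => b j * t ^+ j)).
  rewrite -(big_mkord xpredT (fun j => b j * t ^+ j)).
  by rewrite (@big_cat_nat _ _ _ (n - i)%N 0 n)//= ?leq_subr// addrAC subrr add0r.
pose r' := (r + 1) / 2; pose th := r / r'.
have [r'0 r'1 rr'] : [/\ 0 < r', r' < 1 & r < r'] by split; rewrite /r'; lra.
have th0 : 0 <= th by rewrite divr_ge0// ltW.
have th1 : th < 1 by rewrite ltr_pdivrMr// mul1r.
pose C := M * M * (1 - r)^-1 * (1 - th)^-1.
have bnd n : `|pseries a t n * pseries b t n - pseries (cmul a b) t n| <= C * r' ^+ n.
  rewrite E; apply: le_trans (ler_norm_sum _ _ _) _.
  apply: (@le_trans _ _ (\sum_(i < n) M * M * (1 - r)^-1 * r ^+ n)).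
    apply: ler_sum => i _; rewrite normrM.
    have i_n : (i <= n)%N by rewrite ltnW.
    rewrite (_ : r ^+ n = r ^+ i * r ^+ (n - i)); last by rewrite -exprD subnKC.
    have -> : M * M / (1 - r) * (r ^+ i * r ^+ (n - i)) =
       (M * r ^+ i) * (M * r ^+ (n - i) * (1 - r)^-1) by ring.
    apply: ler_pM => //; first exact: term.
    apply: le_trans (ler_norm_sum _ _ _) _.
    rewrite -{1}[(n - i)%N]add0n big_addn subKn// big_mkord.
    apply: (@le_trans _ _ (M * r ^+ (n - i) * \sum_(j < i) r ^+ j)).
      rewrite mulr_sumr; apply: ler_sum => j _.
      by rewrite -mulrA -exprD addnC; exact: term.
    apply: ler_wpM2l; last by apply: sum_exp_le => //; exact: ltW.
    by rewrite mulr_ge0// exprn_ge0// ltW.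
  rewrite sumr_const card_ord -mulr_natl /C.
  have K0 : 0 <= M * M / (1 - r) by rewrite !mulr_ge0// invr_ge0 subr_ge0 ltW.
  rewrite mulrCA -!(mulrA (M * M / (1 - r))); apply: ler_wpM2l => //.
  have -> : r ^+ n = th ^+ n * r' ^+ n.
    by rewrite -exprMn /th divfK// gt_eqF.
  rewrite mulrA ler_wpM2r//; first by rewrite exprn_ge0// ltW.
  apply: le_trans (natmul_exp_bounded n th0 th1).
  by rewrite ler_wpM2r ?exprn_ge0// ler_nat.
apply: norm_cvg0.
apply: (@squeeze_cvgr _ _ _ _ (fun=> 0) (fun n => C * r' ^+ n)).
- by apply: nearW => n; rewrite normr_ge0 bnd.
- exact: cvg_cst.
- by apply: (@cvg_geometric _ C r'); rewrite gtr0_norm.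
Qed.

Lemma analytic_cmul a b : analytic a -> analytic b -> analytic (cmul a b).
Proof.
move=> [M [r [r0 r1 HA]]] [M' [r' [r'0 r'1 HB]]].
have M0 := analytic_bound_ge0 HA; have M'0 := analytic_bound_ge0 HB.
pose s := Num.max r r'.
have s0 : 0 < s by rewrite lt_max r0.
have s1 : s < 1 by rewrite gt_max r1.
have HA' := analytic_le r0 (_ : r <= s) HA.
have HB' := analytic_le r'0 (_ : r' <= s) HB.
pose s' := (s + 1) / 2; pose th := s / s'.
have [s'0 s'1 ss'] : [/\ 0 < s', s' < 1 & s < s'] by split; rewrite /s'; lra.
have th0 : 0 <= th by rewrite divr_ge0// ltW.
have th1 : th < 1 by rewrite ltr_pdivrMr// mul1r.
exists (M * M' * (1 - th)^-1), s'; split => // k.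
rewrite /cmul; apply: le_trans (ler_norm_sum _ _ _) _.
apply: (@le_trans _ _ (\sum_(i < k.+1) M * M' * s ^+ k)).
  apply: ler_sum => i _; rewrite normrM.
  have ik : (i <= k)%N by rewrite -ltnS.
  rewrite (_ : s ^+ k = s ^+ i * s ^+ (k - i)); last by rewrite -exprD subnKC.
  rewrite mulrACA; apply: ler_pM => //.
    by apply: HA'; rewrite le_max lexx.
  by apply: HB'; rewrite le_max lexx orbT.
rewrite sumr_const card_ord -mulr_natl mulrCA -!(mulrA (M * M')).
apply: ler_wpM2l; first exact: mulr_ge0.
have -> : s ^+ k = th ^+ k * s' ^+ k by rewrite -exprMn /th divfK// gt_eqF.
by rewrite mulrA ler_wpM2r ?natmul_exp_bounded// exprn_ge0// ltW.
Qed.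

End analytic_sequences.

(** * Zonal functions on the sphere *)

Section sphere_calculus.
Context {R : realType} (n : nat).
Local Notation N := n.+1.
Local Notation V := 'rV[R]_N.
Local Notation sphere := (@sphere R n).
Local Notation enorm := (@enorm R n).
Local Notation radproj := (@radproj R n).
Local Notation dvol := (@dvol R n).
Local Notation delta i j := ((i == j)%:R : R).
Implicit Types (f g u v : V -> R) (x : V).

(* The derivative along the sphere, [e_i] being replaced by its tangential
   part; it is defined off the sphere too, but only matters there. *)
Definition spartial i f : V -> R := partial i (rayext f).

Lemma rayext_eq f g x : (forall y, sphere y -> f y = g y) -> x != 0 ->
  rayext f x = rayext g x.
Proof. by move=> fg x0; apply: fg; exact: sphere_radproj. Qed.

Lemma spartial_eq f g i x : (forall y, sphere y -> f y = g y) -> x != 0 ->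
  spartial i f x = spartial i g x.
Proof. by move=> fg x0; apply: eq_partial => // y; exact: rayext_eq. Qed.

Lemma smooth_eq f g : (forall y, sphere y -> f y = g y) -> smooth f -> smooth g.
Proof. by move=> fg sf k; apply: eq_Ck (sf k) => y; exact: rayext_eq. Qed.

Lemma smoothD f g : smooth f -> smooth g -> smooth (fun x => f x + g x).
Proof. by move=> sf sg k; exact: (CkD (sf k) (sg k)). Qed.

Lemma smoothM f g : smooth f -> smooth g -> smooth (fun x => f x * g x).
Proof. by move=> sf sg k; exact: (CkM (sf k) (sg k)). Qed.

Lemma smooth_cst c : smooth (fun _ : V => c).
Proof. by move=> k; exact: Ck_cst. Qed.

Lemma smooth_sum (I : Type) (r : seq I) (f : I -> V -> R) :
  (forall i, smooth (f i)) -> smooth (fun x => \sum_(i <- r) f i x).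
Proof. by move=> sf k; apply: (@Ck_sum R n k I r (fun i => rayext (f i))) => i; exact: sf. Qed.

Lemma rayext_coord i x : rayext (fun y : V => y ord0 i) x = (enorm x)^-1 * x ord0 i.
Proof. by rewrite /rayext /= /radproj mxE. Qed.

Lemma smooth_coord i : smooth (fun y : V => y ord0 i).
Proof.
move=> k; apply: eq_Ck (CkM (Ck_enormV n k) (Ck_coord k i)) => y _.
by rewrite rayext_coord.
Qed.

Lemma smooth_spartial i f : smooth f -> smooth (spartial i f).
Proof.
move=> sf k; apply: eq_Ck (CkM (Ck_enorm n k) (Ck_partial i (sf k.+1))) => y y0.
rewrite (partial_rayextE i (sf k.+1))// mulrA divff ?mul1r// enorm_eq0//.
Qed.

Lemma smooth_bounded f : smooth f -> sphere_bounded f.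
Proof. by move=> /(_ 0%N); exact: sphere_bounded_rayext. Qed.

Lemma is_derive_spartial f i x : smooth f -> x != 0 ->
  is_derive x (delta_mx ord0 i) (rayext f) (spartial i f x).
Proof. by move=> sf x0; exact: (Ck_is_derive i (sf 1%N) x0). Qed.

Lemma spartialD f g i x : smooth f -> smooth g -> x != 0 ->
  spartial i (fun y => f y + g y) x = spartial i f x + spartial i g x.
Proof.
move=> sf sg x0; apply: partialE.
exact: (is_derive_add (is_derive_spartial i sf x0) (is_derive_spartial i sg x0)).
Qed.

Lemma spartialM f g i x : smooth f -> smooth g -> sphere x ->
  spartial i (fun y => f y * g y) x = spartial i f x * g x + f x * spartial i g x.
Proof.
move=> sf sg Sx; have x0 := sphere_neq0 Sx; apply: partialE.
have := is_derive_mul (is_derive_spartial i sf x0) (is_derive_spartial i sg x0).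
by rewrite !rayext_sphere.
Qed.

Lemma spartial_cst c i x : spartial i (fun=> c) x = 0.
Proof. by apply: partialE; exact: is_derive_cst. Qed.

Lemma spartial_coord i j x : sphere x ->
  spartial i (fun y => y ord0 j) x = delta j i - x ord0 j * x ord0 i.
Proof.
move=> Sx; have x0 := sphere_neq0 Sx; apply: partialE.
have H := is_derive_mul (is_derive_enormV (delta_mx ord0 i) x0) (is_derive_coord x (delta_mx ord0 i) j).
apply: (is_derive_neq0 (f := fun y => (enorm y)^-1 * y ord0 j)) => //.
  by move=> y _; rewrite rayext_coord.
apply: (is_derive_eq H).
have -> : enorm x = 1 by exact: Sx.
by rewrite dotp_delta mxE eqxx /= invr1 expr1n; ring.
Qed.

Lemma sphere_coord_le1 i x : sphere x -> `|x ord0 i| <= 1.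
Proof. by move=> Sx; have := normr_coord_le_enorm x i; have -> : enorm x = 1 by exact: Sx. Qed.

Lemma sphere_sum_sqr x : sphere x -> \sum_i x ord0 i ^+ 2 = 1.
Proof.
move=> Sx; have := sqr_enorm x; have -> : enorm x = 1 by exact: Sx.
by rewrite expr1n => ->; apply: eq_bigr => i _; rewrite expr2.
Qed.

Lemma sum_delta (h : 'I_N -> R) j : \sum_i delta j i * h i = h j.
Proof.
rewrite (bigD1 j)//= eqxx mul1r big1 ?addr0// => i /negbTE.
by rewrite eq_sym => ->; rewrite mul0r.
Qed.

Lemma sphere_sum_quad x (c0 c1 c2 c3 : R) : sphere x ->
  \sum_i (c0 + c1 * delta ord0 i + c2 * (delta ord0 i * x ord0 i) + c3 * x ord0 i ^+ 2) =
  c0 * N%:R + c1 + c2 * x ord0 ord0 + c3.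
Proof.
move=> Sx; rewrite !big_split /= -!mulr_sumr sum_delta sphere_sum_sqr//.
rewrite (_ : \sum_i delta ord0 i = 1); last first.
  rewrite -[RHS](sum_delta (fun=> 1) ord0).
  by apply: eq_bigr => i _; rewrite mulr1.
by rewrite sumr_const card_ord mulr_natr !mulr1.
Qed.

Definition zonal (a : nat -> R) : V -> R := fun x => psum a (x ord0 ord0).

Lemma rayext_coord_le1 i x : x != 0 -> `|rayext (fun y : V => y ord0 i) x| <= 1.
Proof. by move=> x0; apply: sphere_coord_le1; exact: sphere_radproj. Qed.

Lemma smooth_zonal a : analytic a -> smooth (zonal a).
Proof.
move=> Ha k.
have H := @Ck_comp R n k (fun m => psum (iter m (@pseries_diffs R) a))
  (rayext (fun y : V => y ord0 ord0)) (@smooth_coord ord0) _ 0%N.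
apply: H => m x x0 /=; apply: is_derive_psum; last exact: rayext_coord_le1.
by elim: m => //= m IH; exact: analytic_diffs.
Qed.

Lemma spartial_zonal a i x : analytic a -> sphere x ->
  spartial i (zonal a) x =
  zonal (pseries_diffs a) x * (delta ord0 i - x ord0 ord0 * x ord0 i).
Proof.
move=> Ha Sx; have x0 := sphere_neq0 Sx.
rewrite -spartial_coord//; apply: partialE.
have H := is_derive_spartial i (smooth_coord ord0) x0.
have c1 := rayext_coord_le1 ord0 x0.
have := is_derive_comp_dir (is_derive_psum Ha c1) H.
by rewrite /zonal rayext_sphere.
Qed.

Lemma laplaceE f x : laplace f x = - \sum_i spartial i (spartial i f) x.
Proof.
rewrite /laplace /divh; congr (- _); apply: eq_bigr => i _.
by congr (partial i (rayext _) x); apply/funext => y; rewrite mxE.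
Qed.

Lemma laplace_eq f g x : (forall y, sphere y -> f y = g y) -> x != 0 ->
  laplace f x = laplace g x.
Proof.
move=> fg x0; rewrite (laplaceE f) (laplaceE g); apply: (congr1 -%R); apply: eq_bigr => i _.
by apply: (fun h => spartial_eq i h x0) => y Sy; exact: (spartial_eq i fg (sphere_neq0 Sy)).
Qed.

Lemma smoothN f : smooth f -> smooth (fun x => - f x).
Proof.
move=> sf; apply: smooth_eq (smoothM (smooth_cst (-1)) sf) => y _.
by rewrite mulN1r.
Qed.

Lemma smooth_laplace f : smooth f -> smooth (laplace f).
Proof.
move=> sf.
suff H : smooth (fun x => - \sum_i spartial i (spartial i f) x).
  by apply: smooth_eq H => y _; rewrite laplaceE.
by apply/smoothN/smooth_sum => i; do 2!apply: smooth_spartial.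
Qed.

Lemma spartial_spartial_zonal a i j x : analytic a -> sphere x ->
  spartial i (spartial j (zonal a)) x =
  zonal (pseries_diffs (pseries_diffs a)) x *
    (delta ord0 i - x ord0 ord0 * x ord0 i) *
    (delta ord0 j - x ord0 ord0 * x ord0 j) -
  zonal (pseries_diffs a) x *
    ((delta ord0 i - x ord0 ord0 * x ord0 i) * x ord0 j +
     x ord0 ord0 * (delta j i - x ord0 j * x ord0 i)).
Proof.
move=> Ha Sx; have x0 := sphere_neq0 Sx.
have Ha' := analytic_diffs Ha.
have s0 := smooth_coord (ord0 : 'I_N); have sj := smooth_coord j.
rewrite (@spartial_eq _ (fun y => zonal (pseries_diffs a) y *
  (delta ord0 j + (-1) * (y ord0 ord0 * y ord0 j))))//; last first.
  by move=> y Sy; rewrite spartial_zonal// mulN1r.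
have s1 := smoothM (smooth_cst (-1)) (smoothM s0 sj).
rewrite spartialM//; [|exact: smooth_zonal|exact: (smoothD (smooth_cst _) s1)].
rewrite spartialD//; last exact: smooth_cst.
rewrite spartialM//; [|exact: smooth_cst|exact: (smoothM s0 sj)].
rewrite spartialM// !spartial_cst !spartial_coord// spartial_zonal//.
by ring.
Qed.

(** The operator - ((1 - t^2) f'' - n t f') on the coefficients of f(t), that is, the Laplacian on
    functions of the first coordinate. *)
Definition laplacec (a : nat -> R) : nat -> R := fun k =>
  k%:R * (k%:R + n%:R - 1) * a k - (k.+1%:R * k.+2%:R) * a k.+2.

Lemma laplacecE a k : laplacec a k =
  (-1) * pseries_diffs (pseries_diffs a) k +
  (shiftc (shiftc (pseries_diffs (pseries_diffs a))) k +
   n%:R * shiftc (pseries_diffs a) k).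
Proof.
case: k => [|[|k]]; rewrite /laplacec /pseries_diffs /shiftc.
- by ring.
- by ring.
- by rewrite -!natr1; ring.
Qed.

Lemma analytic_laplacec a : analytic a -> analytic (laplacec a).
Proof.
move=> Ha; have Ha' := analytic_diffs Ha; have Ha'' := analytic_diffs Ha'.
apply: (@analytic_eq _ _ _ (fun k => esym (laplacecE a k))).
apply: analyticD; first exact: analyticZ.
by apply: analyticD; [do 2!apply: analytic_shift|apply/analyticZ/analytic_shift].
Qed.

Lemma zonal_laplacec a x : analytic a -> sphere x ->
  zonal (laplacec a) x = - ((1 - x ord0 ord0 ^+ 2) * zonal (pseries_diffs (pseries_diffs a)) x -
    n%:R * x ord0 ord0 * zonal (pseries_diffs a) x).
Proof.
move=> Ha Sx; have Ha' := analytic_diffs Ha; have Ha'' := analytic_diffs Ha'.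
have t1 := sphere_coord_le1 ord0 Sx.
have As := analytic_shift Ha''; have Ass := analytic_shift As.
have As' := analytic_shift Ha'.
rewrite /zonal (_ : laplacec a = fun k => (-1) * pseries_diffs (pseries_diffs a) k +
  (shiftc (shiftc (pseries_diffs (pseries_diffs a))) k +
   n%:R * shiftc (pseries_diffs a) k)); last by apply/funext => k; exact: laplacecE.
rewrite psumD//; [|exact: analyticZ|by apply: analyticD => //; exact: analyticZ].
rewrite psumD//; last exact: analyticZ.
rewrite !psumZ// !psum_shift//; ring.
Qed.

Lemma laplace_zonal a x : analytic a -> sphere x ->
  laplace (zonal a) x = zonal (laplacec a) x.
Proof.
move=> Ha Sx; rewrite laplaceE zonal_laplacec//; congr (- _).
under eq_bigr do rewrite spartial_spartial_zonal//.
move: (zonal (pseries_diffs (pseries_diffs a)) x) (zonal (pseries_diffs a) x) => z2 z1.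
set t := x ord0 ord0.
transitivity (\sum_i (- z1 * t + z2 * delta ord0 i +
   (- 2 * z2 * t - z1) * (delta ord0 i * x ord0 i) +
   (z2 * t ^+ 2 + 2 * z1 * t) * x ord0 i ^+ 2)).
  apply: eq_bigr => i _; rewrite eqxx.
  have dd : delta ord0 i * delta ord0 i = delta ord0 i.
    by case: (ord0 == i); rewrite ?mulr1 ?mulr0.
  transitivity (- z1 * t + z2 * (delta ord0 i * delta ord0 i) +
   (- 2 * z2 * t - z1) * (delta ord0 i * x ord0 i) +
   (z2 * t ^+ 2 + 2 * z1 * t) * x ord0 i ^+ 2); last by rewrite dd.
  by rewrite mulr1n; ring.
by rewrite sphere_sum_quad// -/t -natr1; ring.
Qed.

Lemma zonalD a b x : analytic a -> analytic b -> sphere x ->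
  zonal (fun k => a k + b k) x = zonal a x + zonal b x.
Proof. by move=> Ha Hb Sx; apply: psumD => //; exact: sphere_coord_le1. Qed.

Lemma zonalZ c a x : analytic a -> sphere x ->
  zonal (fun k => c * a k) x = c * zonal a x.
Proof. by move=> Ha Sx; apply: psumZ => //; exact: sphere_coord_le1. Qed.

Lemma zonal_euler a x : analytic a -> sphere x ->
  \sum_i x ord0 i * spartial i (zonal a) x = 0.
Proof.
move=> Ha Sx; under eq_bigr do rewrite spartial_zonal//.
set z := zonal _ x; set t := x ord0 ord0.
transitivity (\sum_i (0 + 0 * delta ord0 i + z * (delta ord0 i * x ord0 i) +
   (- z * t) * x ord0 i ^+ 2)).
  by apply: eq_bigr => i _; ring.
by rewrite sphere_sum_quad// -/t; ring.
Qed.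

End sphere_calculus.

(** * Self-adjointness of the Laplacian *)

Section sphere_integrals.
Context {R : realType} (n : nat).
Local Notation N := n.+1.
Local Notation V := 'rV[R]_N.
Local Notation sphere := (@sphere R n).
Local Notation dvol := (@dvol R n).
Local Notation sint f := (Rintegral dvol sphere f).
Implicit Types (f g u v : V -> R).

Lemma sintD f g : sphere_bounded f -> sphere_bounded g ->
  sint (fun x => f x + g x) = sint f + sint g.
Proof.
move=> bf bg; rewrite RintegralD//; [exact: measurable_sphere|..];
  exact: sphere_bounded_integrable.
Qed.

Lemma sintZ c f : sphere_bounded f -> sint (fun x => c * f x) = c * sint f.
Proof.
move=> bf; rewrite RintegralZl//; first exact: measurable_sphere.
exact: sphere_bounded_integrable.
Qed.

Lemma sint_eq f g : (forall x, sphere x -> f x = g x) -> sint f = sint g.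
Proof. by move=> fg; apply: eq_Rintegral => x; rewrite inE; exact: fg. Qed.

Lemma sphere_bounded_sum (I : Type) (r : seq I) (f : I -> V -> R) :
  (forall i, sphere_bounded (f i)) -> sphere_bounded (fun x => \sum_(i <- r) f i x).
Proof.
move=> bf; elim: r => [|i r IH].
  by apply: sphere_bounded_eq (sphere_bounded_cst n 0) _ => x _; rewrite big_nil.
by apply: sphere_bounded_eq (sphere_boundedD (bf i) IH) _ => x _; rewrite big_cons.
Qed.

Lemma sint_sum (I : Type) (r : seq I) (f : I -> V -> R) :
  (forall i, sphere_bounded (f i)) ->
  sint (fun x => \sum_(i <- r) f i x) = \sum_(i <- r) sint (f i).
Proof.
move=> bf; elim: r => [|i r IH].
  rewrite big_nil -[RHS](mul0r (sint (cst 0))) -sintZ; last exact: sphere_bounded_cst.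
  by apply: sint_eq => x _; rewrite big_nil mul0r.
rewrite big_cons -IH -sintD//; last exact: sphere_bounded_sum.
by apply: sint_eq => x _; rewrite big_cons.
Qed.

Lemma sint_cst c : sint (fun=> c) = c * fine (dvol sphere).
Proof. by rewrite Rintegral_cst//; exact: measurable_sphere. Qed.

Lemma fine_dvol_sphere_gt0 : 0 < fine (dvol sphere).
Proof. by apply: fine_gt0; rewrite dvol_sphere_gt0 dvol_sphere_fin. Qed.

Lemma sint_le f g : sphere_bounded f -> sphere_bounded g ->
  (forall x, sphere x -> f x <= g x) -> sint f <= sint g.
Proof.
move=> bf bg fg; apply: le_Rintegral => //; [exact: measurable_sphere|..];
  exact: sphere_bounded_integrable.
Qed.

Lemma sint_spartial f i : smooth f ->
  sint (spartial i f) = n%:R * sint (fun x => x ord0 i * f x).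
Proof. by move=> sf; exact: (sphere_integral_partial i (sf 1%N)). Qed.

Lemma sint_spartial_mul u v i : smooth u -> smooth v ->
  sint (fun x => spartial i u x * v x + u x * spartial i v x) =
  n%:R * sint (fun x => x ord0 i * (u x * v x)).
Proof.
move=> su sv; rewrite -(sint_spartial i (smoothM su sv)).
by apply: sint_eq => x Sx; rewrite spartialM.
Qed.

(** The integrated form of Euler's identity for a ray extension comes from integration by parts
    alone: summed over i, the products x_i f produce n times the integral of f on both sides, from
    the derivatives of the x_i and from the sum of the x_i^2. *)
Lemma sint_euler f : smooth f ->
  sint (fun x => \sum_i x ord0 i * spartial i f x) = 0.
Proof.
move=> sf; have bc i := smooth_bounded (@smooth_coord R n i).
have bf := smooth_bounded sf; have bp i := smooth_bounded (smooth_spartial i sf).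
have E i := sint_spartial_mul i (@smooth_coord R n i) sf.
have : sint (fun x => \sum_i (spartial i (fun y : V => y ord0 i) x * f x +
    x ord0 i * spartial i f x)) = n%:R * sint f.
  rewrite sint_sum; last first.
    move=> i; apply: sphere_boundedD; apply: sphere_boundedM => //.
    exact/smooth_bounded/smooth_spartial/smooth_coord.
  under eq_bigr do rewrite E.
  rewrite -mulr_sumr -sint_sum; last first.
    by move=> i; apply: sphere_boundedM => //; exact: sphere_boundedM.
  congr (_ * _); apply: sint_eq => x Sx.
  under eq_bigr do rewrite mulrA -expr2.
  by rewrite -mulr_suml sphere_sum_sqr// mul1r.
have -> : sint (fun x => \sum_i (spartial i (fun y : V => y ord0 i) x * f x +
    x ord0 i * spartial i f x)) =
    sint (fun x => n%:R * f x + \sum_i x ord0 i * spartial i f x).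
  apply: sint_eq => x Sx; rewrite big_split /= -mulr_suml; congr (_ * _ + _).
  under eq_bigr do rewrite spartial_coord// eqxx -expr2.
  by rewrite sumrB sphere_sum_sqr// sumr_const card_ord -natr1 addrK.
have bE : sphere_bounded (fun x => \sum_i x ord0 i * spartial i f x).
  by apply: sphere_bounded_sum => i; exact: sphere_boundedM.
rewrite sintD// ?sintZ//; last exact: (sphere_boundedM (sphere_bounded_cst n _) bf).
by move/eqP; rewrite -subr_eq0 addrAC subrr add0r => /eqP.
Qed.

(** Integration by parts on the sphere leaves a term n v (x . grad w). With [v = f], [w = u] it
    vanishes pointwise by the hypothesis on [u]; in the other order it vanishes after integration,
    by [sint_euler] for the product u f. *)
Lemma laplace_selfadjoint u f : smooth u -> smooth f ->
  (forall x, sphere x -> \sum_i x ord0 i * spartial i u x = 0) ->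
  sint (fun x => u x * laplace f x) = sint (fun x => f x * laplace u x).
Proof.
move=> su sf eu.
have Green v w : smooth v -> smooth w ->
    sint (fun x => v x * laplace w x) =
    sint (fun x => \sum_i spartial i v x * spartial i w x) -
    n%:R * sint (fun x => v x * \sum_i x ord0 i * spartial i w x).
  move=> sv sw.
  have bv := smooth_bounded sv; have bw := smooth_bounded sw.
  have bc i := smooth_bounded (@smooth_coord R n i).
  have bpv i := smooth_bounded (smooth_spartial i sv).
  have bpw i := smooth_bounded (smooth_spartial i sw).
  have bppw i := smooth_bounded (smooth_spartial i (smooth_spartial i sw)).
  have : sint (fun x => \sum_i (spartial i v x * spartial i w x +
      v x * spartial i (spartial i w) x)) =
      n%:R * sint (fun x => v x * \sum_i x ord0 i * spartial i w x).
    rewrite sint_sum; last by move=> i; apply: sphere_boundedD; exact: sphere_boundedM.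
    rewrite (eq_bigr (fun i => n%:R * sint (fun x : V => x ord0 i * (v x * spartial i w x)))); last first.
      by move=> i _; apply: sint_spartial_mul => //; exact: smooth_spartial.
    rewrite -mulr_sumr -sint_sum; last by move=> i; do 2!apply: sphere_boundedM => //.
    apply: (congr1 ( *%R n%:R)); apply: sint_eq => x _; rewrite mulr_sumr.
    by apply: eq_bigr => i _; rewrite mulrCA.
  have -> : sint (fun x => \sum_i (spartial i v x * spartial i w x +
      v x * spartial i (spartial i w) x)) =
    sint (fun x => \sum_i spartial i v x * spartial i w x + (-1) * (v x * laplace w x)).
    apply: sint_eq => x _; rewrite big_split /= laplaceE -mulr_sumr.
    by rewrite mulrN mulN1r opprK.
  have bl : sphere_bounded (fun x => v x * laplace w x).
    by apply: sphere_boundedM => //; exact/smooth_bounded/smooth_laplace.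
  rewrite sintD; [|by apply: sphere_bounded_sum => i; exact: sphere_boundedM|
    by apply: sphere_boundedM => //; exact: sphere_bounded_cst].
  rewrite sintZ// mulN1r => <-; ring.
have Z : sint (cst 0 : V -> R) = 0 by rewrite sint_cst mul0r.
have E1 : sint (fun x => f x * \sum_i x ord0 i * spartial i u x) = 0.
  rewrite -[RHS]Z.
  by apply: sint_eq => x Sx; rewrite eu// mulr0.
have E2 : sint (fun x => u x * \sum_i x ord0 i * spartial i f x) = 0.
  apply: (etrans _ (sint_euler (smoothM su sf))); apply: sint_eq => x Sx.
  under [RHS]eq_bigr do rewrite spartialM// mulrDr.
  rewrite big_split /= mulr_sumr.
  rewrite [X in _ = X + _](_ : _ = 0) ?add0r.
    by apply: eq_bigr => i _; rewrite mulrCA.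
  by under eq_bigr do rewrite mulrA; rewrite -mulr_suml eu// mul0r.
have E3 : sint (fun x => \sum_i spartial i u x * spartial i f x) =
    sint (fun x => \sum_i spartial i f x * spartial i u x).
  by apply: sint_eq => x _; apply: eq_bigr => i _; rewrite mulrC.
apply: (etrans (Green u f su sf)); apply: (etrans _ (esym (Green f u sf su))).
exact: (congr2 (fun a b => a - n%:R * b) E3 (etrans E2 (esym E1))).
Qed.

End sphere_integrals.

(** * Zonal power series as classical and distributional solutions *)

Section zonal_solutions.
Context {R : realType} (n : nat).
Local Notation N := n.+1.
Local Notation V := 'rV[R]_N.
Local Notation sphere := (@sphere R n).
Local Notation dvol := (@dvol R n).
Local Notation sint f := (Rintegral dvol sphere f).
Local Notation delta i j := ((i == j)%:R : R).
Implicit Types (f g u v : V -> R) (x : V).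

Lemma sphere_bounded_L2 f : sphere_bounded f -> L2 f.
Proof.
move=> bf; split; first by case: bf.
have := sphere_bounded_integrable (sphere_boundedM bf bf).
move=> /integrableP[_]; apply: le_lt_trans.
rewrite le_eqVlt; apply/orP; left; apply/eqP; apply: eq_integral => x _ /=.
by rewrite normrM expr2.
Qed.

(** Integration by parts in each component; the extra term n u (x . X) vanishes because the test
    field is tangent. *)
Lemma zonal_weak_grad a : analytic a -> weak_grad (zonal a) (grad (zonal a : V -> R)).
Proof.
move=> Ha; have su := @smooth_zonal R n a Ha; split.
  move=> x Sx; rewrite -[RHS](zonal_euler Ha Sx).
  by apply: eq_bigr => i _; rewrite mxE.
move=> X [tX sX].
have bu := smooth_bounded su; have bX i := smooth_bounded (sX i).
have bpu i := smooth_bounded (smooth_spartial i su).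
have bpX i := smooth_bounded (smooth_spartial i (sX i)).
have E i := sint_spartial_mul i su (sX i).
have : sint (fun x => \sum_i (spartial i (zonal a) x * X x ord0 i +
    zonal a x * spartial i (fun y => X y ord0 i) x)) = 0.
  rewrite sint_sum; last by move=> i; apply: sphere_boundedD; exact: sphere_boundedM.
  rewrite (eq_bigr (fun i => n%:R * sint (fun x : V => x ord0 i * (zonal a x * X x ord0 i)))); last first.
    by move=> i _; exact: E.
  rewrite -mulr_sumr -sint_sum; last first.
    move=> i; apply: sphere_boundedM; first exact/smooth_bounded/smooth_coord.
    exact: sphere_boundedM.
  rewrite (sint_eq (g := fun=> 0)); first by rewrite sint_cst mul0r mulr0.
  move=> x Sx; transitivity (zonal a x * dotp x (X x)); last by rewrite tX// mulr0.
  by rewrite mulr_sumr; apply: eq_bigr => i _; rewrite mulrCA.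
have -> : sint (fun x => \sum_i (spartial i (zonal a) x * X x ord0 i +
    zonal a x * spartial i (fun y => X y ord0 i) x)) =
    sint (fun x => dotp (grad (zonal a) x) (X x) + zonal a x * divh X x).
  apply: sint_eq => x Sx; rewrite big_split /= -mulr_sumr; congr (_ + _).
  by apply: eq_bigr => i _; rewrite mxE.
have bg : sphere_bounded (fun x => dotp (grad (zonal a) x) (X x)).
  apply: (sphere_bounded_eq (sphere_bounded_sum (index_enum _) (fun i => sphere_boundedM (bpu i) (bX i)))) => x _.
  by apply: eq_bigr => i _; rewrite mxE.
have bd : sphere_bounded (fun x => zonal a x * divh X x).
  by apply: sphere_boundedM => //; apply: (sphere_bounded_sum (index_enum _) bpX).
by rewrite sintD// => /eqP; rewrite addrC addr_eq0 => /eqP.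
Qed.

(** The second derivatives [spartial i (spartial j _)] without their part proportional to x_j, which
    is normal to the sphere. With t the first coordinate, this is f''(t) grad t (x) grad t - t f'(t)
    (metric), (x) being the tensor product. *)
Definition zonal_hessian a x : 'M[R]_N := \matrix_(i, j)
  (zonal (pseries_diffs (pseries_diffs a)) x *
    ((delta ord0 i - x ord0 ord0 * x ord0 i) * (delta ord0 j - x ord0 ord0 * x ord0 j)) -
   zonal (pseries_diffs a) x * (x ord0 ord0 * (delta j i - x ord0 j * x ord0 i))).

Lemma zonal_hessian_bounded a i j : analytic a ->
  sphere_bounded (fun x => zonal_hessian a x i j).
Proof.
move=> Ha; have su := @smooth_zonal R n a Ha.
apply: (sphere_bounded_eq (f := fun x => spartial i (spartial j (zonal a)) x +
  zonal (pseries_diffs a) x * ((delta ord0 i + (-1) * (x ord0 ord0 * x ord0 i)) * x ord0 j))).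
  have bc k := smooth_bounded (@smooth_coord R n k).
  have bk (c : R) := sphere_bounded_cst n c.
  apply: sphere_boundedD; first by apply: smooth_bounded; do 2!apply: smooth_spartial.
  apply: sphere_boundedM; first exact/smooth_bounded/smooth_zonal/analytic_diffs.
  apply: sphere_boundedM => //; apply: sphere_boundedD => //.
  by apply: sphere_boundedM => //; exact: sphere_boundedM.
by move=> x Sx; rewrite spartial_spartial_zonal// mxE; ring.
Qed.

(** As for the gradient: [x T = 0] removes the extra term of the integration by parts, and [T x = 0]
    the normal part by which the second derivatives differ from [zonal_hessian]. *)
Lemma zonal_weak_cov a : analytic a -> weak_cov (grad (zonal a)) (zonal_hessian a).
Proof.
move=> Ha; have su := @smooth_zonal R n a Ha.
have Hsym x i j : zonal_hessian a x i j = zonal_hessian a x j i.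
  by rewrite !mxE [j == i]eq_sym; ring.
have xH x j : sphere x -> \sum_i x ord0 i * zonal_hessian a x i j = 0.
  move=> Sx; set z2 := zonal (pseries_diffs (pseries_diffs a)) x.
  set z1 := zonal (pseries_diffs a) x; set t := x ord0 ord0.
  set A := delta ord0 j - t * x ord0 j.
  transitivity (\sum_i (0 + 0 * delta ord0 i + z2 * A * (delta ord0 i * x ord0 i) +
     (- (z2 * t * A) + z1 * t * x ord0 j) * x ord0 i ^+ 2) -
     z1 * t * \sum_i delta j i * x ord0 i).
    rewrite mulr_sumr -sumrB; apply: eq_bigr => i _.
    by rewrite mxE -/z2 -/z1 -/t -/A; ring.
  by rewrite sphere_sum_quad// sum_delta -/t; ring.
split.
  move=> x Sx; split.
    by apply/rowP => j; rewrite !mxE; exact: xH.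
  apply/matrixP => i j; rewrite !mxE -[RHS](xH x i Sx); apply: eq_bigr => k _.
  by rewrite [x^T k j]mxE (ord1 j) Hsym mulrC.
move=> T [tT sT].
have bT i j := smooth_bounded (sT i j).
have sp i := smooth_spartial i su; have bp i := smooth_bounded (sp i).
have bpp i j := smooth_bounded (smooth_spartial i (sp j)).
have bpT i j := smooth_bounded (smooth_spartial i (sT i j)).
have xT x j : sphere x -> \sum_i x ord0 i * T x i j = 0.
  by move=> /tT[/rowP/(_ j)]; rewrite !mxE.
have Tx x i : sphere x -> \sum_j T x i j * x ord0 j = 0.
  move=> /tT[_ /matrixP/(_ i ord0)]; rewrite !mxE => E; rewrite -[RHS]E.
  by apply: eq_bigr => j _; rewrite mxE.
have : sint (fun x => \sum_i \sum_j (spartial i (spartial j (zonal a)) x * T x i j +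
    spartial j (zonal a) x * spartial i (fun y => T y i j) x)) = 0.
  rewrite sint_sum; last first.
    move=> i; apply: sphere_bounded_sum => j.
    by apply: sphere_boundedD; apply: sphere_boundedM.
  rewrite (eq_bigr (fun i => sint (fun x : V => \sum_j (n%:R * (x ord0 i * (spartial j (zonal a) x * T x i j)))))); last first.
    move=> i _; rewrite sint_sum; last first.
      by move=> j; apply: sphere_boundedD; apply: sphere_boundedM.
    rewrite sint_sum; last first.
      move=> j; apply: sphere_boundedM; first exact: sphere_bounded_cst.
      apply: sphere_boundedM; first exact/smooth_bounded/smooth_coord.
      exact: sphere_boundedM.
    apply: eq_bigr => j _; rewrite sint_spartial_mul// sintZ//.
    apply: sphere_boundedM; first exact/smooth_bounded/smooth_coord.
    exact: sphere_boundedM.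
  rewrite -sint_sum; last first.
    move=> i; apply: sphere_bounded_sum => j.
    apply: sphere_boundedM; first exact: sphere_bounded_cst.
    apply: sphere_boundedM; first exact/smooth_bounded/smooth_coord.
    exact: sphere_boundedM.
  rewrite (sint_eq (g := fun=> 0)); first by rewrite sint_cst mul0r.
  move=> x Sx; rewrite exchange_big /= big1// => j _.
  rewrite -mulr_sumr (eq_bigr (fun i => spartial j (zonal a) x * (x ord0 i * T x i j))).
    by rewrite -mulr_sumr xT// !mulr0.
  by move=> i _; rewrite mulrCA.
have -> : sint (fun x => \sum_i \sum_j (spartial i (spartial j (zonal a)) x * T x i j +
    spartial j (zonal a) x * spartial i (fun y => T y i j) x)) =
    sint (fun x => frobp (zonal_hessian a x) (T x) + dotp (grad (zonal a) x) (divh2 T x)).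
  apply: sint_eq => x Sx.
  rewrite (eq_bigr (fun i => \sum_j spartial i (spartial j (zonal a)) x * T x i j +
     \sum_j spartial j (zonal a) x * spartial i (fun y => T y i j) x)); last first.
    by move=> i _; rewrite big_split.
  rewrite big_split /=; congr (_ + _).
    apply: eq_bigr => i _.
    transitivity (\sum_j zonal_hessian a x i j * T x i j -
      zonal (pseries_diffs a) x * (delta ord0 i - x ord0 ord0 * x ord0 i) *
        \sum_j T x i j * x ord0 j); last by rewrite Tx// mulr0 subr0.
    rewrite mulr_sumr -sumrB; apply: eq_bigr => j _.
    by rewrite spartial_spartial_zonal// mxE; ring.
  rewrite exchange_big /=; apply: eq_bigr => j _; rewrite !mxE mulr_sumr.
  apply: eq_bigr => i _; congr (_ * _).
  by congr (partial i (rayext _) x); apply/funext => y; rewrite mxE.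
have b1 : sphere_bounded (fun x => frobp (zonal_hessian a x) (T x)).
  apply: sphere_bounded_sum => i; apply: sphere_bounded_sum => j.
  by apply: sphere_boundedM => //; exact: zonal_hessian_bounded.
have b2 : sphere_bounded (fun x => dotp (grad (zonal a) x) (divh2 T x)).
  apply: sphere_bounded_sum => j.
  apply: (sphere_bounded_eq (f := fun x => spartial j (zonal a) x * \sum_i spartial i (fun y => T y i j) x)).
    by apply: sphere_boundedM => //; exact: sphere_bounded_sum.
  move=> x Sx; rewrite !mxE; congr (_ * _); apply: eq_bigr => i _.
  by congr (partial i (rayext _) x); apply/funext => y; rewrite mxE.
by rewrite sintD// => /eqP; rewrite addrC addr_eq0 => /eqP.
Qed.

Lemma zonal_H22 a : analytic a -> H22 (zonal a : V -> R).
Proof.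
move=> Ha; have su := @smooth_zonal R n a Ha; have Ha' := analytic_diffs Ha.
split; first exact/sphere_bounded_L2/smooth_bounded.
exists (grad (zonal a)), (zonal_hessian a); split.
- exact: zonal_weak_grad.
- move=> i; apply: sphere_bounded_L2.
  apply: (sphere_bounded_eq (smooth_bounded (smooth_spartial i su))) => x _.
  by rewrite mxE.
- exact: zonal_weak_cov.
- by move=> i j; apply: sphere_bounded_L2; exact: zonal_hessian_bounded.
Qed.

Definition shifted_laplacec (b : R) a : nat -> R := fun k => laplacec n a k + b * a k.

Lemma analytic_shifted_laplacec b a : analytic a -> analytic (shifted_laplacec b a).
Proof.
by move=> Ha; apply: analyticD; [exact: analytic_laplacec|exact: analyticZ].
Qed.

Lemma shifted_laplace_zonal b a x : analytic a -> sphere x ->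
  laplace (zonal a) x + b * zonal a x = zonal (shifted_laplacec b a) x.
Proof.
move=> Ha Sx; rewrite laplace_zonal// /shifted_laplacec.
by rewrite (zonalD (analytic_laplacec n Ha) (analyticZ b Ha) Sx) zonalZ.
Qed.

Lemma bilaplace_zonal alpha a x : analytic a -> sphere x ->
  bilaplace_op alpha (zonal a) x =
  zonal (shifted_laplacec (alpha / 2) (shifted_laplacec (alpha / 2) a)) x.
Proof.
move=> Ha Sx; have Ha' := analytic_shifted_laplacec (alpha / 2) Ha.
rewrite -(shifted_laplace_zonal _ Ha' Sx).
have E y : sphere y -> laplace (zonal a) y + alpha / 2 * zonal a y =
    zonal (shifted_laplacec (alpha / 2) a) y by exact: shifted_laplace_zonal.
exact: (congr2 (fun c d => c + alpha / 2 * d) (laplace_eq E (sphere_neq0 Sx)) (E x Sx)).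
Qed.

Lemma shifted_laplace_selfadjoint b a f : analytic a -> smooth f ->
  sint (fun x => zonal a x * (laplace f x + b * f x)) =
  sint (fun x => f x * zonal (shifted_laplacec b a) x).
Proof.
move=> Ha sf; have su := @smooth_zonal R n a Ha.
have bf := smooth_bounded sf; have bu := smooth_bounded su.
have bl := smooth_bounded (smooth_laplace sf).
have blu := smooth_bounded (smooth_laplace su).
have bfu := sphere_boundedM bf bu.
have bcfu := sphere_boundedM (sphere_bounded_cst n b) bfu.
rewrite (sint_eq (g := fun x => zonal a x * laplace f x + b * (f x * zonal a x))); last first.
  by move=> x _; ring.
rewrite (sintD (sphere_boundedM bu bl) bcfu).
rewrite (laplace_selfadjoint su sf (fun x Sx => zonal_euler Ha Sx)).
rewrite -(sintD (sphere_boundedM bf blu) bcfu).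
by apply: sint_eq => x Sx; rewrite -shifted_laplace_zonal//; ring.
Qed.

Lemma sint_bilaplace_zonal alpha a f : analytic a -> smooth f ->
  sint (fun x => zonal a x * bilaplace_op alpha f x) =
  sint (fun x => bilaplace_op alpha (zonal a) x * f x).
Proof.
move=> Ha sf; have Ha' := analytic_shifted_laplacec (alpha / 2) Ha.
have sg : smooth (fun x => laplace f x + alpha / 2 * f x).
  by apply: smoothD; [exact: smooth_laplace|apply: smoothM => //; exact: smooth_cst].
rewrite /bilaplace_op /= shifted_laplace_selfadjoint//.
rewrite (sint_eq (g := fun x => zonal (shifted_laplacec (alpha / 2) a) x *
   (laplace f x + alpha / 2 * f x))); last by move=> x _; rewrite mulrC.
rewrite shifted_laplace_selfadjoint//; apply: sint_eq => x Sx.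
by rewrite -(bilaplace_zonal _ Ha Sx) mulrC.
Qed.

Section solution.
Variables (alpha : R) (a : nat -> R).
Hypothesis Ha : analytic a.
Hypothesis a_gt0 : forall x : V, sphere x -> 0 < zonal a x.
Hypothesis a_eq : forall x : V, sphere x ->
  zonal (shifted_laplacec (alpha / 2) (shifted_laplacec (alpha / 2) a)) x =
  zonal a x `^ (crit_exp n - 1).

Lemma zonal_classical_solution : classical_solution alpha (zonal a : V -> R).
Proof.
split; first exact: smooth_zonal.
by move=> x Sx; split; [exact: a_gt0|rewrite bilaplace_zonal// a_eq].
Qed.

Lemma zonal_H22_solution : H22_solution alpha (zonal a : V -> R).
Proof.
have Ha' := analytic_shifted_laplacec (alpha / 2) Ha.
split.
- exact: zonal_H22.
- by apply: aeW => x; exact: a_gt0.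
- have := analytic_shifted_laplacec (alpha / 2) Ha'.
  move=> /(@smooth_zonal R n)/smooth_bounded/sphere_bounded_eq/(_ a_eq).
  exact: sphere_bounded_integrable.
- move=> f sf; rewrite sint_bilaplace_zonal//; apply: sint_eq => x Sx.
  by rewrite bilaplace_zonal// a_eq.
Qed.

End solution.

End zonal_solutions.

(** * Gegenbauer polynomials *)

Section gegenbauer.
Context {R : realType} (n : nat).
Hypothesis n_gt2 : (2 < n)%N.
Local Notation N := n.+1.
Local Notation V := 'rV[R]_N.
Local Notation sphere := (@sphere R n).
Local Notation dvol := (@dvol R n).
Local Notation sint f := (Rintegral dvol sphere f).
Implicit Types (p q : {poly R}) (x : V).

Definition polyc q : nat -> R := fun k => q`_k.

Lemma analytic_polyc q : analytic (polyc q).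
Proof.
exists (\sum_(i < size q) `|q`_i| * 2 ^+ i), 2^-1; split; [lra|lra|move=> k].
have [qk|kq] := leqP (size q) k.
  rewrite /polyc nth_default// normr0 mulr_ge0//.
  by apply: sumr_ge0 => i _; rewrite mulr_ge0// exprn_ge0.
rewrite exprVn ler_pdivlMr ?exprn_gt0// (bigD1 (Ordinal kq))//= lerDl.
by apply: sumr_ge0 => i _; rewrite mulr_ge0// exprn_ge0.
Qed.

Lemma psum_polyc q t : psum (polyc q) t = q.[t].
Proof.
apply/cvg_lim => //; rewrite -(cvg_shiftn (size q)) /=.
rewrite (_ : (fun m => _) = cst q.[t]); first exact: cvg_cst.
apply/funext => k; rewrite /pseries /series /= horner_coef addnC.
rewrite (big_cat_nat (n := size q))//= ?leq_addr// big_mkord.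
rewrite [X in _ + X]big1_seq ?addr0// => i /andP[_].
by rewrite mem_index_iota => /andP[qi _]; rewrite /polyc nth_default// mul0r.
Qed.

Lemma zonal_polyc q x : zonal (polyc q) x = q.[x ord0 ord0].
Proof. exact: psum_polyc. Qed.

Definition zint q : R := locked (sint (fun x => q.[x ord0 ord0])).

Lemma zintE q : zint q = sint (fun x => q.[x ord0 ord0]).
Proof. by rewrite /zint -lock. Qed.

Lemma smooth_poly q : smooth (fun x : V => q.[x ord0 ord0]).
Proof.
by apply: smooth_eq (@smooth_zonal R n _ (analytic_polyc q)) => x _; exact: zonal_polyc.
Qed.

Lemma zintD p q : zint (p + q) = zint p + zint q.
Proof.
rewrite !zintE -(sintD (smooth_bounded (smooth_poly p)) (smooth_bounded (smooth_poly q))).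
by apply: sint_eq => x _; rewrite hornerD.
Qed.

Lemma zintZ c q : zint (c *: q) = c * zint q.
Proof.
rewrite !zintE -(sintZ c (smooth_bounded (smooth_poly q))).
by apply: sint_eq => x _; rewrite hornerZ.
Qed.

Lemma zintN q : zint (- q) = - zint q.
Proof. by rewrite -scaleN1r zintZ mulN1r. Qed.

Definition eigenval k : R := k%:R * (k%:R + n%:R - 1).

(** The recurrence coefficient of the monic orthogonal polynomials for the weight (1 -
    t^2)^((n-2)/2), the density of t on the sphere up to a constant; it is also the ratio of
    consecutive squared norms. *)
Definition geg_coef k : R := (k.+1%:R * (k%:R + n%:R - 1)) /
  ((2 * k%:R + n%:R + 1) * (2 * k%:R + n%:R - 1)).

(* The Gegenbauer polynomials for S^n, normalized to be monic. *)
Fixpoint geg k : {poly R} :=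
  if k is k1.+1 then
    if k1 is k2.+1 then 'X * geg k1 - geg_coef k2 *: geg k2 else 'X
  else 1.

Lemma geg0 : geg 0 = 1.
Proof. by []. Qed.

Lemma geg1 : geg 1 = 'X.
Proof. by []. Qed.

Lemma gegSS k : geg k.+2 = 'X * geg k.+1 - geg_coef k *: geg k.
Proof. by []. Qed.

Lemma X_mul_geg k : 'X * geg k.+1 = geg k.+2 + geg_coef k *: geg k.
Proof. by rewrite gegSS subrK. Qed.

Lemma size_geg k : (size (geg k) <= k.+1)%N.
Proof.
suff: (size (geg k) <= k.+1)%N /\ (size (geg k.+1) <= k.+2)%N by case.
elim: k => [|k [IH1 IH2]]; first by rewrite size_poly1 size_polyX.
split => //; rewrite gegSS (leq_trans (size_polyD _ _))// geq_max size_polyN.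
apply/andP; split.
  by rewrite mulrC; apply: leq_trans (size_polyMleq _ _) _; rewrite size_polyX addn2.
by rewrite (leq_trans (size_scale_leq _ _))// (leq_trans IH1)// ltnW.
Qed.

Lemma geg_lead k : (geg k)`_k = 1.
Proof.
suff: (geg k)`_k = 1 /\ (geg k.+1)`_k.+1 = 1 by case.
elim: k => [|k [IH1 IH2]]; first by rewrite coefC coefX.
split => //; rewrite gegSS coefB coefXM /= IH2 coefZ nth_default ?mulr0 ?subr0//.
by rewrite (leq_trans (size_geg k)).
Qed.

Let n1 : 0 < n%:R - 1 :> R.
Proof. by rewrite subr_gt0 ltr1n; exact: ltn_trans n_gt2. Qed.

Lemma geg_coef_gt0 k : 0 < geg_coef k.
Proof.
have k0 : 0 <= k%:R :> R by [].
by rewrite /geg_coef divr_gt0// !mulr_gt0// ?ltr0Sn//; move: n1; lra.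
Qed.

(** The difference has the sign of (n - 1) (n - 3) (l - k), hence the condition n > 2. This
    monotonicity is what Askey's argument rests on. *)
Lemma geg_coef_le k l : (k <= l)%N -> geg_coef k <= geg_coef l.
Proof.
move=> kl; have n3 : 3 <= n%:R :> R by rewrite (ler_nat _ 3).
have {kl} : k%:R <= l%:R :> R by rewrite ler_nat.
rewrite /geg_coef -!(natr1 k) -!(natr1 l).
move: (n%:R : R) n3 (k%:R : R) (ler0n R k) (l%:R : R) (ler0n R l).
move=> a a3 x x0 y y0 xy.
rewrite ler_pdivrMr; last by rewrite mulr_gt0//; lra.
rewrite mulrAC ler_pdivlMr; last by rewrite mulr_gt0//; lra.
rewrite -subr_ge0.
have -> : (y + 1) * (y + a - 1) * ((2 * x + a + 1) * (2 * x + a - 1)) -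
   (x + 1) * (x + a - 1) * ((2 * y + a + 1) * (2 * y + a - 1)) =
   (a - 1) * (a - 3) * (y - x) * (y + x + a) by ring.
by rewrite !mulr_ge0//; lra.
Qed.

(** The two relations are proved together: the first at k + 1 is the second at k rewritten by the
    recurrence, and the second at k + 1 needs both at k. *)
Lemma geg_derivE k :
  (1 - 'X ^+ 2) * (geg k)^`() = (k%:R + n%:R - 1) *: ('X * geg k) - (2 * k%:R + n%:R - 1) *: geg k.+1 /\
  (1 - 'X ^+ 2) * (geg k.+1)^`() =
    ((2 * k%:R + n%:R + 1) * geg_coef k) *: geg k - k.+1%:R *: ('X * geg k.+1).
Proof.
have bE m : (2 * m%:R + n%:R + 1) * geg_coef m = m.+1%:R * (m%:R + n%:R - 1) / (2 * m%:R + n%:R - 1).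
  have m0 : 0 <= m%:R :> R by [].
  by rewrite /geg_coef; field; apply/andP; split; rewrite gt_eqF//; move: n1; lra.
elim: k => [|k [IH1 IH2]].
  split; first by rewrite derivC mulr0 mulr1 !mulr0n !mulr0 !add0r subrr.
  rewrite derivX mulr1 bE mulr0n mulr0 !add0r mul1r divff ?gt_eqF// !scale1r.
  by rewrite expr2.
split.
  rewrite IH2 gegSS; move: (geg_coef k) (geg k) (geg k.+1) => b p q.
  rewrite -(natr1 k) -!mul_polyC !(polyCD, polyCM, polyCN, polyC1, polyC_natr).
  by ring.
rewrite gegSS derivB derivM derivX derivZ mul1r.
rewrite (_ : (1 - 'X^2) * _ = (1 - 'X^2) * geg k.+1 + 'X * ((1 - 'X^2) * (geg k.+1)^`()) -
  geg_coef k *: ((1 - 'X^2) * (geg k)^`())); last first.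
  by rewrite -!mul_polyC; ring.
rewrite IH1 IH2.
have E : (2 * k.+1%:R + n%:R + 1) * geg_coef k.+1 = 1 + geg_coef k * (2 * k%:R + n%:R - 1).
  have k0 : 0 <= k%:R :> R by [].
  rewrite bE /geg_coef -!(natr1 k.+1) -!(natr1 k); field.
  by apply/andP; split; rewrite gt_eqF//; move: n1; lra.
rewrite E; move: (geg_coef k) (geg k) (geg k.+1) => b p q.
rewrite -(natr1 k.+1) -(natr1 k) -!mul_polyC.
rewrite !(polyCD, polyCM, polyCN, polyC1, polyC_natr).
by ring.
Qed.

Lemma eigenvalS k : eigenval k.+1 = eigenval k + 2 * k%:R + n%:R.
Proof. by rewrite /eigenval -natr1; ring. Qed.

Definition gegop q : {poly R} := n%:R *: ('X * q^`()) - (1 - 'X ^+ 2) * q^`()^`().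

(** Two-step induction along the recurrence: commuting the operator with the multiplication by X
    costs n X - 2 (1 - X^2) d/dX, and [geg_derivE] evaluates the last term. *)
Lemma gegop_geg k : gegop (geg k) = eigenval k *: geg k.
Proof.
suff: gegop (geg k) = eigenval k *: geg k /\ gegop (geg k.+1) = eigenval k.+1 *: geg k.+1.
  by case.
elim: k => [|k [IH1 IH2]].
  split; first by rewrite /gegop /= derivC linear0 /eigenval !mulr0 mul0r scale0r scaler0 subr0.
  rewrite /gegop /= derivX derivC !mulr0 mulr1 subr0 /eigenval mul1r; congr (_ *: _); ring.
split => //; have [_ D] := geg_derivE k.
rewrite gegSS.
have -> : gegop ('X * geg k.+1 - geg_coef k *: geg k) =
    'X * gegop (geg k.+1) + n%:R *: ('X * geg k.+1) -
    2%:R *: ((1 - 'X^2) * (geg k.+1)^`()) - geg_coef k *: gegop (geg k).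
  rewrite /gegop !(derivB, derivD, derivM, derivX, derivZ, mul1r) -!mul_polyC.
  by rewrite !polyC_natr; ring.
rewrite IH1 IH2 D !eigenvalS; move: (geg_coef k) (eigenval k) (geg k) (geg k.+1) => b e p q.
rewrite -(natr1 k) -!mul_polyC !(polyCD, polyCM, polyCN, polyC1, polyC_natr).
by ring.
Qed.

Lemma laplacec_polyc q i : laplacec n (polyc q) i = (gegop q)`_i.
Proof.
rewrite /laplacec /gegop /polyc mulrBl mul1r opprB addrCA coefD coefB coefZ.
rewrite coefXM coefXnM !coef_deriv.
case: i => [|[|i]] /=.
- by ring.
- by ring.
- by rewrite !subSS subn0; ring.
Qed.

Lemma laplacec_geg k i : laplacec n (polyc (geg k)) i = eigenval k * polyc (geg k) i.
Proof. by rewrite laplacec_polyc gegop_geg coefZ. Qed.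

Lemma eigenval_inj : injective eigenval.
Proof.
move=> k l /eqP; rewrite -subr_eq0.
have -> : eigenval k - eigenval l = (k%:R - l%:R) * (k%:R + l%:R + n%:R - 1).
  by rewrite /eigenval; ring.
have k0 : 0 <= k%:R :> R by []; have l0 : 0 <= l%:R :> R by [].
rewrite mulf_eq0 subr_eq0 eqr_nat => /orP[/eqP//|/eqP E]; exfalso; have := n1; lra.
Qed.

(** Eigenfunctions of a symmetric operator for distinct eigenvalues. *)
Lemma zint_geg_orth (k l : nat) : k != l -> zint (geg k * geg l) = 0.
Proof.
move=> kl.
have ak := analytic_polyc (geg k); have al := analytic_polyc (geg l).
have H := laplace_selfadjoint (@smooth_zonal R n _ ak) (@smooth_zonal R n _ al)
  (fun x Sx => zonal_euler ak Sx).
have E m m' : sint (fun x => zonal (polyc (geg m')) x * laplace (zonal (polyc (geg m))) x) =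
    eigenval m * zint (geg m' * geg m).
  have am := analytic_polyc (geg m).
  rewrite !zintE -(sintZ _ (smooth_bounded (smooth_poly (geg m' * geg m)))).
  apply: sint_eq => x Sx; rewrite (laplace_zonal am Sx).
  have -> : laplacec n (polyc (geg m)) = (fun i => eigenval m * polyc (geg m) i).
    by apply/funext => i; rewrite laplacec_geg.
  by rewrite (zonalZ _ am Sx) !zonal_polyc hornerM; exact: mulrCA.
have := etrans (esym (E l k)) (etrans H (E k l)).
rewrite [geg l * _]mulrC => /eqP; rewrite -subr_eq0 -mulrBl mulf_eq0 subr_eq0.
case/orP => [/eqP/eigenval_inj lk|/eqP]; last exact.
by rewrite lk eqxx in kl.
Qed.

(** Computing the integral of X p_k p_(k+1) in two ways by the recurrence shows that the squared
    norm is multiplied by [geg_coef k] from k to k + 1. *)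
Lemma zint_geg_sqr_gt0 k : 0 < zint (geg k * geg k).
Proof.
elim: k => [|k IH].
  rewrite mulr1 zintE (sint_eq (g := fun=> 1)) => [|x _]; last by rewrite hornerC.
  by rewrite sint_cst mul1r fine_dvol_sphere_gt0.
suff -> : zint (geg k.+1 * geg k.+1) = geg_coef k * zint (geg k * geg k).
  by rewrite mulr_gt0// geg_coef_gt0.
have H1 : zint ('X * geg k * geg k.+1) = zint (geg k.+1 * geg k.+1).
  case: k {IH} => [|k]; first by rewrite mulr1.
  rewrite X_mul_geg mulrDl zintD -scalerAl zintZ.
  by rewrite [zint (geg k * _)]zint_geg_orth ?mulr0 ?addr0// ltn_eqF// ltnW.
rewrite -H1 mulrAC X_mul_geg mulrDl zintD -scalerAl zintZ.
have k2 : k.+2 != k by rewrite gtn_eqF// ltnW.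
by rewrite (zint_geg_orth k2) add0r.
Qed.

Lemma zint_geg_ge0 k l : 0 <= zint (geg k * geg l).
Proof.
by have [->|kl] := eqVneq k l; [exact/ltW/zint_geg_sqr_gt0|rewrite zint_geg_orth].
Qed.

Local Opaque geg.

(* Askey's argument for the positivity of the linearization coefficients: it
   only uses that the coefficients of the recurrence are nondecreasing. *)
Lemma zint_geg_exchange k j l : (k <= j)%N ->
  0 <= zint (geg k * geg j * geg l) /\
  zint (geg k * geg j.+1 * geg l) <= zint (geg k.+1 * geg j * geg l).
Proof.
elim: k j => [|k IH] j kj.
  split; first by rewrite geg0 mul1r zint_geg_ge0.
  rewrite geg0 geg1 mul1r; case: j {kj} => [|j]; first by rewrite geg0 geg1 mulr1.
  rewrite X_mul_geg (mulrDl (geg j.+2)) (zintD (geg j.+2 * geg l)) lerDl -scalerAl zintZ.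
  by rewrite mulr_ge0 ?zint_geg_ge0// ltW// geg_coef_gt0.
case: j kj => // j kj.
have P0 : 0 <= zint (geg k.+1 * geg j * geg l).
  have [H0 H1] := IH _ kj; apply: le_trans H1.
  exact: (IH _ (leqW kj)).1.
split.
  have [H0 H1] := IH _ (leqW kj); apply: le_trans H1.
  exact: (IH _ (leqW (leqW kj))).1.
have -> : geg k.+2 * geg j.+1 * geg l = geg k.+1 * geg j.+2 * geg l +
   (geg_coef j - geg_coef k) *: (geg k.+1 * geg j * geg l) +
   geg_coef k *: (geg k.+1 * geg j * geg l - geg k * geg j.+1 * geg l).
  by rewrite !gegSS -!mul_polyC polyCB; ring.
have := (IH _ kj).2; move: P0 (geg_coef_le (kj : (k <= j)%N)) (ltW (geg_coef_gt0 k)).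
move: (geg_coef j) (geg_coef k) (geg k.+1 * geg j.+2 * geg l)
  (geg k.+1 * geg j * geg l) (geg k * geg j.+1 * geg l) => c d A B C B0 dc d0 CB.
rewrite zintD zintD zintZ zintZ -addrA lerDl zintD zintN addr_ge0// mulr_ge0//;
  by rewrite subr_ge0.
Qed.

(** Iterates [zint_geg_exchange]: bringing two indices closer at constant sum increases the
    integral. *)
Lemma zint_geg_shift i k j l : (i + k <= j)%N ->
  zint (geg k * geg (i + j) * geg l) <= zint (geg (i + k) * geg j * geg l).
Proof.
elim: i k j => [|i IH] k j ikj; first by rewrite !add0n.
apply: le_trans (zint_geg_exchange l (_ : (i + k <= j)%N)).2; last exact: ltnW.
by rewrite addSnnS; apply: IH; rewrite ltnW// ltnW.
Qed.

(** Two shifts give the chain: integral of p_(3h)^2 <= integral of p_h p_(2h) p_(3h) <= integral of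
    p_(2h)^3, whose first member is positive. *)
Lemma zint_geg_cube_gt0 h : 0 < zint (geg (h + h) ^+ 3).
Proof.
apply: (lt_le_trans (zint_geg_sqr_gt0 (h + (h + h)))).
rewrite exprS expr2 mulrA.
apply: (le_trans _ (zint_geg_shift (h + h) (leqnn (h + h)))).
rewrite (mulrAC (geg h)).
have := @zint_geg_shift h 0 (h + h) (h + (h + h)).
by rewrite addn0 geg0 mul1r => -> //; rewrite leq_addl.
Qed.

End gegenbauer.

(** * Weighted spaces of coefficients *)

Section weighted_sequences.
Context {R : realType}.
Implicit Types (a b : nat -> R).

Lemma sum_inv_sqr_le k : \sum_(i < k.+1) (i.+1%:R ^+ 2)^-1 <= 2 - k.+1%:R^-1 :> R.
Proof.
elim: k => [|k IH]; first by rewrite big_ord1 expr1n invr1; lra.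
rewrite big_ord_recr /=; apply: le_trans (lerD IH (lexx _)) _.
have k0 : 0 < k.+1%:R :> R by rewrite ltr0n.
rewrite -(natr1 k.+1); move: (k.+1%:R : R) k0 => x x0.
rewrite -subr_ge0.
have -> : 2 - (x + 1)^-1 - (2 - x^-1 + ((x + 1) ^+ 2)^-1) = (x * (x + 1) ^+ 2)^-1.
  by field; apply/andP; split; rewrite gt_eqF//; lra.
by rewrite invr_ge0 mulr_ge0 ?ltW// exprn_gt0//; lra.
Qed.

Section weight.
Variable delta : R.
Hypothesis delta_gt0 : 0 < delta.
Hypothesis delta_le : delta <= 2^-1.

(* The factor in front of [delta ^+ k] makes the weighted space an algebra
   for the Cauchy product, with a submultiplicative norm. *)
Definition weight (k : nat) : R := delta ^+ k / (8 * k.+1%:R ^+ 2).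

Definition bnd (M : R) a : Prop := forall k, `|a k| <= M * weight k.

Lemma weight_gt0 k : 0 < weight k.
Proof. by rewrite /weight divr_gt0 ?exprn_gt0// mulr_gt0// exprn_gt0// ltr0n. Qed.

Let d1 : delta <= 1.
Proof. by move: delta_le; lra. Qed.

Lemma weight_le_exp k : 8 * weight k <= delta ^+ k.
Proof.
have k0 : 0 < k.+1%:R :> R by rewrite ltr0n.
have -> : 8 * weight k = delta ^+ k * (k.+1%:R ^+ 2)^-1.
  by rewrite /weight; field; rewrite gt_eqF.
rewrite ler_piMr ?exprn_ge0 ?(ltW delta_gt0)//.
by rewrite invf_le1 ?exprn_gt0 ?ltr0n// exprn_ege1// ler1n.
Qed.

Lemma weight_le1 k : 8 * weight k <= 1.
Proof. by apply: le_trans (weight_le_exp k) _; rewrite exprn_ile1// ltW. Qed.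

Lemma weightS k i : weight (k + i) <= delta ^+ i * weight k.
Proof.
rewrite /weight exprD [delta ^+ k * _]mulrC [leRHS]mulrA ler_wpM2l//.
  by rewrite mulr_ge0// exprn_ge0// ltW.
rewrite lef_pV2 ?posrE ?mulr_gt0 ?exprn_gt0 ?ltr0n// ler_wpM2l//.
by rewrite lerXn2r ?nnegrE// ler_nat ltnS leq_addr.
Qed.

(** With x = i + 1 and y = k - i + 1, the bound 1/(x y)^2 <= 2/(x + y)^2 (1/x^2 + 1/y^2) has a
    square as its defect. The sums of inverse squares are at most 2 each, so the total constant is 2
    (2 + 2) / 64 = 1/8: this is the origin of the 8 in [weight]. *)
Lemma weight_conv k : \sum_(i < k.+1) weight i * weight (k - i)%N <= weight k.
Proof.
have E (i : 'I_k.+1) : weight i * weight (k - i)%N <=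
    delta ^+ k / 64 * (2 / k.+2%:R ^+ 2) * ((i.+1%:R ^+ 2)^-1 + ((k - i).+1%:R ^+ 2)^-1).
  have ik : (i <= k)%N by rewrite -ltnS.
  rewrite /weight -[in delta ^+ k](subnKC ik) exprD.
  have -> : k.+2%:R = i.+1%:R + (k - i).+1%:R :> R.
    by rewrite -natrD addSn addnS subnKC.
  have x0 : 0 < i.+1%:R :> R by rewrite ltr0n.
  have y0 : 0 < (k - i).+1%:R :> R by rewrite ltr0n.
  move: (i.+1%:R : R) ((k - i).+1%:R : R) (delta ^+ i) (delta ^+ (k - i))
    (exprn_gt0 i delta_gt0) (exprn_gt0 (k - i) delta_gt0) x0 y0.
  move=> x y A B A0 B0 x0 y0.
  rewrite -subr_ge0.
  have -> : A * B / 64 * (2 / (x + y) ^+ 2) * ((x ^+ 2)^-1 + (y ^+ 2)^-1) -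
     A / (8 * x ^+ 2) * (B / (8 * y ^+ 2)) = A * B / 64 * ((x - y) / ((x + y) * x * y)) ^+ 2.
    by field; do ?[apply/andP; split]; rewrite gt_eqF//; lra.
  by rewrite mulr_ge0 ?sqr_ge0// divr_ge0// mulr_ge0// ltW.
apply: le_trans (ler_sum _ (fun i _ => E i)) _.
rewrite -mulr_sumr big_split /=.
have -> : \sum_(i < k.+1) ((k - i).+1%:R ^+ 2)^-1 = \sum_(i < k.+1) (i.+1%:R ^+ 2)^-1 :> R.
  rewrite (reindex_inj rev_ord_inj) /=; apply: eq_bigr => i _.
  by rewrite subSS subKn// -ltnS.
have S : \sum_(i < k.+1) (i.+1%:R ^+ 2)^-1 <= 2 :> R.
  by apply: le_trans (sum_inv_sqr_le k) _; rewrite gerBl invr_ge0.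
have c0 : 0 <= delta ^+ k / 64 * (2 / k.+2%:R ^+ 2).
  by rewrite !mulr_ge0 ?invr_ge0 ?exprn_ge0// ltW.
apply: le_trans (ler_wpM2l c0 (lerD S S)) _.
rewrite /weight.
have -> : delta ^+ k / 64 * (2 / k.+2%:R ^+ 2) * (2 + 2) = delta ^+ k / 8 * (k.+2%:R ^+ 2)^-1.
  by field; rewrite gt_eqF// ltr0n.
rewrite [in leRHS]invfM [leRHS]mulrA ler_wpM2l//.
  by rewrite mulr_ge0 ?invr_ge0 ?exprn_ge0// ltW.
by rewrite lef_pV2 ?posrE ?exprn_gt0 ?ltr0n// lerXn2r ?nnegrE// ler_nat.
Qed.

Lemma bnd_ge0 M a : bnd M a -> 0 <= M.
Proof.
move=> /(_ 0%N) /(le_trans (normr_ge0 _)); rewrite pmulr_lge0//; exact: weight_gt0.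
Qed.

Lemma bnd_le M M' a : M <= M' -> bnd M a -> bnd M' a.
Proof.
by move=> MM Ha k; rewrite (le_trans (Ha k))// ler_wpM2r// ltW// weight_gt0.
Qed.

Lemma bnd_eq M a b : (forall k, a k = b k) -> bnd M a -> bnd M b.
Proof. by move=> ab Ha k; rewrite -ab. Qed.

Lemma bnd0 : bnd 0 (fun=> 0).
Proof. by move=> k; rewrite normr0 mul0r. Qed.

Lemma bndD M M' a b : bnd M a -> bnd M' b -> bnd (M + M') (fun k => a k + b k).
Proof. by move=> Ha Hb k; rewrite mulrDl (le_trans (ler_normD _ _))// lerD. Qed.

Lemma bndB M M' a b : bnd M a -> bnd M' b -> bnd (M + M') (fun k => a k - b k).
Proof. by move=> Ha Hb k; rewrite mulrDl (le_trans (ler_normB _ _))// lerD. Qed.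

Lemma bndZ c M a : bnd M a -> bnd (`|c| * M) (fun k => c * a k).
Proof. by move=> Ha k; rewrite normrM -mulrA ler_wpM2l. Qed.

Lemma bndM M M' a b : bnd M a -> bnd M' b -> bnd (M * M') (cmul a b).
Proof.
move=> Ha Hb k; have M0 := bnd_ge0 Ha; have M'0 := bnd_ge0 Hb.
rewrite /cmul (le_trans (ler_norm_sum _ _ _))//.
apply: le_trans (ler_wpM2l (mulr_ge0 M0 M'0) (weight_conv k)).
rewrite mulr_sumr; apply: ler_sum => i _; rewrite normrM mulrACA.
by apply: ler_pM.
Qed.

Lemma bnd_analytic M a : bnd M a -> analytic a.
Proof.
move=> Ha; exists M, delta; split => //; first by move: delta_le; lra.
move=> k; rewrite (le_trans (Ha k))// ler_wpM2l ?(bnd_ge0 Ha)//.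
by apply: le_trans (weight_le_exp k); rewrite ler_peMl ?ltW ?weight_gt0//; lra.
Qed.

Lemma bnd_psum M a t : bnd M a -> `|t| <= 1 -> `|psum a t| <= M.
Proof.
move=> Ha t1; have M0 := bnd_ge0 Ha.
have C := is_cvg_psum (bnd_analytic Ha) t1.
apply: (@ler_cvg_to nat \oo _ R (fun i => `|pseries a t i|) (fun=> M) `|psum a t| M).
- by apply: cvg_norm; exact: C.
- exact: cvg_cst.
apply: nearW => i; rewrite /pseries /series /= big_mkord.
apply: le_trans (ler_norm_sum _ _ _) _.
apply: (@le_trans _ _ (\sum_(k < i) M / 8 * delta ^+ k)).
  apply: ler_sum => k _; rewrite normrM normrX.
  apply: (@le_trans _ _ (M * weight k)).
    by rewrite -[leRHS]mulr1 ler_pM// ?exprn_ge0// exprn_ile1.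
  rewrite -mulrA ler_wpM2l// mulrC ler_pdivlMr// mulrC; exact: weight_le_exp.
rewrite -mulr_sumr.
have d0 := ltW delta_gt0.
have dl1 : delta < 1 by move: delta_le; lra.
apply: le_trans (ler_wpM2l (_ : 0 <= M / 8) (sum_exp_le i d0 dl1)) _.
  by rewrite divr_ge0.
rewrite -[leRHS]mulr1 -mulrA ler_wpM2l// mulrC ler_pdivrMr// mul1r.
have : (1 - delta)^-1 <= 2.
  by rewrite -[leRHS]invrK lef_pV2 ?posrE ?invr_gt0 ?subr_gt0//; move: delta_le; lra.
by lra.
Qed.

Lemma bnd_polyc (q : {poly R}) : exists M, bnd M (polyc q).
Proof.
exists (\sum_(i < size q) `|q`_i| / weight i) => k.
have w0 i : 0 <= `|q`_i| / weight i by rewrite divr_ge0// ltW// weight_gt0.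
have [qk|kq] := leqP (size q) k.
  rewrite /polyc nth_default// normr0 mulr_ge0 ?sumr_ge0//.
  by rewrite ltW// weight_gt0.
rewrite -ler_pdivrMr ?weight_gt0// (bigD1 (Ordinal kq))//= lerDl.
by apply: sumr_ge0.
Qed.

(** The contraction principle carried out by hand for the predicate [bnd]: the iterates converge in
    each coordinate, and the geometric bounds, uniform with respect to the weight, pass to the
    limit. *)
Lemma bnd_fixed_point (T : (nat -> R) -> nat -> R) :
  (forall x, bnd 1 x -> bnd 1 (T x)) ->
  (forall M x x', bnd 1 x -> bnd 1 x' -> bnd M (fun k => x k - x' k) ->
     bnd (2^-1 * M) (fun k => T x k - T x' k)) ->
  exists x, bnd 1 x /\ forall k, T x k = x k.
Proof.
move=> T1 T2; pose x i := iter i T (fun=> 0).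
have x1 i : bnd 1 (x i).
  elim: i => [|i IH]; last exact: T1.
  by apply: bnd_le bnd0; lra.
have dx i : bnd (2^-1 ^+ i) (fun k => x i.+1 k - x i k).
  elim: i => [|i IH]; last by rewrite exprS; exact: (T2 _ _ _ (x1 _) (x1 _) IH).
  by move=> k; rewrite /= subr0 expr0; exact: (x1 1%N).
(* The exact sum of the geometric bounds, rather than 2 / 2^i, so that the induction on [m]
   closes. *)
have dxm m i : bnd (2 * 2^-1 ^+ i - 2 * 2^-1 ^+ (i + m)) (fun k => x (i + m)%N k - x i k).
  elim: m => [|m IH].
    by rewrite addn0 subrr => k; rewrite subrr normr0 mul0r.
  have -> : 2 * 2^-1 ^+ i - 2 * 2^-1 ^+ (i + m.+1) =
      2^-1 ^+ (i + m) + (2 * 2^-1 ^+ i - 2 * 2^-1 ^+ (i + m)) :> R.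
    by rewrite addnS exprS; field.
  apply: bnd_eq (bndD (dx (i + m)%N) IH) => k; rewrite addnS.
  by rewrite addrA subrK.
have dxm' m i : bnd (2 * 2^-1 ^+ i) (fun k => x (i + m)%N k - x i k).
  by apply: bnd_le (dxm m i); rewrite gerBl mulr_ge0// exprn_ge0.
have cx k : cvgn (x^~ k).
  have -> : x^~ k = series (fun i => x i.+1 k - x i k).
    apply/funext => i; rewrite /series /= telescope_sumr// subr0 //.
  apply: normed_cvg; apply: (@series_le_cvg _ _ (geometric (weight k) 2^-1)) => [i|i|i|].
  - exact: normr_ge0.
  - by rewrite /geometric /= mulr_ge0 ?exprn_ge0// ltW// weight_gt0.
  - by rewrite /geometric /= mulrC; exact: dx.
  - by apply: is_cvg_geometric_series; rewrite ger0_norm; lra.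
pose X k := limn (x^~ k).
have Xx i : bnd (2 * 2^-1 ^+ i) (fun k => X k - x i k).
  move=> k.
  apply: (@ler_cvg_to nat \oo _ R (fun m => `|x (i + m)%N k - x i k|) (fun=> 2 * 2^-1 ^+ i * weight k)
     `|X k - x i k| (2 * 2^-1 ^+ i * weight k)).
  - apply: cvg_norm; apply: cvgB; last exact: cvg_cst.
    have -> : (fun m => x (i + m)%N k) = (fun m => x (m + i)%N k).
      by apply/funext => m; rewrite addnC.
    have := cx k; rewrite -(cvg_shiftn i) /= => H; exact: H.
  - exact: cvg_cst.
  - by apply: nearW => m; exact: dxm'.
have X1 : bnd 1 X.
  move=> k.
  apply: (@ler_cvg_to nat \oo _ R (fun m => `|x m k|) (fun=> 1 * weight k) `|X k| (1 * weight k)).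
  - by apply: cvg_norm; exact: cx.
  - exact: cvg_cst.
  - by apply: nearW => m; exact: x1.
exists X; split => // k.
have TX i : `|T X k - X k| <= 4 * weight k * 2^-1 ^+ i.
  have H1 := T2 _ _ _ X1 (x1 i) (Xx i) k.
  have H2 := Xx i.+1 k.
  rewrite (_ : T X k - X k = (T X k - T (x i) k) - (X k - x i.+1 k)); last first.
    by rewrite /=; ring.
  rewrite (le_trans (ler_normB _ _))// (le_trans (lerD H1 H2))//.
  rewrite exprS.
  have : 0 <= weight k * 2^-1 ^+ i by rewrite mulr_ge0 ?exprn_ge0// ltW// weight_gt0.
  by move: (2^-1 ^+ i) (weight k) => u v; lra.
have c0 : (fun i => 4 * weight k * 2^-1 ^+ i) @ \oo --> (0 : R).
  by apply: (@cvg_geometric _ (4 * weight k) 2^-1); rewrite ger0_norm; lra.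
have : `|T X k - X k| <= 0.
  apply: (@ler_cvg_to nat \oo _ R (fun i => `|T X k - X k|) _ _ _ (cvg_cst _) c0).
  by apply: nearW => i; exact: TX.
by rewrite normr_le0 subr_eq0 => /eqP.
Qed.

End weight.

End weighted_sequences.

(** * Lipschitz maps on the weighted unit ball and their fixed points *)

Section lipschitz_maps.
Context {R : realType} (delta : R).
Hypothesis delta_gt0 : 0 < delta.
Hypothesis delta_le : delta <= 2^-1.
Local Notation bnd := (bnd delta).
Implicit Types (f : R -> (nat -> R) -> R) (Phi Psi : R -> (nat -> R) -> nat -> R).

(** Bounds and Lipschitz constants on the unit ball, uniform for r in [0, 1]; [lips] is for scalars
    and [lip] for sequences. Closure under sums and products lets the nonlinear term of the equation
    be handled by its shape alone. *)
Definition lips f : Prop := exists2 C, 0 <= C & forall r x x',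
  0 <= r <= 1 -> bnd 1 x -> bnd 1 x' -> `|f r x| <= C /\
  forall M, bnd M (fun k => x k - x' k) -> `|f r x - f r x'| <= C * M.

Definition lip Phi : Prop := exists2 C, 0 <= C & forall r x x',
  0 <= r <= 1 -> bnd 1 x -> bnd 1 x' -> bnd C (Phi r x) /\
  forall M, bnd M (fun k => x k - x' k) ->
    bnd (C * M) (fun k => Phi r x k - Phi r x' k).

Lemma lips_param f : (exists C, forall r x x', 0 <= r <= 1 -> `|f r x| <= C /\ f r x = f r x') ->
  lips f.
Proof.
move=> [C H]; exists `|C| => // r x x' r01 _ _; have [fC ff] := H r x x' r01.
split; first by rewrite (le_trans fC)// ler_norm.
by move=> M /(bnd_ge0 delta_gt0) M0; rewrite ff subrr normr0 mulr_ge0.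
Qed.

Lemma lips_cst c : lips (fun _ _ => c).
Proof. by apply: lips_param; exists `|c|. Qed.

Lemma lips_var : lips (fun r _ => r).
Proof. by apply: lips_param; exists 1 => r _ _ /andP[r0 r1]; rewrite ger0_norm. Qed.

Lemma lips_coord j : lips (fun _ x => x j).
Proof.
have w1 : weight delta j <= 1.
  have := weight_le1 delta_gt0 delta_le j; have := weight_gt0 delta_gt0 j; lra.
exists 1 => // r x x' _ /(_ j) xj _; split; first by rewrite (le_trans xj)// mul1r.
move=> M HM; rewrite mul1r (le_trans (HM j))//.
by rewrite ler_piMr// (bnd_ge0 delta_gt0 HM).
Qed.

Lemma lipsD f g : lips f -> lips g -> lips (fun r x => f r x + g r x).
Proof.
move=> [C C0 Hf] [D D0 Hg]; exists (C + D); first exact: addr_ge0.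
move=> r x x' r01 x1 x'1; have [f1 f2] := Hf r x x' r01 x1 x'1.
have [g1 g2] := Hg r x x' r01 x1 x'1; split.
  by rewrite (le_trans (ler_normD _ _))// lerD.
move=> M HM; rewrite opprD addrACA mulrDl (le_trans (ler_normD _ _))// lerD//.
  exact: f2.
exact: g2.
Qed.

Lemma lipsM f g : lips f -> lips g -> lips (fun r x => f r x * g r x).
Proof.
move=> [C C0 Hf] [D D0 Hg]; exists (C * D + C * D); first by rewrite addr_ge0// mulr_ge0.
move=> r x x' r01 x1 x'1; have [f1 f2] := Hf r x x' r01 x1 x'1.
have [g1 g2] := Hg r x x' r01 x1 x'1; split.
  by rewrite normrM (le_trans (ler_pM _ _ f1 g1))// lerDl mulr_ge0.
have [f1' _] := Hf r x' x r01 x'1 x1.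
move=> M HM; have -> : f r x * g r x - f r x' * g r x' =
  (f r x - f r x') * g r x + f r x' * (g r x - g r x') by ring.
rewrite (le_trans (ler_normD _ _))// !normrM.
have -> : (C * D + C * D) * M = C * M * D + C * (D * M) by ring.
by apply: lerD; apply: ler_pM => //; [exact: f2|exact: g2].
Qed.

Lemma lip_cst M a : bnd M a -> lip (fun _ _ => a).
Proof.
move=> Ha; have M0 := bnd_ge0 delta_gt0 Ha; exists M => // r x x' _ _ _; split=> //.
move=> M' /(bnd_ge0 delta_gt0) M'0 k; rewrite subrr normr0.
by apply: mulr_ge0; [exact: mulr_ge0|exact/ltW/weight_gt0].
Qed.

Lemma lip_erase j : lip (fun _ x k => if k == j then 0 else x k).
Proof.
exists 1 => // r x x' _ x1 x'1; split.
  move=> k; case: ifP => // _.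
  by rewrite normr0 mul1r ltW// weight_gt0.
move=> M HM k; have M0 := bnd_ge0 delta_gt0 HM; rewrite mul1r; case: ifP => // _.
by rewrite subrr normr0 mulr_ge0// ltW// weight_gt0.
Qed.

Lemma lipD Phi Psi : lip Phi -> lip Psi -> lip (fun r x k => Phi r x k + Psi r x k).
Proof.
move=> [C C0 Hf] [D D0 Hg]; exists (C + D); first exact: addr_ge0.
move=> r x x' r01 x1 x'1; have [f1 f2] := Hf r x x' r01 x1 x'1.
have [g1 g2] := Hg r x x' r01 x1 x'1; split; first exact: bndD.
move=> M HM; rewrite mulrDl; apply: bnd_eq (bndD (f2 _ HM) (g2 _ HM)) => k.
by ring.
Qed.

Lemma lipZ f Phi : lips f -> lip Phi -> lip (fun r x k => f r x * Phi r x k).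
Proof.
move=> [C C0 Hf] [D D0 Hg]; exists (C * D + C * D); first by rewrite addr_ge0// mulr_ge0.
move=> r x x' r01 x1 x'1; have [f1 f2] := Hf r x x' r01 x1 x'1.
have [g1 g2] := Hg r x x' r01 x1 x'1; split.
  apply: (bnd_le delta_gt0) (bndZ _ g1).
  by rewrite (le_trans (ler_wpM2r D0 f1))// lerDl mulr_ge0.
have [f1' _] := Hf r x' x r01 x'1 x1.
move=> M HM; have M0 := bnd_ge0 delta_gt0 HM.
have HA := bnd_le delta_gt0 (ler_wpM2r D0 (f2 _ HM)) (bndZ (f r x - f r x') g1).
have HB := bnd_le delta_gt0 (ler_wpM2r (mulr_ge0 D0 M0) f1') (bndZ (f r x') (g2 _ HM)).
have -> : (C * D + C * D) * M = C * M * D + C * (D * M) by ring.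
by apply: bnd_eq (bndD HA HB) => k; ring.
Qed.

Lemma lip_cmul Phi Psi : lip Phi -> lip Psi -> lip (fun r x => cmul (Phi r x) (Psi r x)).
Proof.
move=> [C C0 Hf] [D D0 Hg]; exists (C * D + C * D); first by rewrite addr_ge0// mulr_ge0.
move=> r x x' r01 x1 x'1; have [f1 f2] := Hf r x x' r01 x1 x'1.
have [g1 g2] := Hg r x x' r01 x1 x'1; split.
  by apply: (bnd_le delta_gt0) (bndM delta_gt0 f1 g1); rewrite lerDl mulr_ge0.
have [f1' _] := Hf r x' x r01 x'1 x1.
move=> M HM.
have HA := bndM delta_gt0 (f2 _ HM) g1.
have HB := bndM delta_gt0 f1' (g2 _ HM).
have -> : (C * D + C * D) * M = C * M * D + C * (D * M) by ring.
apply: bnd_eq (bndD HA HB) => k; rewrite /cmul -big_split /= -sumrB.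
by apply: eq_bigr => i _; ring.
Qed.

Definition band (al be ga : nat -> R) (a : nat -> R) : nat -> R :=
  fun k => al k * a k + be k * a k.+2 + ga k * a k.+4.

(** Reading the coefficient k + 2 or k + 4 at place k gains a factor [delta]; this is what makes
    off-diagonal bands small. *)
Lemma bnd_band K K' M al be ga a : (forall k, `|al k| <= K) ->
  (forall k, `|be k| <= K') -> (forall k, `|ga k| <= K') ->
  bnd M a -> bnd ((K + 2 * K' * delta) * M) (band al be ga a).
Proof.
move=> Hal Hbe Hga Ha k; have M0 := bnd_ge0 delta_gt0 Ha.
have K'0 : 0 <= K' by exact: le_trans (Hbe 0%N).
have w0 := weight_gt0 delta_gt0 k.
have wi i : (0 < i)%N -> `|a (k + i)%N| <= M * (delta * weight delta k).
  move=> i0; rewrite (le_trans (Ha _))// ler_wpM2l//.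
  apply: le_trans (weightS delta_gt0 k i) _.
  rewrite ler_wpM2r ?(ltW w0)// -{2}[delta]expr1.
  apply: ler_wiXn2l => //; [exact: ltW|move: delta_le; lra].
have H1 := ler_pM (normr_ge0 _) (normr_ge0 _) (Hal k) (Ha k).
have H2 := ler_pM (normr_ge0 _) (normr_ge0 _) (Hbe k) (wi 2%N isT).
have H3 := ler_pM (normr_ge0 _) (normr_ge0 _) (Hga k) (wi 4%N isT).
rewrite -!normrM addn2 addn4 in H1 H2 H3.
rewrite /band (le_trans (ler_normD _ _))// (le_trans (lerD (ler_normD _ _) (lexx _)))//.
by rewrite (le_trans (lerD (lerD H1 H2) H3))//; move: (weight delta k) => w; lra.
Qed.

Lemma bandB al be ga a b k : band al be ga (fun k => a k - b k) k =
  band al be ga a k - band al be ga b k.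
Proof. by rewrite /band; ring. Qed.

Lemma lip_band K al be ga Phi : (forall k, `|al k| <= K) ->
  (forall k, `|be k| <= K) -> (forall k, `|ga k| <= K) ->
  lip Phi -> lip (fun r x => band al be ga (Phi r x)).
Proof.
move=> Hal Hbe Hga [C C0 H].
have K0 : 0 <= K by exact: le_trans (Hbe 0%N).
exists ((K + 2 * K * delta) * C).
  by rewrite mulr_ge0// addr_ge0// !mulr_ge0// ltW.
move=> r x x' r01 x1 x'1; have [f1 f2] := H r x x' r01 x1 x'1; split.
  exact: bnd_band.
move=> M HM; rewrite -[_ * C * M]mulrA.
apply: bnd_eq (bnd_band Hal Hbe Hga (f2 _ HM)) => k.
exact: bandB.
Qed.

(* [(1 + s z)^i = 1 + i s z + s^2 binrem i s z]. *)
Fixpoint binrem (i : nat) (s : R) (z : nat -> R) : nat -> R :=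
  if i is i'.+1 then fun k =>
    binrem i' s z k + (i'%:R * cmul z z k + s * cmul z (binrem i' s z) k)
  else fun=> 0.

Lemma lip_binrem i f Phi : lips f -> lip Phi -> lip (fun r x => binrem i (f r x) (Phi r x)).
Proof.
move=> Hf HP; elim: i => [|i IH] /=; first exact: (@lip_cst 0 _ (@bnd0 _ delta)).
apply: lipD => //; apply: lipD.
  exact: (lipZ (lips_cst _) (lip_cmul HP HP)).
exact: (lipZ Hf (lip_cmul HP IH)).
Qed.

(** For r <= r0 with r0 (C + 1) = 1/4, the linear part and [r * Phi] contribute at most 1/4 each, so
    their sum is a contraction of ratio 1/2 that preserves the unit ball. *)
Lemma lip_fixed_point (Lam : (nat -> R) -> nat -> R) Phi :
  (forall M x, bnd M x -> bnd (4^-1 * M) (Lam x)) ->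
  (forall x x' k, Lam (fun k => x k - x' k) k = Lam x k - Lam x' k) ->
  lip Phi ->
  exists2 r0, 0 < r0 <= 1 & forall r, 0 <= r <= r0 ->
    exists x, bnd 1 x /\ forall k, Lam x k - r * Phi r x k = x k.
Proof.
move=> HL LB [C C0 HP]; pose r0 := (4 * (C + 1))^-1.
have r00 : 0 < r0 by rewrite invr_gt0; lra.
have r0C : r0 * (C + 1) = 4^-1 by rewrite /r0; field; rewrite gt_eqF//; lra.
have r01 : r0 <= 1 by rewrite /r0 invf_le1; lra.
exists r0; first by rewrite r00.
move=> r /andP[r_ge0 rr].
have rC : r * C <= 4^-1.
  have h1 : r * C <= r0 * C by rewrite ler_wpM2r.
  by have h2 : 0 <= r0 := ltW r00; lra.
have r1 : 0 <= r <= 1 by rewrite r_ge0/= (le_trans rr).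
have nr : `|r| = r by rewrite ger0_norm.
apply: (bnd_fixed_point delta_gt0).
  move=> x x1; have [H1 _] := HP r x x r1 x1 x1.
  apply: (bnd_le delta_gt0) (bndB (HL _ _ x1) (bndZ r H1)); rewrite nr; lra.
move=> M x x' x1 x'1 HM; have [_ H2] := HP r x x' r1 x1 x'1.
have M0 := bnd_ge0 delta_gt0 HM.
have : bnd (2^-1 * M) (fun k => Lam (fun k => x k - x' k) k - r * (Phi r x k - Phi r x' k)).
  apply: (bnd_le delta_gt0) (bndB (HL _ _ HM) (bndZ r (H2 _ HM))); rewrite nr.
  by have := ler_wpM2r M0 rC; lra.
by apply: bnd_eq => k; rewrite LB; ring.
Qed.

End lipschitz_maps.

(** * Bifurcation from the constant solution *)

Section branch.
Context {R : realType} (n j : nat) (sg : R).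
Hypothesis n_gt2 : (2 < n)%N.
Hypothesis j_gt0 : (0 < j)%N.
Hypothesis sg_ge1 : 1 <= sg.
Local Notation lam := (@eigenval R n).
Local Notation l := (@eigenval R n j).
Local Notation P := (polyc (@geg R n j)).
Local Notation c k := (k.+1%:R * k.+2%:R : R).

Let n3 : @Order.le _ R 3 n%:R. Proof. by rewrite (ler_nat _ 3). Qed.

Let j1 : @Order.le _ R 1 j%:R. Proof. by rewrite ler1n. Qed.

Lemma eigenval_ge1 : 1 <= l.
Proof.
by have [n3' j1'] := conj n3 j1; rewrite /eigenval -[leLHS]mulr1 ler_pM//; lra.
Qed.

Let base : [/\ @Order.le _ R 3 n%:R, @Order.le _ R 1 j%:R, 1 <= sg, 1 <= l & 1 <= sg * l].
Proof. by have l1 := eigenval_ge1; split=> //; rewrite -[leLHS]mulr1 ler_pM. Qed.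

(* The diagonal of the linearization at the bifurcation point: the [j]-th
   unknown is the shift of the eigenvalue instead of a coefficient. *)
Definition branch_diag k : R :=
  if k == j then - ((sg + 1) * l) else (lam k - l) * (lam k + sg * l).
Local Notation D := branch_diag.

Let K2 : R := 2 * (j%:R + 2) * (j%:R + 1) ^+ 4.

(** The diagonal grows like k^4 and thus controls the polynomial growth of all the bands. For k <>
    j, |lam_k - l| is |k - j| (k + j + n - 1) with |k - j| >= 1, which costs the factor j + 2 of
    [K2]; the other eigenvalue factor costs 2, and the exceptional place k = j costs (j + 1)^4. *)
Lemma branch_diag_ge k : k.+1%:R ^+ 4 <= K2 * `|D k|.
Proof.
have [n3' j1' sg1 l1 sl] := base.
have k0 : 0 <= k%:R :> R by [].
have j41 : 1 <= (j%:R + 1) ^+ 4 :> R by rewrite exprn_ege1//; lra.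
rewrite /D /K2; case: eqVneq => [->|kj].
  have h : 1 <= (sg + 1) * l by lra.
  rewrite normrN ger0_norm; last by lra.
  rewrite -(natr1 j) mulrAC ler_peMl//.
  have : 4 <= 2 * (j%:R + 2) :> R by lra.
  by move=> h2; apply: le_trans (ler_pM _ _ h2 h) => //; lra.
rewrite normrM (ger0_norm (_ : 0 <= lam k + sg * l)); last first.
  by rewrite addr_ge0//; [rewrite /eigenval mulr_ge0//; lra|lra].
have A : k.+1%:R ^+ 2 <= (j%:R + 2) * `|lam k - l|.
  have -> : lam k - l = (k%:R - j%:R) * (k%:R + j%:R + n%:R - 1).
    by rewrite /eigenval; ring.
  rewrite normrM (ger0_norm (_ : 0 <= k%:R + j%:R + n%:R - 1)); last by lra.
  rewrite expr2 mulrA -(natr1 k) ler_pM ?addr_ge0//; last by lra.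
  have [jk|kj'] := ltnP j k.
    have : j.+1%:R <= k%:R :> R by rewrite ler_nat.
    rewrite -natr1 => h; rewrite ger0_norm; last by lra.
    rewrite -subr_ge0.
    have -> : (j%:R + 2) * (k%:R - j%:R) - (k%:R + 1) = (j%:R + 1) * (k%:R - j%:R - 1) :> R by ring.
    by rewrite mulr_ge0//; lra.
  have : k.+1%:R <= j%:R :> R by rewrite ler_nat ltn_neqAle kj.
  rewrite -natr1 => h; rewrite ler0_norm; last by lra.
  rewrite -subr_ge0.
  have -> : (j%:R + 2) * - (k%:R - j%:R) - (k%:R + 1) =
     (j%:R + 2) * (j%:R - k%:R - 1) + (j%:R - k%:R) + 1 :> R by ring.
  have h1 : 0 <= (j%:R + 2) * (j%:R - k%:R - 1) :> R by rewrite mulr_ge0//; lra.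
  by lra.
have B : k.+1%:R ^+ 2 <= 2 * (lam k + sg * l).
  have h : k%:R ^+ 2 <= lam k by rewrite /eigenval expr2 ler_wpM2l//; lra.
  have h3 := sqr_ge0 (k%:R - 1 : R).
  have -> : k.+1%:R ^+ 2 = 2 * k%:R ^+ 2 + 2 - (k%:R - 1) ^+ 2 :> R.
    by rewrite -natr1; ring.
  by lra.
have -> : k.+1%:R ^+ 4 = k.+1%:R ^+ 2 * k.+1%:R ^+ 2 :> R by rewrite -exprD.
apply: le_trans (ler_pM _ _ A B) _ => //; rewrite ?exprn_ge0//.
rewrite (_ : 2 * _ * _ * _ = (j%:R + 2) * `|lam k - l| * (2 * (lam k + sg * l)) * (j%:R + 1) ^+ 4); last by ring.
have a0 := le_trans (exprn_ge0 2 (ler0n R k.+1)) A.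
have b0 := le_trans (exprn_ge0 2 (ler0n R k.+1)) B.
by rewrite ler_peMr// mulr_ge0.
Qed.

Lemma branch_diag_neq0 k : D k != 0.
Proof.
apply/eqP => D0; have := branch_diag_ge k; rewrite D0 normr0 mulr0.
by rewrite leNgt exprn_gt0// ltr0n.
Qed.

(** Large enough to bound sg, l and sg l, and to bound each of lam_k, lam_(k+2), (k+1)(k+2) and
    (k+3)(k+4) after multiplication by (k + 1)^2. *)
Let B : R := 2 * n%:R + 14 + l + sg * l + sg.

Let K := 3 * B ^+ 2 * K2.

Lemma branch_ratio k (v : R) : `|v| <= 3 * B ^+ 2 * k.+1%:R ^+ 4 -> `|v / D k| <= K.
Proof.
move=> Hv; rewrite normf_div ler_pdivrMr ?normr_gt0 ?branch_diag_neq0//.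
apply: le_trans Hv _; rewrite /K -[leRHS]mulrA ler_wpM2l ?branch_diag_ge//.
by rewrite mulr_ge0// sqr_ge0.
Qed.

Let lamB k : 0 <= lam k <= B * k.+1%:R ^+ 2.
Proof.
have [n3' j1' sg1 l1 sl] := base.
have k0 : 0 <= k%:R :> R by [].
rewrite /eigenval mulr_ge0//=; last by lra.
rewrite -natr1; move: (k%:R : R) k0 => x x0.
have h : x * (x + n%:R - 1) <= n%:R * (x + 1) ^+ 2.
  rewrite -subr_ge0.
  have -> : n%:R * (x + 1) ^+ 2 - x * (x + n%:R - 1) = (n%:R - 1) * x ^+ 2 + (n%:R + 1) * x + n%:R by ring.
  by rewrite !addr_ge0 ?mulr_ge0 ?sqr_ge0//; lra.
apply: le_trans h _; rewrite ler_wpM2r ?sqr_ge0//.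
by rewrite /B; lra.
Qed.

Let lam2B k : 0 <= lam k.+2 <= B * k.+1%:R ^+ 2.
Proof.
have [n3' j1' sg1 l1 sl] := base.
have k0 : 0 <= k%:R :> R by [].
have k2 : 0 <= k.+2%:R + n%:R - 1 :> R.
  by have h : 0 <= k.+2%:R :> R by []; lra.
rewrite /eigenval (mulr_ge0 _ k2)//= {k2}.
rewrite -(natr1 k.+1) -natr1; move: (k%:R : R) k0 => x x0.
have h : (x + 1 + 1) * (x + 1 + 1 + n%:R - 1) <= (2 * (n%:R + 1)) * (x + 1) ^+ 2.
  rewrite -subr_ge0.
  have -> : (2 * (n%:R + 1)) * (x + 1) ^+ 2 - (x + 1 + 1) * (x + 1 + 1 + n%:R - 1) =
     (2 * n%:R + 1) * x ^+ 2 + (3 * n%:R + 1) * x by ring.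
  by rewrite !addr_ge0 ?mulr_ge0 ?sqr_ge0//; lra.
apply: le_trans h _; rewrite ler_wpM2r ?sqr_ge0//.
by rewrite /B; lra.
Qed.

Let cB k : 0 <= c k <= B * k.+1%:R ^+ 2.
Proof.
have [n3' j1' sg1 l1 sl] := base.
have k0 : 0 <= k%:R :> R by [].
rewrite mulr_ge0//= -(natr1 k.+1) -natr1; move: (k%:R : R) k0 => x x0.
have h : (x + 1) * (x + 1 + 1) <= 2 * (x + 1) ^+ 2 by nra.
apply: le_trans h _; rewrite ler_wpM2r ?sqr_ge0//.
by rewrite /B; lra.
Qed.

Let c2B k : 0 <= c k.+2 <= B * k.+1%:R ^+ 2.
Proof.
have [n3' j1' sg1 l1 sl] := base.
have k0 : 0 <= k%:R :> R by [].
rewrite mulr_ge0//= -(natr1 k.+3) -(natr1 k.+2) -(natr1 k.+1) -natr1.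
move: (k%:R : R) k0 => x x0.
have h : (x + 1 + 1 + 1) * (x + 1 + 1 + 1 + 1) <= 12 * (x + 1) ^+ 2 by nra.
apply: le_trans h _; rewrite ler_wpM2r ?sqr_ge0//.
by rewrite /B; lra.
Qed.

(* The Taylor coefficients in [e] of [(L - (l + e)) (L + sg (l + e))], divided
   by the diagonal. *)
Definition branch_op : (nat -> R) -> nat -> R :=
  band (fun k => (lam k - l) * (lam k + sg * l) / D k)
       (fun k => - (c k * (lam k + lam k.+2 + sg * l - l)) / D k)
       (fun k => (c k * c k.+2) / D k).

Definition branch_op' : (nat -> R) -> nat -> R :=
  band (fun k => ((sg - 1) * lam k - 2 * sg * l) / D k)
       (fun k => - ((sg - 1) * c k) / D k) (fun k => 0 / D k).

Definition branch_id : (nat -> R) -> nat -> R :=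
  band (fun k => 1 / D k) (fun k => 0 / D k) (fun k => 0 / D k).

Let prod4 k (u v C1 C2 : R) : `|u| <= C1 * k.+1%:R ^+ 2 -> `|v| <= C2 * k.+1%:R ^+ 2 ->
  C1 * C2 <= 3 * B ^+ 2 -> `|u * v| <= 3 * B ^+ 2 * k.+1%:R ^+ 4.
Proof.
move=> Hu Hv CC; rewrite normrM (le_trans (ler_pM _ _ Hu Hv))//.
by rewrite mulrACA -exprD ler_wpM2r// exprn_ge0.
Qed.

Let B1 : 1 <= B.
Proof.
have [n3' j1' sg1 l1 sl] := base.
by rewrite /B; lra.
Qed.

Let BB (a b : R) : 0 <= a -> 0 <= b -> a * b <= 3 -> a * B * (b * B) <= 3 * B ^+ 2.
Proof. by move=> a0 b0 ab; rewrite mulrACA -expr2 ler_wpM2r// sqr_ge0. Qed.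

Let u1 k : 1 <= k.+1%:R ^+ 2 :> R.
Proof. by rewrite exprn_ege1// ler1n. Qed.

Let const2 k (C : R) : 0 <= C -> C <= C * k.+1%:R ^+ 2.
Proof. by move=> C0; rewrite ler_peMr. Qed.

Let bnd_zero k : `|0 / D k| <= K.
Proof. by apply: branch_ratio; rewrite normr0 mulr_ge0 ?exprn_ge0// mulr_ge0 ?sqr_ge0. Qed.

Let bnd_be k : `|- (c k * (lam k + lam k.+2 + sg * l - l)) / D k| <= K.
Proof.
have [n3' j1' sg1 l1 sl] := base.
apply: branch_ratio; rewrite normrN; apply: (@prod4 _ _ _ (1 * B) (3 * B)).
- by have /andP[h h'] := cB k; rewrite ger0_norm// mul1r.
- have /andP[h1 h2] := lamB k; have /andP[h3 h4] := lam2B k.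
  have h5 : sg * l <= B by rewrite /B; lra.
  have h6 : l <= B by rewrite /B; lra.
  have h7 := const2 k (le_trans ler01 B1).
  by rewrite ler_norml; apply/andP; split; lra.
- by apply: BB; lra.
Qed.

Let bnd_ga k : `|(c k * c k.+2) / D k| <= K.
Proof.
apply: branch_ratio; apply: (@prod4 _ _ _ (1 * B) (1 * B)).
- by have /andP[h h'] := cB k; rewrite ger0_norm// mul1r.
- by have /andP[h h'] := c2B k; rewrite ger0_norm// mul1r.
- by apply: BB; lra.
Qed.

Lemma lip_branch_op delta Phi : 0 < delta -> delta <= 2^-1 ->
  lip delta Phi -> lip delta (fun r x => branch_op (Phi r x)).
Proof.
move=> d0 d2; have [n3' j1' sg1 l1 sl] := base.
apply: (lip_band d0 d2 (K := K)) => // k.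
have /andP[h1 h2] := lamB k; have h7 := const2 k (le_trans ler01 B1).
apply: branch_ratio; apply: (@prod4 _ _ _ (1 * B) (2 * B)); last by apply: BB; lra.
- have h6 : l <= B by rewrite /B; lra.
  by rewrite ler_norml; apply/andP; split; lra.
- have h6 : sg * l <= B by rewrite /B; lra.
  by rewrite ler_norml; apply/andP; split; lra.
Qed.

Lemma lip_branch_op' delta Phi : 0 < delta -> delta <= 2^-1 ->
  lip delta Phi -> lip delta (fun r x => branch_op' (Phi r x)).
Proof.
move=> d0 d2; have [n3' j1' sg1 l1 sl] := base.
have B0 := le_trans ler01 B1.
have sgB : sg <= B by rewrite /B; lra.
have aB : `|sg - 1| <= 1 * B * 1 by rewrite ler_norml; apply/andP; split; lra.
have h0 k : `|sg - 1| <= 1 * B * k.+1%:R ^+ 2.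
  by apply: le_trans aB _; rewrite mulr1 mul1r const2.
apply: (lip_band d0 d2 (K := K)) => // k.
- apply: branch_ratio; have /andP[h1 h2] := lamB k.
  have h3 : `|(sg - 1) * lam k| <= B * (B * k.+1%:R ^+ 2).
    by rewrite normrM ler_pM// ?ger0_norm//; lra.
  have h4 : sg * l <= B by rewrite /B; lra.
  have h5 : B <= B * (B * k.+1%:R ^+ 2).
    by rewrite ler_peMr// (le_trans B1)// const2.
  have h6 : B * (B * k.+1%:R ^+ 2) <= B ^+ 2 * k.+1%:R ^+ 4.
    rewrite mulrA -expr2 ler_wpM2l ?sqr_ge0// (_ : 4 = 2 + 2)%N// exprD ler_peMr//.
  rewrite (le_trans (ler_normB _ _))// (ger0_norm (_ : 0 <= 2 * sg * l)); last by lra.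
  by lra.
- apply: branch_ratio; rewrite normrN; apply: (@prod4 _ _ _ (1 * B) (1 * B)) => //.
    by have /andP[h h'] := cB k; rewrite ger0_norm// mul1r.
  by apply: BB; lra.
Qed.

Lemma lip_branch_id delta Phi : 0 < delta -> delta <= 2^-1 ->
  lip delta Phi -> lip delta (fun r x => branch_id (Phi r x)).
Proof.
move=> d0 d2; apply: (lip_band d0 d2 (K := K)) => // k.
apply: branch_ratio; rewrite normr1 -[leLHS]mulr1 ler_pM//.
  have : 1 <= B ^+ 2 by rewrite exprn_ege1.
  by lra.
by rewrite exprn_ege1// ler1n.
Qed.

(** The identity minus the linearized equation divided by its diagonal. The unknown x_j, being the
    shift of kappa, multiplies - (sg + 1) l P, the derivative in kappa of (L - kappa) (L + sg kappa)
    P at l; since P_j = 1, this explains the entry of [branch_diag] at j. *)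
Definition branch_lin (x : nat -> R) : nat -> R := fun k =>
  band (fun k => 0 / D k) (fun k => (c k * (lam k + lam k.+2 + sg * l - l)) / D k)
    (fun k => - (c k * c k.+2) / D k) (fun k => if k == j then 0 else x k) k +
  x j * ((sg + 1) * l * (P k - (k == j)%:R) / D k).

(** Both parts are strictly upper triangular: the bands read later coefficients, and the term in x_j
    acts only at places k < j because P has degree j and its j-th entry cancels. Each thus gains a
    factor [delta], and delta = 1 / (2 + 4 X) makes the total X delta at most 1/4. *)
Lemma branch_lin_contraction : exists delta, [/\ 0 < delta, delta <= 2^-1 &
  forall M x, bnd delta M x -> bnd delta (4^-1 * M) (branch_lin x)].
Proof.
have [n3' j1' sg1 l1 sl] := base.
have K20 : 0 <= K2 by rewrite /K2 !mulr_ge0 ?exprn_ge0//; lra.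
have K0 : 0 <= K by rewrite /K mulr_ge0// mulr_ge0 ?sqr_ge0.
pose KP : R := \sum_(i < j) `|P i|.
have KP0 : 0 <= KP by exact: sumr_ge0.
pose X := 2 * K + (sg + 1) * l * KP * K2.
have X0 : 0 <= X.
  rewrite /X addr_ge0//; first by lra.
  by rewrite !mulr_ge0//; lra.
pose delta := (2 + 4 * X)^-1.
have d0 : 0 < delta by rewrite invr_gt0; lra.
have d2 : delta <= 2^-1 by rewrite lef_pV2 ?posrE; lra.
have dX : X * delta <= 4^-1 by rewrite /delta ler_pdivrMr; lra.
exists delta; split => // M x Hx; have M0 := bnd_ge0 d0 Hx.
have Hy : bnd delta M (fun k => if k == j then 0 else x k).
  move=> k; case: ifP => // _; rewrite normr0 mulr_ge0//.
  exact/ltW/weight_gt0.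
have Hb1 k : `|(c k * (lam k + lam k.+2 + sg * l - l)) / D k| <= K.
  by have := bnd_be k; rewrite mulNr normrN.
have Hb2 k : `|- (c k * c k.+2) / D k| <= K by have := bnd_ga k; rewrite mulNr normrN.
have Hz k : `|0 / D k| <= 0 by rewrite mul0r normr0.
have H1 := bnd_band d0 d2 Hz Hb1 Hb2 Hy.
have H2 : bnd delta ((sg + 1) * l * KP * K2 * delta * M)
    (fun k => x j * ((sg + 1) * l * (P k - (k == j)%:R) / D k)).
  move=> k; have w0 := weight_gt0 d0 k.
  have R0 : 0 <= (sg + 1) * l * KP * K2 * delta * M * weight delta k.
    have s1 : 0 <= (sg + 1) * l by lra.
    exact: (mulr_ge0 (mulr_ge0 (mulr_ge0 (mulr_ge0 (mulr_ge0 s1 KP0) K20) (ltW d0)) M0) (ltW w0)).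
  have [jk|kj|jk] := ltngtP j k.
  - rewrite /polyc nth_default ?mulr0n ?subrr ?mulr0 ?mul0r ?mulr0 ?normr0//.
    exact: leq_trans (size_geg n j) jk.
  - rewrite mulr0n subr0 normrM normf_div.
    have h1 : `|x j| <= M * (delta * weight delta k).
      rewrite (le_trans (Hx j))// ler_wpM2l//.
      rewrite -{1}(subnKC (ltnW kj)); apply: le_trans (weightS d0 _ _) _.
      rewrite ler_wpM2r ?(ltW w0)// -{2}[delta]expr1.
      by apply: ler_wiXn2l; [exact: ltW|lra|rewrite subn_gt0].
    have h2 : `|P k| <= KP.
      by rewrite /KP (bigD1 (Ordinal kj))//= lerDl sumr_ge0.
    have h3 : `|D k|^-1 <= K2.
      rewrite -[leLHS]mul1r ler_pdivrMr ?normr_gt0 ?branch_diag_neq0//.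
      by apply: le_trans (branch_diag_ge k); rewrite exprn_ege1// ler1n.
    rewrite normrM (ger0_norm (_ : 0 <= (sg + 1) * l)); last by lra.
    have s1 : 0 <= (sg + 1) * l by lra.
    have D1 : 0 <= `|D k|^-1 by rewrite invr_ge0.
    have h4 := ler_pM (mulr_ge0 s1 (normr_ge0 (P k))) D1 (ler_wpM2l s1 h2) h3.
    have h5 := mulr_ge0 (mulr_ge0 s1 (normr_ge0 (P k))) D1.
    apply: le_trans (ler_pM (normr_ge0 _) h5 h1 h4) _.
    by rewrite le_eqVlt; apply/orP; left; apply/eqP; ring.
  - subst k; by rewrite /polyc geg_lead mulr1n subrr mulr0 mul0r mulr0 normr0.
apply: (bnd_le d0) (bndD H1 H2).
have := ler_wpM2r M0 dX; rewrite /X; lra.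
Qed.

Lemma branch_linB x x' k :
  branch_lin (fun k => x k - x' k) k = branch_lin x k - branch_lin x' k.
Proof.
by rewrite /branch_lin /band; do 3![case: (_ == j)]; ring.
Qed.

End branch.

(** * The branch of solutions of the coefficient equation *)

Section bifurcation.
Context {R : realType} (n j q m : nat) (sg om p : R).
Hypothesis n_gt2 : (2 < n)%N.
Hypothesis j_gt0 : (0 < j)%N.
Hypothesis sg_ge1 : 1 <= sg.
Local Notation lam := (@eigenval R n).
Local Notation l := (@eigenval R n j).
Local Notation P := (polyc (@geg R n j)).
Local Notation D := (branch_diag n j sg).

Lemma shifted_laplacec2E (e : R) (a : nat -> R) k :
  shifted_laplacec n (- (l + e)) (shifted_laplacec n (sg * (l + e)) a) k =
  D k * (branch_op n j sg a k + e * branch_op' n j sg a k - sg * e ^+ 2 * branch_id n j sg a k).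
Proof.
have D0 : D k != 0 by exact: branch_diag_neq0.
have -> : D k * (branch_op n j sg a k + e * branch_op' n j sg a k - sg * e ^+ 2 * branch_id n j sg a k) =
  ((lam k - l) * (lam k + sg * l) * a k
    - k.+1%:R * k.+2%:R * (lam k + lam k.+2 + sg * l - l) * a k.+2
    + k.+1%:R * k.+2%:R * (k.+3%:R * k.+4%:R) * a k.+4) +
  e * (((sg - 1) * lam k - 2 * sg * l) * a k - (sg - 1) * (k.+1%:R * k.+2%:R) * a k.+2) -
  sg * e ^+ 2 * a k.
  rewrite /branch_op /branch_op' /branch_id /band; move: (D k) D0 (lam k) (lam k.+2) l => d d0 x y z.
  by field.
rewrite /shifted_laplacec /laplacec -/(lam k) -/(lam k.+2).
by move: (lam k) (lam k.+2) l => x y z; ring.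
Qed.

Lemma shifted_laplacec_geg b k : shifted_laplacec n b P k = (l + b) * P k.
Proof. by rewrite /shifted_laplacec laplacec_geg// mulrDl. Qed.

Lemma shifted_laplacecZ b c (a : nat -> R) k :
  shifted_laplacec n b (fun i => c * a i) k = c * shifted_laplacec n b a k.
Proof. by rewrite /shifted_laplacec /laplacec; ring. Qed.

Lemma shifted_laplacecD b (a a' : nat -> R) k :
  shifted_laplacec n b (fun i => a i + a' i) k =
  shifted_laplacec n b a k + shifted_laplacec n b a' k.
Proof. by rewrite /shifted_laplacec /laplacec; ring. Qed.

(** With v = 1 + s Z, [H] is (v^q - 1) / q. After division by s r D_k, the equation is its linear
    part in (y, eta) plus [r * Phi]. In order, the terms of [Phi] come from the part of [H] of order
    s^2, from the first and second order terms in the shift of kappa, and from the right-hand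
    side. *)
Lemma zonal_branch : exists delta r0, [/\ 0 < delta, delta <= 2^-1, 0 < r0, r0 <= 1 &
  forall r, 0 <= r <= r0 -> exists eta y, [/\ `|eta| <= 1, bnd delta 1 y &
    let s := - r ^+ 2 in let kappa := l + r * eta in
    let Z := fun k => P k + r * y k in
    let H := fun k => s * Z k + s ^+ 2 / q%:R * binrem q s Z k in
    forall k, shifted_laplacec n (- kappa) (shifted_laplacec n (sg * kappa) H) k =
      om * kappa ^+ 2 / q%:R * s ^+ 2 * (binrem m s Z k - p * binrem q s Z k)]].
Proof.
have [delta [d0 d2 HL]] := @branch_lin_contraction R n j sg n_gt2 j_gt0 sg_ge1.
have [MP HP] := bnd_polyc d0 (@geg R n j).
pose iq : R := q%:R^-1.
pose y (x : nat -> R) : nat -> R := fun k => if k == j then 0 else x k.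
pose Z r x : nat -> R := fun k => P k + r * y x k.
pose Q i r x : nat -> R := binrem i (- r ^+ 2) (Z r x).
pose V r x : nat -> R := fun k => y x k + (- iq * r) * Q q r x k.
pose W r x : nat -> R := fun k => Z r x k + (- iq * (r * r)) * Q q r x k.
pose kap r (x : nat -> R) := l + r * x j.
pose Phi r x : nat -> R := fun k => (- iq) * branch_op n j sg (Q q r x) k +
  (x j * branch_op' n j sg (V r x) k +
  ((- sg * (x j * x j)) * branch_id n j sg (W r x) k +
   (om * iq * (kap r x * kap r x)) *
     branch_id n j sg (fun k => Q m r x k + (- p) * Q q r x k) k)).
have Ly : lip delta (fun _ x => y x) by exact: lip_erase.
have LZ : lip delta Z.
  exact: (lipD (lip_cst d0 HP) (lipZ d0 (lips_var d0) Ly)).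
have Lr : lips delta (fun r _ => - r ^+ 2).
  apply: (lips_param d0); exists 1 => r _ _ /andP[r_0 r_1]; split=> //.
  by rewrite normrN ger0_norm ?exprn_ge0// exprn_ile1.
have LQ i : lip delta (Q i) by exact: (lip_binrem d0 i Lr LZ).
have Lx : lips delta (fun _ x => x j) by exact: lips_coord.
have LV : lip delta V.
  apply: (lipD Ly); apply: (lipZ d0 _ (LQ q)).
  exact: (lipsM (lips_cst d0 _) (lips_var d0)).
have LW : lip delta W.
  apply: (lipD LZ); apply: (lipZ d0 _ (LQ q)).
  exact: (lipsM (lips_cst d0 _) (lipsM (lips_var d0) (lips_var d0))).
have Lk : lips delta kap.
  exact: (lipsD (lips_cst d0 _) (lipsM (lips_var d0) Lx)).
have LPhi : lip delta Phi.
  apply: lipD; first by apply: (lipZ d0 (lips_cst d0 _)); exact: lip_branch_op.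
  apply: lipD; first by apply: (lipZ d0 Lx); exact: lip_branch_op'.
  apply: lipD.
    apply: (lipZ d0 (lipsM (lips_cst d0 _) (lipsM Lx Lx))); exact: lip_branch_id.
  apply: (lipZ d0 (lipsM (lips_cst d0 _) (lipsM Lk Lk))); apply: lip_branch_id => //.
  exact: (lipD (LQ m) (lipZ d0 (lips_cst d0 _) (LQ q))).
have [r0 /andP[r00 r01] HF] := lip_fixed_point d0 HL (@branch_linB R n j sg) LPhi.
exists delta, r0; split => // r rr0; have [x [x1 Hx]] := HF r rr0.
exists (x j), (y x); split.
- have := lips_coord d0 d2 j; move: (x1 j); rewrite mul1r => /le_trans h _; apply: h.
  by have := weight_le1 d0 d2 j; have := weight_gt0 d0 j; lra.
- move=> k; rewrite /y; case: ifP => // _; rewrite normr0 mul1r; exact/ltW/weight_gt0.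
move=> s kappa Z' H k.
have D0 : D k != 0 by exact: branch_diag_neq0.
(* The fixed point equation in its original form. For k <> j the diagonal entry of [branch_op] is 1
   and returns x_k; for k = j it is 0, and x_j is returned by the term in P, as P_j = 1 and D_j = -
   (sg + 1) l. *)
have E : branch_op n j sg (y x) k - (sg + 1) * l * x j * P k / D k + r * Phi r x k = 0.
  have := Hx k; rewrite /branch_lin.
  have -> : band (fun k => 0 / D k)
     (fun k => (k.+1%:R * k.+2%:R * (lam k + lam k.+2 + sg * l - l)) / D k)
     (fun k => - (k.+1%:R * k.+2%:R * (k.+3%:R * k.+4%:R)) / D k)
     (fun k => if k == j then 0 else x k) k =
     (lam k - l) * (lam k + sg * l) / D k * y x k - branch_op n j sg (y x) k.
    by rewrite /branch_op /band /y; ring.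
  move: (branch_op n j sg (y x) k) (Phi r x k) => A F.
  rewrite /y /branch_diag; case: eqVneq => [->|kj] Ek.
    rewrite mulr1n mulr0 add0r in Ek.
    have h1 := @eigenval_ge1 R n j n_gt2 j_gt0.
    have h2 : (sg + 1) * l != 0.
      by rewrite gt_eqF// mulr_gt0//; [move: sg_ge1|]; lra.
    have -> : r * F = - A + x j * ((sg + 1) * l * (P j - 1) / - ((sg + 1) * l)) - x j.
      by set X := - A + _ in Ek *; rewrite -Ek; ring.
    by move: (P j) (x j) ((sg + 1) * l) h2 => P1 e u u0; field.
  have dk : (lam k - l) * (lam k + sg * l) != 0.
    by have := D0; rewrite /branch_diag (negbTE kj).
  rewrite divff// mul1r mulr0n in Ek.
  set X := x k - A + _ in Ek.
  have -> : r * F = X - x k by rewrite -[in RHS]Ek; ring.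
  rewrite /X.
  by move: dk; move: (_ * _) => d dk; field.
have -> : H = fun k => s * (P k + (r * y x k + (- (r * r * iq)) * Q q r x k)).
  apply/funext => i; rewrite /H /Z' /Q /Z /s -/iq.
  by ring.
rewrite (_ : shifted_laplacec n (sg * kappa) _ = fun i => s * ((l + sg * kappa) * P i +
   (r * shifted_laplacec n (sg * kappa) (y x) i +
   (- (r * r * iq)) * shifted_laplacec n (sg * kappa) (Q q r x) i))); last first.
  apply/funext => i; rewrite shifted_laplacecZ shifted_laplacecD shifted_laplacec_geg.
  by rewrite shifted_laplacecD !shifted_laplacecZ.
rewrite shifted_laplacecZ shifted_laplacecD shifted_laplacecZ shifted_laplacec_geg.
rewrite shifted_laplacecD !shifted_laplacecZ.
rewrite /kappa !(shifted_laplacec2E (r * x j)).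
have EV : branch_op' n j sg (V r x) k = branch_op' n j sg (y x) k - iq * r * branch_op' n j sg (Q q r x) k.
  by rewrite /branch_op' /band /V; ring.
have EI a : branch_id n j sg a k = a k / D k by rewrite /branch_id /band; ring.
move: E; rewrite /Phi EV !EI /W /Z /kap -/(Z' k) => E.
rewrite -[binrem q s Z' k]/(Q q r x k) -[binrem m s Z' k]/(Q m r x k) -/iq.
apply/eqP; rewrite -subr_eq0; apply/eqP.
(* The difference of the two sides is s r D_k times the fixed point equation [E]. *)
rewrite -[RHS](mulr0 (s * r * D k)) -E.
rewrite (_ : Z' k = P k + r * y x k)// /s /iq.
move: (branch_op n j sg (y x) k) (branch_op' n j sg (y x) k) (branch_op n j sg (Q q r x) k)
  (branch_op' n j sg (Q q r x) k) (Q q r x k) (Q m r x k) (y x k) (x j) (P k) (D k) D0 l q%:R^-1.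
move=> A1 A2 A3 A4 Q1 Q2 y1 e P1 d d0' l1 iq1.
by field.
Qed.

End bifurcation.

(** * Energy of the bifurcating solutions *)

Section sphere_solutions.
Context {R : realType}.

Lemma analytic_binrem i (s : R) z : analytic z -> analytic (binrem i s z).
Proof.
move=> Hz; elim: i => [|i IH] /=.
  by apply: analytic_eq (analytic_const 0) => -[].
by apply: analyticD => //; apply: analyticD; apply: analyticZ; exact: analytic_cmul.
Qed.

Lemma psum_binrem i (s : R) z t : analytic z -> `|t| <= 1 ->
  (1 + s * psum z t) ^+ i = 1 + i%:R * s * psum z t + s ^+ 2 * psum (binrem i s z) t.
Proof.
move=> Hz t1; elim: i => [|i IH] /=.
  have -> : psum (fun=> 0) t = 0 :> R.
    rewrite -[RHS](psum_const 0 t); congr (psum _ t).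
    by apply/funext => -[].
  by rewrite expr0; ring.
have Hb := analytic_binrem i s Hz.
have Hzz := analytic_cmul Hz Hz; have Hzb := analytic_cmul Hz Hb.
rewrite exprS IH (psumD Hb (analyticD (analyticZ _ Hzz) (analyticZ _ Hzb)) t1).
rewrite (psumD (analyticZ _ Hzz) (analyticZ _ Hzb) t1).
rewrite (psumZ _ Hzz t1) (psumZ _ Hzb t1) (psum_mul Hz Hz t1) (psum_mul Hz Hb t1).
by rewrite -(natr1 i); ring.
Qed.

Lemma pow_taylor3 i : exists2 K : R, 0 <= K & forall w, `|w| <= 1 ->
  `|(1 + w) ^+ i - (1 + i%:R * w + i%:R * (i%:R - 1) / 2 * w ^+ 2 +
    i%:R * (i%:R - 1) * (i%:R - 2) / 6 * w ^+ 3)| <= K * w ^+ 4.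
Proof.
elim: i => [|i [K K0 IH]].
  exists 0 => // w _; rewrite expr0 (_ : _ - _ = 0) ?normr0 ?mul0r//.
  by field.
pose c := i%:R * (i%:R - 1) * (i%:R - 2) / 6 : R.
exists (2 * K + `|c|); first by rewrite addr_ge0// mulr_ge0.
move=> w w1.
set A := (X in X - _); set B := (X in _ - X).
have -> : A - B = (1 + w) * ((1 + w) ^+ i - (1 + i%:R * w + i%:R * (i%:R - 1) / 2 * w ^+ 2 +
    i%:R * (i%:R - 1) * (i%:R - 2) / 6 * w ^+ 3)) + c * w ^+ 4.
  by rewrite /A /B /c exprS -(natr1 i); field.
rewrite (le_trans (ler_normD _ _))// [leRHS]mulrDl lerD//.
  rewrite normrM -[leRHS]mulrA ler_pM//; last exact: IH.
  by rewrite (le_trans (ler_normD _ _))// normr1; lra.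
by rewrite normrM ler_wpM2l// ger0_norm// exprn_even_ge0.
Qed.

(* All the terms of order less than 3 cancel. *)
Lemma energy_density_taylor n : (4 < n)%N -> exists C K : R, [/\ 0 < C, 0 <= K &
  forall w, `|w| <= 1 -> (1 + w) ^+ (2 * n) - 1 -
    n%:R / 4 * ((1 + w) ^+ (n + 4) - (1 + w) ^+ (n - 4)) <= C * w ^+ 3 + K * w ^+ 4].
Proof.
move=> n4.
have [K1 K10 H1] := pow_taylor3 (2 * n); have [K2 K20 H2] := pow_taylor3 (n + 4).
have [K3 K30 H3] := pow_taylor3 (n - 4).
have n5 : 5 <= n%:R :> R by rewrite (ler_nat _ 5).
exists (n%:R * (n%:R + 4) * (n%:R - 4) / 3), (K1 + n%:R / 4 * (K2 + K3)); split.
- by rewrite divr_gt0// !mulr_gt0//; lra.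
- by rewrite addr_ge0// mulr_ge0// ?addr_ge0// divr_ge0.
move=> w w1.
have := H1 w w1; have := H2 w w1; have := H3 w w1.
rewrite natrM natrD natrB ?(ltnW n4)//.
move: ((1 + w) ^+ (2 * n)) ((1 + w) ^+ (n + 4)) ((1 + w) ^+ (n - 4)) => A B C.
rewrite !ler_norml => /andP[c1 c2] /andP[b1 b2] /andP[a1 a2].
have n0 : 0 <= n%:R / 4 :> R by lra.
have h1 := ler_wpM2l n0 b1; have h2 := ler_wpM2l n0 c2.
rewrite -subr_ge0.
set N := n%:R : R in n5 n0 h1 h2 a2 *.
have -> : N * (N + 4) * (N - 4) / 3 * w ^+ 3 + (K1 + N / 4 * (K2 + K3)) * w ^+ 4 -
    (A - 1 - N / 4 * (B - C)) =
  (K1 * w ^+ 4 - (A - (1 + 2 * N * w + 2 * N * (2 * N - 1) / 2 * w ^+ 2 +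
     2 * N * (2 * N - 1) * (2 * N - 2) / 6 * w ^+ 3))) +
  (N / 4 * (B - (1 + (N + 4) * w + (N + 4) * (N + 4 - 1) / 2 * w ^+ 2 +
     (N + 4) * (N + 4 - 1) * (N + 4 - 2) / 6 * w ^+ 3)) - N / 4 * - (K2 * w ^+ 4)) +
  (N / 4 * (K3 * w ^+ 4) - N / 4 * (C - (1 + (N - 4) * w + (N - 4) * (N - 4 - 1) / 2 * w ^+ 2 +
     (N - 4) * (N - 4 - 1) * (N - 4 - 2) / 6 * w ^+ 3))).
  by field.
by apply: addr_ge0; [apply: addr_ge0|]; rewrite subr_ge0.
Qed.

Section dimension.
Variable n : nat.
Local Notation N := n.+1.
Local Notation V := 'rV[R]_N.
Local Notation sphere := (@sphere R n).
Local Notation dvol := (@dvol R n).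
Local Notation sint f := (Rintegral dvol sphere f).
Implicit Types (x : V) (a : nat -> R).

Lemma sphere_nonempty : exists x : V, sphere x.
Proof.
exists (radproj (delta_mx ord0 ord0)); apply: sphere_radproj.
by apply/eqP => /matrixP/(_ ord0 ord0)/eqP; rewrite !mxE eqxx oner_eq0.
Qed.

Lemma laplace_cst (c : R) x : sphere x -> laplace (fun=> c) x = 0.
Proof.
move=> Sx; rewrite laplaceE big1 ?oppr0// => i _.
rewrite (spartial_eq i (g := fun=> 0)) ?spartial_cst ?sphere_neq0// => y _.
exact: spartial_cst.
Qed.

(** Self-adjointness against the constant 1, which the Laplacian annihilates. *)
Lemma sint_shifted_laplacec b a : analytic a ->
  sint (zonal (shifted_laplacec n b a)) = b * sint (zonal a).
Proof.
move=> Ha; have su := @smooth_zonal R n a Ha.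
have H := shifted_laplace_selfadjoint b Ha (@smooth_cst R n 1).
rewrite -(sintZ b (smooth_bounded su)).
have E1 := sint_eq (f := zonal (shifted_laplacec n b a))
  (g := fun x => 1 * zonal (shifted_laplacec n b a) x) (fun x _ => esym (mul1r _)).
rewrite E1 -H; apply: sint_eq => x Sx.
by rewrite laplace_cst// add0r mulr1 mulrC.
Qed.

Lemma energyE (u : V -> R) : sphere_bounded (fun x => `|u x| `^ crit_exp n) ->
  energy u = (sint (fun x => `|u x| `^ crit_exp n))%:E.
Proof.
move=> bu; rewrite /energy /Rintegral fineK//.
by apply: integrable_fin_num; [exact: measurable_sphere|exact: sphere_bounded_integrable].
Qed.

Lemma shifted_laplacec_cst (b c : R) k : shifted_laplacec n b (constc c) k = b * constc c k.
Proof.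
rewrite /shifted_laplacec /laplacec; case: k => [|k] /=; ring.
Qed.

Lemma shifted_laplacec2 (b b' : R) a k : shifted_laplacec n b (shifted_laplacec n b' a) k =
  laplacec n (laplacec n a) k + (b + b') * laplacec n a k + b * b' * a k.
Proof. by rewrite /shifted_laplacec /laplacec; ring. Qed.

End dimension.

End sphere_solutions.

(** * From the coefficient equation to solutions on the sphere and their energy *)

Section zonal_solution.
Context {R : realType} (n : nat).
Hypothesis n_gt4 : (4 < n)%N.
Local Notation N := n.+1.
Local Notation V := 'rV[R]_N.
Local Notation sphere := (@sphere R n).
Local Notation dvol := (@dvol R n).
Local Notation sint f := (Rintegral dvol sphere f).
Local Notation q := (n - 4)%N.
Local Notation m := (n + 4)%N.
Local Notation crit := (@crit_exp R n).
Implicit Types (x : V).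

Let n5 : @Order.le _ R 5 n%:R. Proof. by rewrite (ler_nat _ 5). Qed.

Let qE : q%:R = n%:R - 4 :> R. Proof. by rewrite natrB// ltnW. Qed.

Let mE : m%:R = n%:R + 4 :> R. Proof. by rewrite natrD. Qed.

Let q_gt0 : @Order.lt _ R 0 q%:R. Proof. by rewrite ltr0n subn_gt0. Qed.

Definition growth : R := Num.sqrt (m%:R / q%:R).

Lemma growth_gt1 : 1 < growth.
Proof.
rewrite -[ltLHS]sqrtr1 ltr_sqrt; rewrite ltr_pdivlMr ?mul1r// ?qE ?mE; have := n5; lra.
Qed.

Lemma growth_sqr : growth ^+ 2 = m%:R / q%:R.
Proof. by rewrite sqr_sqrtr// divr_ge0. Qed.

Lemma crit_exp_sub1 : crit - 1 = m%:R / q%:R.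
Proof. by rewrite /crit_exp qE mE; field; rewrite gt_eqF//; have := n5; lra. Qed.

Lemma pow_crit_sub1 (v : R) : 0 < v -> (v ^+ q) `^ (crit - 1) = v ^+ m.
Proof.
move=> v0; have v1 := ltW v0.
rewrite -!powR_mulrn// -powRrM crit_exp_sub1; congr (_ `^ _).
by field; rewrite gt_eqF.
Qed.

Lemma pow_crit (v : R) : 0 < v -> (v ^+ q) `^ crit = v ^+ (2 * n).
Proof.
move=> v0; have v1 := ltW v0.
rewrite -!powR_mulrn// -powRrM; congr (_ `^ _).
by rewrite /crit_exp natrM qE; field; rewrite gt_eqF//; have := n5; lra.
Qed.

Lemma smoothX (f : V -> R) i : smooth f -> smooth (fun x => f x ^+ i).
Proof.
move=> sf; elim: i => [|i IH].
  by apply: smooth_eq (@smooth_cst R n 1) => x _; rewrite expr0.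
by apply: smooth_eq (smoothM sf IH) => x _; rewrite exprS.
Qed.

Variables (Z : nat -> R) (s kappa : R).
Hypothesis HZ : analytic Z.
Hypothesis kappa_gt0 : 0 < kappa.

Let H : nat -> R := fun k => s * Z k + s ^+ 2 / q%:R * binrem q s Z k.

(** This is (L + beta)^2 v^q = beta^2 v^m for H = (v^q - 1) / q, with (m/q) beta^2 H subtracted from
    both sides: the left side factors, the terms linear in Z cancel on the right, and kappa /
    (growth - 1) is beta. *)
Hypothesis HE : forall k, shifted_laplacec n (- kappa)
  (shifted_laplacec n ((growth + 1) / (growth - 1) * kappa) H) k =
  ((growth - 1) ^+ 2)^-1 * kappa ^+ 2 / q%:R * s ^+ 2 *
    (binrem m s Z k - m%:R / q%:R * binrem q s Z k).

Let v x := 1 + s * zonal Z x.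

Hypothesis v_gt0 : forall x, sphere x -> 0 < v x.

Let alpha := 2 * (kappa / (growth - 1)).

Let beta := alpha / 2.

Let betaE : beta = kappa / (growth - 1).
Proof. by rewrite /beta /alpha mulrAC divff ?mul1r// pnatr_eq0. Qed.

Let g1 : 0 < growth - 1.
Proof. by rewrite subr_gt0 growth_gt1. Qed.

Lemma beta_gt0 : 0 < beta.
Proof. by rewrite betaE divr_gt0. Qed.

Let ub : R := const_solution n alpha 0.

Let ubE : ub = (beta ^+ 2) `^ ((n%:R - 4) / 8).
Proof.
rewrite /ub /const_solution; congr (_ `^ _); rewrite /beta.
by field.
Qed.

Lemma ub_gt0 : 0 < ub.
Proof. by rewrite ubE powR_gt0// exprn_gt0// beta_gt0. Qed.

(** The constant [ub] solves the equation: the exponent is 1 + 8 / (n - 4), and ub^(8/(n-4)) =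
    beta^2. *)
Lemma ub_pow : ub `^ (crit - 1) = ub * beta ^+ 2.
Proof.
have n4 : n%:R - 4 != 0 :> R by rewrite gt_eqF//; have := n5; lra.
have -> : crit - 1 = 1 + 8 / (n%:R - 4) by rewrite /crit_exp; field.
rewrite powRD ?(gt_eqF ub_gt0) ?implybT// powRr1 ?(ltW ub_gt0)//.
rewrite {2}ubE -powRrM (_ : (n%:R - 4) / 8 * (8 / (n%:R - 4)) = 1); last by field.
by rewrite powRr1// exprn_ge0// (ltW beta_gt0).
Qed.

Definition branch_solution : nat -> R := fun k => ub * (constc 1 k + q%:R * H k).
Local Notation a := branch_solution.

Let HB i := analytic_binrem i s HZ.

Let analytic_pow i : analytic (fun k => constc 1 k + (i%:R * s * Z k + s ^+ 2 * binrem i s Z k)).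
Proof.
apply: analyticD; first exact: analytic_const.
by apply: analyticD; apply: analyticZ.
Qed.

Let zonal_pow i x : sphere x ->
  zonal (fun k => constc 1 k + (i%:R * s * Z k + s ^+ 2 * binrem i s Z k)) x = v x ^+ i.
Proof.
move=> Sx; have t1 := sphere_coord_le1 ord0 Sx.
rewrite /v /zonal psum_binrem// (psumD (analytic_const _) _ t1); last first.
  by apply: analyticD; apply: analyticZ.
rewrite (psumD (analyticZ _ HZ) (analyticZ _ (HB i)) t1).
by rewrite (psumZ _ HZ t1) (psumZ _ (HB i) t1) psum_const addrA.
Qed.

Let branch_solutionE k :
  a k = ub * (constc 1 k + (q%:R * s * Z k + s ^+ 2 * binrem q s Z k)).
Proof.
have q0 : q%:R != 0 :> R by rewrite gt_eqF.
by rewrite /a /H; field.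
Qed.

Lemma analytic_branch_solution : analytic a.
Proof.
apply: (analytic_eq (fun k => esym (branch_solutionE k))).
by apply: analyticZ; exact: analytic_pow.
Qed.

Lemma zonal_branch_solution x : sphere x -> zonal a x = ub * v x ^+ q.
Proof.
move=> Sx; rewrite -(zonal_pow q Sx) -(zonalZ ub (analytic_pow q) Sx).
by congr (zonal _ x); apply/funext => k; exact: branch_solutionE.
Qed.

Lemma shifted_laplacec_branch_solution k :
  shifted_laplacec n beta (shifted_laplacec n beta a) k =
  (ub * beta ^+ 2) * (constc 1 k + (m%:R * s * Z k + s ^+ 2 * binrem m s Z k)).
Proof.
have q0 : q%:R != 0 :> R by rewrite gt_eqF.
have gg : growth - 1 != 0 by rewrite gt_eqF.
have EH : shifted_laplacec n beta (shifted_laplacec n beta H) k =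
    shifted_laplacec n (- kappa) (shifted_laplacec n ((growth + 1) / (growth - 1) * kappa) H) k +
    m%:R / q%:R * beta ^+ 2 * H k.
  rewrite !shifted_laplacec2 -growth_sqr betaE.
  by move: (laplacec n (laplacec n H) k) (laplacec n H k) (H k) => A B C; field.
have -> : shifted_laplacec n beta a = fun i => ub * (beta * constc 1 i + q%:R * shifted_laplacec n beta H i).
  apply/funext => i; rewrite /a shifted_laplacecZ shifted_laplacecD shifted_laplacec_cst.
  by rewrite shifted_laplacecZ.
rewrite shifted_laplacecZ shifted_laplacecD !shifted_laplacecZ shifted_laplacec_cst.
rewrite EH HE betaE /H.
move: (binrem m s Z k) (binrem q s Z k) (Z k) (constc 1 k) => A B C D.
by field; rewrite gg q0.
Qed.

Let zonal_rhs x : sphere x ->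
  zonal (shifted_laplacec n beta (shifted_laplacec n beta a)) x = (ub * beta ^+ 2) * v x ^+ m.
Proof.
move=> Sx; rewrite -(zonal_pow m Sx) -(zonalZ _ (analytic_pow m) Sx).
by congr (zonal _ x); apply/funext => k; exact: shifted_laplacec_branch_solution.
Qed.

Let a_gt0 x : sphere x -> 0 < zonal a x.
Proof. by move=> Sx; rewrite zonal_branch_solution// mulr_gt0 ?ub_gt0// exprn_gt0// v_gt0. Qed.

Let a_eq x : sphere x ->
  zonal (shifted_laplacec n beta (shifted_laplacec n beta a)) x = zonal a x `^ (crit - 1).
Proof.
move=> Sx; rewrite zonal_rhs// zonal_branch_solution//.
rewrite powRM ?(ltW ub_gt0)// ?exprn_ge0 ?(ltW (v_gt0 Sx))//.
by rewrite ub_pow pow_crit_sub1// v_gt0.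
Qed.

Lemma branch_classical_solution : classical_solution alpha (zonal a : V -> R).
Proof. exact: zonal_classical_solution analytic_branch_solution a_gt0 a_eq. Qed.

Lemma branch_H22_solution : H22_solution alpha (zonal a : V -> R).
Proof. exact: zonal_H22_solution analytic_branch_solution a_gt0 a_eq. Qed.

Let smooth_v : smooth v.
Proof.
apply: smoothD; first exact: smooth_cst.
by apply: smoothM; [exact: smooth_cst|exact: smooth_zonal].
Qed.

Let bounded_pow i := smooth_bounded (smoothX i smooth_v).

(* Test the equation against the constant [1]. *)
Lemma branch_moment : sint (fun x => v x ^+ m) = sint (fun x => v x ^+ q).
Proof.
have b0 := beta_gt0; have u0 := ub_gt0; have Ha := analytic_branch_solution.
have c0 : ub * beta ^+ 2 != 0 by rewrite gt_eqF// mulr_gt0// exprn_gt0.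
apply: (mulfI c0).
rewrite -(sintZ _ (bounded_pow m)) -(sint_eq zonal_rhs).
rewrite (@sint_shifted_laplacec R n beta _ (analytic_shifted_laplacec n beta Ha)).
rewrite (@sint_shifted_laplacec R n beta _ Ha) (sint_eq zonal_branch_solution).
by rewrite (sintZ _ (bounded_pow q)); ring.
Qed.

Hypothesis moment_lt : sint (fun x => v x ^+ (2 * n)) < fine (dvol sphere).

Lemma branch_energy_lt : (energy (zonal a : V -> R) < energy (const_solution n alpha))%E.
Proof.
have u0 := ub_gt0.
have E1 x : sphere x -> `|zonal a x| `^ crit = ub `^ crit * v x ^+ (2 * n).
  move=> Sx; rewrite (gtr0_norm (a_gt0 Sx)) zonal_branch_solution//.
  rewrite powRM ?(ltW ub_gt0)// ?exprn_ge0 ?(ltW (v_gt0 Sx))//.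
  by rewrite pow_crit// v_gt0.
have b1 := sphere_boundedM (sphere_bounded_cst n (ub `^ crit)) (bounded_pow (2 * n)).
rewrite (energyE (sphere_bounded_eq b1 (fun x Sx => esym (E1 x Sx)))) (sint_eq E1).
rewrite (sintZ _ (bounded_pow (2 * n))).
have E2 x : sphere x -> `|const_solution n alpha x| `^ crit = ub `^ crit.
  by move=> _; rewrite -[const_solution n alpha x]/ub gtr0_norm.
rewrite (energyE (sphere_bounded_eq (sphere_bounded_cst n _) (fun x Sx => esym (E2 x Sx)))).
rewrite (sint_eq E2) sint_cst lte_fin ltr_pM2l//.
exact: powR_gt0.
Qed.

(** If [v] were constant, the equality of the moments of orders q and m = q + 8 would force v^8 = 1,
    hence v = 1, against the strict inequality [moment_lt]. *)
Lemma branch_nonconstant : ~ (exists c : R, forall x, sphere x -> zonal a x = c).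
Proof.
move=> [c Hc]; have [x0 S0] := @sphere_nonempty R n; have v0 := v_gt0 S0.
have q0 : (0 < q)%N by rewrite subn_gt0.
have vE x : sphere x -> v x = v x0.
  move=> Sx; have v1 := v_gt0 Sx.
  have : ub * v x ^+ q = ub * v x0 ^+ q by rewrite -!zonal_branch_solution// !Hc.
  move/(mulfI (lt0r_neq0 ub_gt0))/eqP; rewrite eqrXn2 ?ltW//.
  by move/eqP.
have D0 := @fine_dvol_sphere_gt0 R n.
have EX i : sint (fun x => v x ^+ i) = v x0 ^+ i * fine (dvol sphere).
  by rewrite -sint_cst; apply: sint_eq => x Sx; rewrite vE.
have := branch_moment; rewrite !EX => /(mulIf (lt0r_neq0 D0)).
move=> Emq.
have : v x0 ^+ q * v x0 ^+ 8 = v x0 ^+ q * 1.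
  rewrite mulr1 -exprD -[RHS]Emq; congr (_ ^+ _).
  by rewrite -[in RHS](subnK (ltnW n_gt4)) -addnA.
move/(mulfI (lt0r_neq0 (exprn_gt0 q v0)))/eqP.
rewrite -[X in _ == X](expr1n _ 8) eqrXn2 ?ltW// => /eqP v01.
by have := moment_lt; rewrite EX v01 expr1n mul1r ltxx.
Qed.

End zonal_solution.

(** * Choice of the parameters and the energy inequality *)

Section bifurcating_solutions.
Context {R : realType} (n : nat).
Hypothesis n_gt4 : (4 < n)%N.
Local Notation N := n.+1.
Local Notation V := 'rV[R]_N.
Local Notation sphere := (@sphere R n).
Local Notation dvol := (@dvol R n).
Local Notation sint f := (Rintegral dvol sphere f).
Local Notation q := (n - 4)%N.
Local Notation m := (n + 4)%N.
Implicit Types (x : V).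

(** The inverse of [r] is taken to be the sum of three lower bounds, one for each condition. *)
Lemma exists_small (r0 A B e : R) : 0 < r0 -> 0 <= A -> 0 <= B -> 0 < e ->
  exists r, [/\ 0 < r, r <= r0, 2 * (r * A) <= 1 & r * B < e].
Proof.
move=> r00 A0 B0 e0; pose S := r0^-1 + 2 * A + (B + 1) / e.
have i0 : 0 < r0^-1 by rewrite invr_gt0.
have t0 : 0 < (B + 1) / e by rewrite divr_gt0//; lra.
have S0 : 0 < S by rewrite /S; lra.
have rS : S^-1 * S = 1 by rewrite mulVf// gt_eqF.
have r1 : 0 < S^-1 by rewrite invr_gt0.
have h1 : 0 < S^-1 * r0^-1 by rewrite mulr_gt0.
have h2 : 0 <= S^-1 * A by rewrite mulr_ge0// ltW.
have h3 : 0 < S^-1 * ((B + 1) / e) by rewrite mulr_gt0.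
rewrite /S !mulrDr -/S in rS; exists S^-1; split => //.
- rewrite -[leRHS]mul1r -ler_pdivrMr//; lra.
- lra.
- have : S^-1 * ((B + 1) / e) <= 1 by lra.
  rewrite mulrA ler_pdivrMr// mul1r mulrDr mulr1; lra.
Qed.

(* [s = - r^2] is negative, so that the cubic term lowers the energy. *)
Lemma energy_density_branch (C K A r z p y : R) : 0 < C -> 0 <= K -> 0 <= r <= 1 ->
  `|p| <= A -> `|y| <= 1 -> z = p + r * y -> `|z| <= A ->
  C * (- r ^+ 2 * z) ^+ 3 + K * (- r ^+ 2 * z) ^+ 4 <=
  - (C * r ^+ 6) * p ^+ 3 + r ^+ 7 * (C * (3 * A ^+ 2) + K * A ^+ 4).
Proof.
move=> C0 K0 /andP[r0 r1] pA y1 zE zA; have A0 := le_trans (normr_ge0 _) pA.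
have h : `|z ^+ 3 - p ^+ 3| <= r * (3 * A ^+ 2).
  have -> : z ^+ 3 - p ^+ 3 = r * (y * (z ^+ 2 + z * p + p ^+ 2)) by rewrite zE; ring.
  rewrite normrM ger0_norm// ler_wpM2l// normrM -[leRHS]mul1r ler_pM//.
  have a1 : `|z ^+ 2| <= A ^+ 2 by rewrite normrX lerXn2r ?nnegrE.
  have a2 : `|p ^+ 2| <= A ^+ 2 by rewrite normrX lerXn2r ?nnegrE.
  have a3 : `|z * p| <= A ^+ 2 by rewrite normrM expr2 ler_pM.
  have := ler_normD (z ^+ 2 + z * p) (p ^+ 2); have := ler_normD (z ^+ 2) (z * p).
  lra.
have h4 : z ^+ 4 <= A ^+ 4.
  by rewrite -[z ^+ 4]ger0_norm ?exprn_even_ge0// normrX lerXn2r ?nnegrE.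
have h3 : - z ^+ 3 <= - p ^+ 3 + r * (3 * A ^+ 2).
  by move: h; rewrite ler_norml => /andP[]; lra.
have -> : C * (- r ^+ 2 * z) ^+ 3 + K * (- r ^+ 2 * z) ^+ 4 =
  (C * r ^+ 6) * (- z ^+ 3) + (K * r ^+ 7) * (r * z ^+ 4) by ring.
have -> : - (C * r ^+ 6) * p ^+ 3 + r ^+ 7 * (C * (3 * A ^+ 2) + K * A ^+ 4) =
  (C * r ^+ 6) * (- p ^+ 3 + r * (3 * A ^+ 2)) + (K * r ^+ 7) * A ^+ 4 by ring.
rewrite lerD//; apply: ler_wpM2l => //; rewrite ?mulr_ge0 ?exprn_ge0// ?(ltW C0)//.
have z4 : 0 <= z ^+ 4 by rewrite exprn_even_ge0.
by rewrite (le_trans _ h4)// ler_piMl.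
Qed.

Lemma exists_solution k : exists alpha : R, [/\ 0 < alpha,
  k%:R * (2 / (growth n - 1)) <= alpha,
  exists u : V -> R, classical_solution alpha u /\
    ~ (exists c : R, forall x, sphere x -> u x = c) &
  (min_energy n alpha < energy (const_solution n alpha))%E].
Proof.
have n2 : (2 < n)%N by rewrite (ltn_trans _ n_gt4).
have g1 : 0 < growth n - 1 :> R by rewrite subr_gt0 growth_gt1.
(* Even, for the positivity of the integral of p_j^3, and growing with [k], so that [kappa], within
   distance 1 of the j-th eigenvalue, exceeds [k]. *)
pose j := (k.+1 + k.+1)%N.
have j0 : (0 < j)%N by [].
pose sg : R := (growth n + 1) / (growth n - 1).
have sg1 : 1 <= sg by rewrite /sg ler_pdivlMr//; lra.
have [delta [r0 [d0 d2 r00 r01 HB]]] :=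
  @zonal_branch R n j q m sg ((growth n - 1) ^+ 2)^-1 (m%:R / q%:R) n2 j0 sg1.
have [M HM] := bnd_polyc d0 (@geg R n j).
have M0 := bnd_ge0 d0 HM.
have [C [K [C0 K0 HE]]] := @energy_density_taylor R n n_gt4.
have J0 := @zint_geg_cube_gt0 R n n2 k.+1; rewrite -/j in J0.
set J := zint n (geg n j ^+ 3) in J0.
pose A := M + 1; pose X := C * (3 * A ^+ 2) + K * A ^+ 4.
have A0 : 0 <= A by rewrite /A; lra.
have X0 : 0 <= X.
  by rewrite /X addr_ge0// mulr_ge0 ?exprn_ge0 ?(ltW C0)// mulr_ge0// exprn_ge0.
have vol0 := @fine_dvol_sphere_gt0 R n; set vol := fine _ in vol0.
(* The bound 2 r A <= 1 keeps |v - 1| <= 1/2, whence v > 0; r X vol < C J makes the cubic gain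
   exceed the error of order r^7. *)
have [r [r_gt0 rr0 rA rX]] := exists_small r00 A0 (mulr_ge0 X0 (ltW vol0)) (mulr_gt0 C0 J0).
have r1 : 0 <= r <= 1 by rewrite (ltW r_gt0) (le_trans rr0).
have rr0' : 0 <= r <= r0 by rewrite (ltW r_gt0).
have [eta [y [eta1 y1 /= Heq]]] := HB r rr0'.
pose Z : nat -> R := fun i => polyc (geg n j) i + r * y i.
pose kappa : R := eigenval n j + r * eta.
have r2 : 2 * r <= 1.
  have : 1 <= A by rewrite /A; lra.
  by move=> /(ler_wpM2l (ltW r_gt0)); lra.
have lj : k.+2%:R <= eigenval n j :> R.
  have n3 : 3 <= n%:R :> R by rewrite (ler_nat _ 3).
  have kj : k.+2%:R <= j%:R :> R by rewrite ler_nat /j addSn !ltnS leq_addl.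
  have j0' : 0 <= j%:R :> R by [].
  rewrite /eigenval; apply: le_trans kj _; rewrite ler_peMr//.
  have h : 1 <= j%:R :> R by rewrite ler1n.
  by lra.
have ka : k%:R + 1 <= kappa.
  have : `|r * eta| <= 1.
    rewrite normrM gtr0_norm// -[leRHS]mul1r; apply: ler_pM => //; first exact: ltW.
    by case/andP: r1.
  rewrite ler_norml => /andP[h _].
  by move: lj; rewrite /kappa -(natr1 k.+1) -(natr1 k); lra.
have kappa0 : 0 < kappa by have : 0 <= k%:R :> R by []; lra.
have HP := bnd_analytic d0 d2 HM; have Hy := bnd_analytic d0 d2 y1.
have HZ : analytic Z by apply: analyticD => //; exact: analyticZ.
have ZE x : sphere x -> zonal Z x = (geg n j).[x ord0 ord0] + r * zonal y x.
  move=> Sx; rewrite (zonalD HP (analyticZ r Hy) Sx) (zonalZ _ Hy Sx).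
  by rewrite zonal_polyc.
have pM x : sphere x -> `|(geg n j).[x ord0 ord0]| <= M.
  move=> Sx; rewrite -(zonal_polyc (n := n)).
  exact: (bnd_psum d0 d2 HM (sphere_coord_le1 ord0 Sx)).
have yM x : sphere x -> `|zonal y x| <= 1.
  by move=> Sx; exact: (bnd_psum d0 d2 y1 (sphere_coord_le1 ord0 Sx)).
have ZA x : sphere x -> `|zonal Z x| <= A.
  move=> Sx; rewrite ZE// /A (le_trans (ler_normD _ _))// lerD ?pM//.
  rewrite normrM gtr0_norm// -[leRHS]mul1r; apply: ler_pM => //; first exact: ltW.
    by case/andP: r1.
  exact: yM.
have wS x : sphere x -> `|- r ^+ 2 * zonal Z x| <= 2^-1.
  move=> Sx; rewrite normrM normrN (ger0_norm (exprn_ge0 2 (ltW r_gt0))).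
  have h1 : r ^+ 2 * `|zonal Z x| <= r * A.
    rewrite expr2 -mulrA ler_wpM2l ?(ltW r_gt0)//.
    rewrite -[leRHS]mul1r; apply: ler_pM => //; first exact: ltW.
      by case/andP: r1.
    exact: ZA.
  by apply: le_trans h1 _; lra.
have v0 x : sphere x -> 0 < 1 + - r ^+ 2 * zonal Z x.
  by move=> /wS; rewrite ler_norml => /andP[]; lra.
(* Integrate the pointwise bound: by [branch_moment] the terms with factor n/4 cancel, so that the
   integral of v^(2n) minus the volume is at most r^6 (r X vol - C J) < 0. *)
have moment : sint (fun x => (1 + - r ^+ 2 * zonal Z x) ^+ (2 * n)) < vol.
  have E1 := branch_moment n_gt4 HZ kappa0 Heq.
  pose v x := 1 + - r ^+ 2 * zonal Z x.
  have sv : smooth v.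
    apply: smoothD; first exact: smooth_cst.
    by apply: smoothM; [exact: smooth_cst|exact: smooth_zonal].
  have bv i := smooth_bounded (smoothX i sv).
  have bk (c : R) := sphere_bounded_cst n c.
  have bp := smooth_bounded (@smooth_poly R n (geg n j ^+ 3)).
  pose f x := v x ^+ (2 * n) + ((-1) + ((- (n%:R / 4)) * v x ^+ m + (n%:R / 4) * v x ^+ q)).
  pose g x := (- (C * r ^+ 6)) * (geg n j ^+ 3).[x ord0 ord0] + r ^+ 7 * X.
  have b1 := sphere_boundedM (bk (- (n%:R / 4))) (bv m).
  have b2 := sphere_boundedM (bk (n%:R / 4)) (bv q).
  have b3 := sphere_boundedD b1 b2; have b4 := sphere_boundedD (bk (-1)) b3.
  have bf : sphere_bounded f := sphere_boundedD (bv (2 * n)%N) b4.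
  have b5 := sphere_boundedM (bk (- (C * r ^+ 6))) bp.
  have bg : sphere_bounded g := sphere_boundedD b5 (bk (r ^+ 7 * X)).
  have fg x : sphere x -> f x <= g x.
    move=> Sx; have w1 : `|- r ^+ 2 * zonal Z x| <= 1 by apply: le_trans (wS x Sx) _; lra.
    have := HE _ w1; rewrite -/(v x).
    have pA : `|(geg n j).[x ord0 ord0]| <= A.
      by apply: le_trans (pM x Sx) _; rewrite /A; lra.
    have := energy_density_branch C0 K0 r1 pA (yM x Sx) (ZE x Sx) (ZA x Sx).
    rewrite -/X /f /g horner_exp.
    move: (v x ^+ (2 * n)) (v x ^+ m) (v x ^+ q) => a b c; lra.
  have := sint_le bf bg fg.
  rewrite (sintD (bv (2 * n)%N) b4) (sintD (bk (-1)) b3) (sintD b1 b2).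
  rewrite (sintZ _ (bv m)) (sintZ _ (bv q)) (sintD b5 (bk _)) (sintZ _ bp) !sint_cst.
  rewrite -zintE -/J -/vol.
  have E2 : sint (fun x => v x ^+ m) = sint (fun x => v x ^+ q) := E1.
  rewrite E2.
  have r6 : 0 < r ^+ 6 by rewrite exprn_gt0.
  have r6X : r ^+ 6 * (r * (X * vol)) < r ^+ 6 * (C * J) by rewrite ltr_pM2l.
  rewrite -/(v _).
  have -> : - (C * r ^+ 6) * J + r ^+ 7 * X * vol = r ^+ 6 * (r * (X * vol)) - r ^+ 6 * (C * J).
    by ring.
  move: r6X; move: (r ^+ 6 * _) (r ^+ 6 * _) (sint _) (sint _) => a b c d; lra.
exists (2 * (kappa / (growth n - 1))); split.
- by rewrite mulr_gt0// divr_gt0.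
- rewrite mulrCA ler_wpM2l// ler_wpM2r ?invr_ge0 ?(ltW g1)//; lra.
- exists (zonal (branch_solution n Z (- r ^+ 2) kappa)); split.
    exact: (branch_classical_solution n_gt4 HZ kappa0 Heq v0).
  exact: (branch_nonconstant n_gt4 HZ kappa0 Heq v0 moment).
- apply: le_lt_trans (branch_energy_lt n_gt4 HZ kappa0 v0 moment).
  apply: ereal_inf_lbound; exists (zonal (branch_solution n Z (- r ^+ 2) kappa)) => //.
  exact: (branch_H22_solution n_gt4 HZ kappa0 Heq v0).
Qed.

End bifurcating_solutions.

Theorem mainTheorem3 (R : realType) (n : nat) (hn5 : (5 <= n)%N)
    (hnodd : odd n) :
  exists alpha : nat -> R,
    [/\ (forall k, 0 < alpha k),
        alpha @ \oo --> +oo &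
        forall k,
          (exists u : 'rV[R]_n.+1 -> R,
             classical_solution (alpha k) u /\
             ~ (exists c : R, forall x, sphere x -> u x = c)) /\
          (min_energy n (alpha k) < energy (const_solution n (alpha k)))%E].
Proof.
have [alpha H] := choice (@exists_solution R n hn5).
have c0 : 0 < 2 / (growth n - 1) :> R by rewrite divr_gt0// subr_gt0 growth_gt1.
exists alpha; split.
- by move=> k; have [] := H k.
- apply: (@ger_cvgy _ _ _ _ (fun k => k%:R * (2 / (growth n - 1)))).
    by apply: nearW => k; have [] := H k.
  apply/cvgryPge => A; have /cvgryPge/(_ (A / (2 / (growth n - 1)))) := @cvgr_idn R.
  by apply: filterS => k; rewrite ler_pdivrMr.
- by move=> k; have [_ _ H1 H2] := H k.
Qed.
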